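(* Let $G$ be a closed braid graph (with its outermost strand cut), and designate as special its outermost connected component (the one containing the cut edge). Let $G^{\mathtt e}$ denote $G$ with the framing in which every thin edge is $+1$ framed. Then $$\mathcal{B}(G^{\mathtt e})\cong\mathcal{A}(G),$$ where $\mathcal{A}(G)$ is the Ozsváth–Szabó knot Floer graph homology.
   Context: **Ground ring.** $\mathcal{R}=\mathbb{F}[t^{-1},t]]$ is the ring (field) of Laurent series in $t$ over a field $\mathbb{F}$. **Closed braid graphs.** Take an open braid diagram on $b$ strands, oriented upward, replace each crossing by a thick edge (with two incoming thin edges at its bottom vertex and two outgoing thin edges at its top vertex), possibly with bivalent vertices (one incoming, one outgoing thin edge) on strands, so that every connected component contains a thick edge or a bivalent vertex. Number positions $1,\dots,b$ from right to left and, for each $1\le i\le b-1$, join the top boundary edge in position $i$ to the bottom boundary edge in position $i$ into a single thin edge. The strand in position $b$ is left open (the cut edge), giving one bottom and one top boundary thin edge. The result is a closed braid graph. **Framing and edge ring.** A framing assigns an integer $\ell_e$ to each thin edge $e$. Each thin edge $e$ has variables $x_e$ (first segment) and $y_e$ (second segment); $\mathcal{E}(G)=\mathcal{R}[x_e,y_e]/(t^{\ell_e}y_e-x_e)_e\cong\mathcal{R}[x_e]$, so $y_e=t^{-\ell_e}x_e$. **Ideals in $\mathcal{E}(G)$.** The linear ideal $L(G)$ is generated by $(x_a+x_b)-(y_c+y_d)$ for each thick edge with outgoing thin edges $a,b$ and incoming thin edges $c,d$. The non-local ideal $N(G)$ is generated by $t^{\mathbf{w}(\Gamma)}x_{\Gamma,\mathrm{out}}-y_{\Gamma,\mathrm{in}}$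 over all sets $\Gamma$ of thick edges and bivalent vertices, where $\mathbf{w}(\Gamma)$ is the sum of the framings of thin edges with both ends in $\Gamma$, $x_{\Gamma,\mathrm{out}}$ is the product of $x_e$ over thin edges $e$ from $\Gamma$ to its complement (or the top boundary), and $y_{\Gamma,\mathrm{in}}$ is the product of $y_e$ over thin edges $e$ into $\Gamma$ from its complement (or the bottom boundary). **Graph homology.** Let $V_G$ be the free $\mathcal{E}(G)$-module spanned by the non-special connected components of $G$. Then $$\mathcal{B}(G)=\mathrm{Tor}_*^{\mathcal{E}(G)}\big(\mathcal{E}(G)/L(G),\,\mathcal{E}(G)/N(G)\big)\otimes\Lambda^*V_G .$$ **The algebra $\mathcal{A}(G)$ (Ozsváth–Szabó).** $\mathcal{A}(G)$ is the quotient of $\mathcal{R}[x_e: e\text{ a thin edge of }G]$ by the relations: $t(x_a+x_b)=x_c+x_d$ for each thick edge with outgoing thin edges $a,b$ and incoming thin edges $c,d$; and, for each set $\Gamma$ of thick edges and bivalent vertices, $t^{w(\Gamma)}\prod_{e\text{ out of }\Gamma}x_e=\prod_{e\text{ into }\Gamma}x_e$, where $w(\Gamma)$ is twice the number of thick edges plus the number of bivalent vertices in $\Gamma$, and the products run over thin edges from $\Gamma$ to its complement (or top boundary) and into $\Gamma$ from its complement (or bottom boundary). (These contain the quadratic relations $t^2x_ax_b=x_cx_d$ at thick edges and $tx_a=x_c$ at bivalent vertices.) It is regarded as concentrated in degree $0$ (the $\mathrm{Tor}$ and exterior degree), and the isomorphism is one of $\mathcal{E}(G^{\mathtt e})=\mathcal{R}[x_e]$-modules.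 *)

(* Defs.v *)
From HB Require Import structures.
From mathcomp Require Import all_boot all_order all_algebra.
From mathcomp Require Import ring_quotient boolp freeg mpoly.
From mathcomp Require Import zify.

Set Implicit Arguments.
Unset Strict Implicit.
Unset Printing Implicit Defensive.

Import GRing.Theory Num.Theory Order.TTheory.
Local Open Scope ring_scope.
Local Open Scope quotient_scope.

Section Laurent.
Variable F : fieldType.

Definition bounded_below (f : int -> F) : Prop :=
  exists N : nat, forall k : int, k < - N%:Z -> f k = 0.

(* [f k] is the coefficient of [t ^ k]. *)
Record laurent := Laurent { lcoef :> int -> F; _ : `[< bounded_below lcoef >] }.

HB.instance Definition _ := [isSub for lcoef].
HB.instance Definition _ := [Choice of laurent by <:].

Implicit Types f g h : laurent.

Lemma laurentP f g : (forall k, f k = g k) <-> f = g.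
Proof. by split=> [fg | -> //]; apply/val_inj/funext. Qed.

Definition mk_laurent (f : int -> F) (bf : bounded_below f) : laurent :=
  Laurent (introT (asboolP _) bf).

Lemma laurent_bounded f : bounded_below f.
Proof. by case: f => f /= /asboolP. Qed.

Definition lbound f : nat := sval (cid (laurent_bounded f)).

Lemma lbound_lt f k : k < - (lbound f)%:Z -> f k = 0.
Proof. exact: (svalP (cid (laurent_bounded f))). Qed.

Lemma mono_bounded (c : F) (n : int) :
  bounded_below (fun k => if k == n then c else 0).
Proof. by exists (absz (n)) => k kn; case: eqP => // ?; lia. Qed.
(* c * t ^ n *)
Definition lmono c n := mk_laurent (mono_bounded c n).

Lemma zero_bounded : bounded_below (fun=> 0).
Proof. by exists 0%N. Qed.
Definition lzero := mk_laurent zero_bounded.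

Lemma opp_bounded f : bounded_below (fun k => - f k).
Proof. by exists (lbound f) => k kf; rewrite lbound_lt ?oppr0. Qed.
Definition lopp f := mk_laurent (opp_bounded f).

Lemma add_bounded f g : bounded_below (fun k => f k + g k).
Proof.
by exists (lbound f + lbound g)%N => k kfg; rewrite !lbound_lt ?addr0 //; lia.
Qed.
Definition ladd f g := mk_laurent (add_bounded f g).

Lemma laddA : associative ladd.
Proof. by move=> f g h; apply/laurentP => k /=; rewrite addrA. Qed.
Lemma laddC : commutative ladd.
Proof. by move=> f g; apply/laurentP => k /=; rewrite addrC. Qed.
Lemma ladd0 : left_id lzero ladd.
Proof. by move=> f; apply/laurentP => k /=; rewrite add0r. Qed.
Lemma laddN : left_inverse lzero lopp ladd.
Proof. by move=> f; apply/laurentP => k /=; rewrite addNr. Qed.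

HB.instance Definition _ := GRing.isZmodule.Build laurent laddA laddC ladd0 laddN.

(* The sum of [f i * g (n - i)] over the [i] with both factors possibly nonzero,
   that is [- lbound f <= i <= n + lbound g]. *)
Definition lmul_coef f g (n : int) : F :=
  \sum_(j < (absz (n + (lbound f)%:Z + (lbound g)%:Z)).+1)
     f (j%:Z - (lbound f)%:Z) * g (n - (j%:Z - (lbound f)%:Z)).

Lemma window (h : int -> F) (a b : int) (K L : nat) :
  (forall i, h i != 0 -> a <= i < a + K%:Z) ->
  (forall i, h i != 0 -> b <= i < b + L%:Z) ->
  \sum_(j < K) h (a + j%:Z) = \sum_(j < L) h (b + j%:Z).
Proof.
move=> ha hb.
have seqE c M : \sum_(j < M) h (c + j%:Z) =
    \sum_(i <- [seq i <- [seq c + j%:Z | j <- iota 0 M] | h i != 0]) h i.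
  rewrite big_filter big_map (_ : iota 0 M = index_iota 0 M) ?big_mkord /=; last by rewrite /index_iota subn0.
  rewrite [LHS](bigID (fun j : 'I_M => h (c + j%:Z) != 0)) /=.
  by rewrite [X in _ + X]big1 ?addr0 // => i; rewrite negbK => /eqP.
rewrite !seqE; apply/perm_big/uniq_perm.
- by rewrite filter_uniq // map_inj_uniq ?iota_uniq // => i j; lia.
- by rewrite filter_uniq // map_inj_uniq ?iota_uniq // => i j; lia.
move=> i; rewrite !mem_filter; case: (boolP (h i != 0)) => //= hi.
have mem c M : c <= i < c + M%:Z -> i \in [seq c + j%:Z | j <- iota 0 M].
  move=> ci; apply/mapP; exists (absz (i - c)); last by lia.
  by rewrite mem_iota; lia.
by rewrite !mem ?ha ?hb.
Qed.

Lemma lmul_coefE f g (N M : nat) n (a : int) (K : nat) :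
  (forall k, k < - N%:Z -> f k = 0) -> (forall k, k < - M%:Z -> g k = 0) ->
  a <= - N%:Z -> n + M%:Z < a + K%:Z ->
  lmul_coef f g n = \sum_(j < K) f (a + j%:Z) * g (n - (a + j%:Z)).
Proof.
move=> fN gM aN nK.
rewrite /lmul_coef; under eq_bigr do rewrite addrC.
apply: (@window (fun i => f i * g (n - i))) => i fg0.
- have : - (lbound f)%:Z <= i.
    by rewrite leNgt; apply: contra fg0 => /lbound_lt->; rewrite mul0r.
  have : - (lbound g)%:Z <= n - i.
    by rewrite leNgt; apply: contra fg0 => /lbound_lt->; rewrite mulr0.
  by lia.
- have : - N%:Z <= i by rewrite leNgt; apply: contra fg0 => /fN->; rewrite mul0r.
  have : - M%:Z <= n - i.
    by rewrite leNgt; apply: contra fg0 => /gM->; rewrite mulr0.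
  by lia.
Qed.

Lemma mul_bounded f g : bounded_below (lmul_coef f g).
Proof.
exists (lbound f + lbound g)%N => n nfg.
rewrite (@lmul_coefE f g (lbound f) (lbound g) n (- (lbound f)%:Z) 0) ?big_ord0 //.
- exact: lbound_lt.
- exact: lbound_lt.
by lia.
Qed.
Definition lmul f g := mk_laurent (mul_bounded f g).

Lemma lmul_lt f g (N M : nat) n :
  (forall k, k < - N%:Z -> f k = 0) -> (forall k, k < - M%:Z -> g k = 0) ->
  n < - (N + M)%N%:Z -> lmul f g n = 0.
Proof.
move=> fN gM nNM; rewrite /= (@lmul_coefE f g N M n (- N%:Z) 0) ?big_ord0 //.
by lia.
Qed.

(* [f * t ^ N] truncated at degree [K], as a polynomial. *)
Definition trunc (K N : nat) (f : int -> F) : {poly F} :=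
  \poly_(i < K) f (i%:Z - N%:Z).

Lemma lmul_trunc f g (N M K n : nat) : (n < K)%N ->
  (forall k, k < - N%:Z -> f k = 0) -> (forall k, k < - M%:Z -> g k = 0) ->
  lmul f g (n%:Z - (N + M)%N%:Z) = (trunc K N f * trunc K M g)`_n.
Proof.
move=> nK fN gM; rewrite /= (@lmul_coefE f g N M _ (- N%:Z) n.+1) //; last by lia.
rewrite coefM; apply: eq_bigr => i _; rewrite !coef_poly.
rewrite (leq_ltn_trans (leq_ord i) nK) (leq_ltn_trans (leq_subr _ _) nK).
by congr (f _ * g _); have := leq_ord i; lia.
Qed.

Lemma lbound_ge f (N : nat) : (lbound f <= N)%N ->
  forall k, k < - N%:Z -> f k = 0.
Proof. by move=> fN k kN; apply: lbound_lt; lia. Qed.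

Lemma lmulC : commutative lmul.
Proof.
move=> f g; apply/laurentP => k; pose N := maxn (lbound f) (lbound g).
have fN := lbound_ge (leq_maxl _ _ : lbound f <= N)%N.
have gN := lbound_ge (leq_maxr _ _ : lbound g <= N)%N.
have [kN | kN] := ltP k (- (N + N)%N%:Z); first by rewrite !(@lmul_lt _ _ N N).
have -> : k = (absz (k + (N + N)%N%:Z))%:Z - (N + N)%N%:Z by lia.
by rewrite !(lmul_trunc (ltnSn _)) // mulrC.
Qed.

Lemma lmulA : associative lmul.
Proof.
move=> f g h; apply/laurentP => k.
pose N := maxn (lbound f) (maxn (lbound g) (lbound h)).
have fN := @lbound_ge f N ltac:(lia); have gN := @lbound_ge g N ltac:(lia).
have hN := @lbound_ge h N ltac:(lia).
have fgN j := @lmul_lt f g N N j fN gN; have ghN j := @lmul_lt g h N N j gN hN.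
have [kN | kN] := ltP k (- (N + (N + N))%N%:Z).
  by rewrite (@lmul_lt _ _ N (N + N)) // (@lmul_lt _ _ (N + N) N) //; lia.
set n := (absz (k + (N + (N + N))%N%:Z)).
have -> : k = n%:Z - (N + (N + N))%N%:Z by lia.
have tr (u v : laurent) : (forall k, k < - N%:Z -> u k = 0) -> (forall k, k < - N%:Z -> v k = 0) ->
    forall i, (i < n.+1)%N ->
    (trunc n.+1 (N + N) (lmul u v))`_i = (trunc n.+1 N u * trunc n.+1 N v)`_i.
  by move=> uN vN i iK; rewrite coef_poly iK (lmul_trunc iK).
rewrite (lmul_trunc (ltnSn n)) // addnA (lmul_trunc (ltnSn n)) //.
rewrite coefM (eq_bigr (fun i : 'I_n.+1 => (trunc n.+1 N f)`_i *
   (trunc n.+1 N g * trunc n.+1 N h)`_(n - i))); last first.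
  by move=> i _; rewrite tr // ltnS leq_subr.
rewrite -coefM mulrA coefM [RHS]coefM.
by apply: eq_bigr => i _; rewrite tr.
Qed.

Definition lone := lmono 1 0.

Lemma lmonoE f c (m : int) k : lmul (lmono c m) f k = c * f (k - m).
Proof.
have mm : forall i : int, i < - (absz (m))%:Z -> lmono c m i = 0.
  by move=> i im /=; case: eqP => // ?; lia.
pose a : int := - (absz (m))%:Z.
pose K := ((absz (k + (lbound f)%:Z - a)%R).+1 + absz m + absz m)%N.
rewrite /= (@lmul_coefE _ f (absz m) (lbound f) _ a K) //; first last.
- by rewrite /K /a; lia.
- exact: lbound_lt.
have mK : (absz (m - a)%R < K)%N by rewrite /K /a; lia.
rewrite (bigD1 (Ordinal mK)) //= big1 ?addr0.
  by have -> : a + (absz (m - a))%:Z = m; rewrite ?eqxx // /a; lia.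
move=> i /eqP im; case: eqP => [aim|_]; last by rewrite mul0r.
by case: im; apply: val_inj => /=; lia.
Qed.

Lemma lmul1 : left_id lone lmul.
Proof. by move=> f; apply/laurentP => k; rewrite lmonoE mul1r subr0. Qed.

Lemma lmulDl : left_distributive lmul ladd.
Proof.
move=> f g h; apply/laurentP => k.
pose N := maxn (lbound f) (maxn (lbound g) (lbound h)).
have fN := @lbound_ge f N ltac:(lia); have gN := @lbound_ge g N ltac:(lia).
have hN := @lbound_ge h N ltac:(lia).
have fgN j : j < - N%:Z -> ladd f g j = 0 by move=> jN /=; rewrite fN ?gN ?addr0.
pose K := (absz (k + N%:Z + N%:Z)).+1.
have E (u : laurent) : (forall j, j < - N%:Z -> u j = 0) -> lmul u h k =
    \sum_(j < K) u (- N%:Z + j%:Z) * h (k - (- N%:Z + j%:Z)).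
  by move=> uN; rewrite /= (@lmul_coefE u h N N k (- N%:Z) K) //; rewrite /K; lia.
transitivity (lmul f h k + lmul g h k); last by [].
rewrite !E // -big_split /=.
by apply: eq_bigr => j _; rewrite mulrDl.
Qed.

Lemma lone_neq0 : lone != 0.
Proof. by apply/eqP => /laurentP/(_ 0)/eqP; rewrite /= oner_eq0. Qed.

HB.instance Definition _ := GRing.Zmodule_isComNzRing.Build laurent
  lmulA lmulC lmul1 lmulDl lone_neq0.

Fixpoint inv_seq (a : nat -> F) (n : nat) : seq F :=
  if n is m.+1 then
    rcons (inv_seq a m)
      ((a 0%N)^-1 * ((m == 0%N)%:R - \sum_(i < m) a (m - i)%N * (inv_seq a m)`_i))
  else [::].

Lemma inv_seqP (a : nat -> F) : a 0%N != 0 ->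
  exists c : nat -> F, forall n,
    \sum_(i < n.+1) c i * a (n - i)%N = (n == 0%N)%:R.
Proof.
move=> a0; exists (fun n => (inv_seq a n.+1)`_n) => n.
have size_inv m : size (inv_seq a m) = m by elim: m => //= m IH; rewrite size_rcons IH.
have nth_inv m i : (i < m)%N -> (inv_seq a m)`_i = (inv_seq a i.+1)`_i.
  elim: m => // m IH; rewrite ltnS leq_eqVlt => /orP[/eqP-> // | im].
  by rewrite [inv_seq a m.+1]/= nth_rcons size_inv im IH.
rewrite big_ord_recr subnn /= nth_rcons size_inv ltnn eqxx.
rewrite mulrC mulrA mulfV // mul1r addrC -[RHS]addr0 -addrA; congr (_ + _).
rewrite addrC; apply/eqP; rewrite subr_eq0; apply/eqP.
by apply: eq_bigr => i _; rewrite [RHS]mulrC -[(rcons _ _)`_i]/((inv_seq a i.+1)`_i) (nth_inv n).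
Qed.

Lemma laurent_order f : f != 0 ->
  exists m : int, f m != 0 /\ forall k, k < m -> f k = 0.
Proof.
move=> f0; have [k fk] : exists k, f k != 0.
  apply: contrapT => nf; case/eqP: f0; apply/laurentP => k.
  by apply: contrapT => /eqP fk; apply: nf; exists k.
have exP : exists n : nat, f (n%:Z - (lbound f)%:Z) != 0.
  exists (absz (k + (lbound f)%:Z)); have kf : - (lbound f)%:Z <= k.
    by rewrite leNgt; apply: contra fk => /lbound_lt->.
  by rewrite (_ : _ - _ = k) //; lia.
case: (ex_minnP exP) => n fn nmin; exists (n%:Z - (lbound f)%:Z); split=> // j jn.
apply: contrapT => /eqP fj; have jf : - (lbound f)%:Z <= j.
  by rewrite leNgt; apply: contra fj => /lbound_lt->.
have := nmin (absz (j + (lbound f)%:Z)); rewrite (_ : _ - _ = j); last by lia.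
by move/(_ fj); lia.
Qed.

Lemma laurent_inv_ex f : f != 0 -> exists g : laurent, g * f = 1.
Proof.
move=> /laurent_order[m [fm fm0]].
have fm1 : f (m + 0%N%:Z) != 0 by rewrite addr0.
have [c cP] := @inv_seqP (fun n => f (m + n%:Z)) fm1.
have gb : bounded_below (fun k => if k < - m then 0 else c (absz (k + m))).
  by exists (absz (m)) => k km; case: ifP => //; lia.
exists (mk_laurent gb); apply/laurentP => k.
pose g := mk_laurent gb.
have gm : forall j, j < - m -> g j = 0 by move=> j /= ->.
have glt : forall j, j < - (absz (m))%:Z -> g j = 0 by move=> j jm; apply: gm; lia.
have flt : forall j, j < - (absz (m))%:Z -> f j = 0 by move=> j jm; apply: fm0; lia.
have -> : (g * f : laurent) k = \sum_(j < (absz k).+1) g (- m + j%:Z) * f (k - (- m + j%:Z)).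
  pose K := (absz m + absz m + absz k + absz m + 1)%N.
  rewrite [LHS](@lmul_coefE g f (absz m) (absz m) k (- (absz (m))%:Z) K) //; last by rewrite /K; lia.
  apply: (@window (fun i => g i * f (k - i))) => i gf0.
    have : - m <= i by rewrite leNgt; apply: contra gf0 => /gm->; rewrite mul0r.
    have : m <= k - i by rewrite leNgt; apply: contra gf0 => /fm0->; rewrite mulr0.
    by rewrite /K; lia.
  have : - m <= i by rewrite leNgt; apply: contra gf0 => /gm->; rewrite mul0r.
  have : m <= k - i by rewrite leNgt; apply: contra gf0 => /fm0->; rewrite mulr0.
  by lia.
case: (ltP k 0) => k0.
  rewrite big1 => [|j _]; first by rewrite /=; case: eqP => //; lia.
  by rewrite fm0 ?mulr0 //; lia.
transitivity (\sum_(i < (absz k).+1) c i * f (m + (absz k - i)%N%:Z)).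
  apply: eq_bigr => i _ /=; rewrite ifF; last by lia.
  by congr (c _ * f _); have := leq_ord i; lia.
by rewrite cP /= absz_eq0; case: eqP.
Qed.

Definition linv f : laurent :=
  if pselect (exists g : laurent, g * f = 1) is left ex then sval (cid ex) else 0.

Lemma linvV f : f != 0 -> linv f * f = 1.
Proof.
move=> /laurent_inv_ex ex; rewrite /linv; case: pselect => // ex'.
exact: (svalP (cid ex')).
Qed.

Lemma linv0 : linv 0 = 0.
Proof.
rewrite /linv; case: pselect => // ex; exfalso; case: ex => g.
by rewrite mulr0 => /esym/eqP; rewrite oner_eq0.
Qed.

HB.instance Definition _ := GRing.ComNzRing_isField.Build laurent linvV linv0.

Definition tvar : laurent := lmono 1 1.

End Laurent.

Section LinearMaps.
Variables (E : comNzRingType).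

Section LinearSpan.
Variables (V : lmodType E) (S : V -> Prop).

Inductive lin_span : V -> Prop :=
| lin_span0 : lin_span 0
| lin_spanZD a x y : S x -> lin_span y -> lin_span (a *: x + y).

Definition span : {pred V} := fun v => `[< lin_span v >].

Lemma spanP v : reflect (lin_span v) (v \in span).
Proof. exact: asboolP. Qed.

Lemma gen_span v : S v -> v \in span.
Proof.
by move=> Sv; apply/spanP; rewrite -[v]addr0 -[v]scale1r;
  apply: lin_spanZD => //; exact: lin_span0.
Qed.

Lemma span_submod_closed : submod_closed span.
Proof.
split=> [|a u v /spanP uP /spanP vP]; first exact/spanP/lin_span0.
apply/spanP; elim: uP => [|b x y Sx _ IH]; first by rewrite scaler0 add0r.
by rewrite scalerDr scalerA -addrA; apply: lin_spanZD.
Qed.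

Lemma span_subsemimod_closed : subsemimod_closed span.
Proof.
have [s0 sZD] := span_submod_closed; split; first split=> // u v uS vS.
  by rewrite -[u]scale1r; apply: sZD.
by move=> a u uS; rewrite -[_ *: _]addr0; apply: sZD.
Qed.

HB.instance Definition _ :=
  GRing.isSubmodClosed.Build E V span span_subsemimod_closed.

(* The quotient of [V] by the submodule generated by the relations [S]. *)
Definition modquot := Quotient.quot span.

HB.instance Definition _ := GRing.Zmodule.on modquot.

Definition modquot_pi (v : V) : modquot := \pi_(Quotient.quot span) v.

Lemma modquot_pi_eq u v : modquot_pi u = modquot_pi v <-> u - v \in span.
Proof. by rewrite Quotient.idealrBE; split=> [/eqP | /eqP]. Qed.

Lemma modquot_reprK x : modquot_pi (repr x) = x.
Proof. exact: reprK. Qed.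

Lemma modquot_piD u v : modquot_pi (u + v) = modquot_pi u + modquot_pi v.
Proof. exact: (raddfD \pi_(Quotient.quot span)). Qed.

Definition modquot_scale a (x : modquot) : modquot := modquot_pi (a *: repr x).

Lemma modquot_scale_pi a v : modquot_scale a (modquot_pi v) = modquot_pi (a *: v).
Proof.
apply/modquot_pi_eq; rewrite -scalerBr rpredZ //.
by apply/modquot_pi_eq; rewrite modquot_reprK.
Qed.

Lemma modquot_scalerA a b x :
  modquot_scale a (modquot_scale b x) = modquot_scale (a * b) x.
Proof. by rewrite -[x]modquot_reprK !modquot_scale_pi scalerA. Qed.

Lemma modquot_scale1r : left_id 1 modquot_scale.
Proof. by move=> x; rewrite -[x]modquot_reprK modquot_scale_pi scale1r. Qed.

Lemma modquot_scalerDr : right_distributive modquot_scale +%R.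
Proof.
move=> a x y; rewrite -[x]modquot_reprK -[y]modquot_reprK.
by rewrite -modquot_piD !modquot_scale_pi -modquot_piD scalerDr.
Qed.

Lemma modquot_scalerDl x :
  {morph (modquot_scale^~ x : E -> modquot) : a b / a + b}.
Proof.
by move=> a b; rewrite -[x]modquot_reprK !modquot_scale_pi -modquot_piD scalerDl.
Qed.

HB.instance Definition _ := GRing.Zmodule_isLmodule.Build E modquot
  modquot_scalerA modquot_scale1r modquot_scalerDr modquot_scalerDl.

Lemma modquot_pi_linear : linear modquot_pi.
Proof. by move=> a u v; rewrite modquot_piD -modquot_scale_pi. Qed.

HB.instance Definition _ :=
  GRing.isLinear.Build E V modquot *:%R modquot_pi modquot_pi_linear.

End LinearSpan.

Section Kernel.
Variables (V W : lmodType E) (f : {linear V -> W}).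

Definition lker : {pred V} := fun v => f v == 0.

Lemma lker_subsemimod_closed : subsemimod_closed lker.
Proof.
split=> [|a u /eqP fu0]; last by apply/eqP; rewrite linearZ /= fu0 scaler0.
split=> [|u v /eqP fu0 /eqP fv0]; apply/eqP; first exact: linear0.
by rewrite linearD fu0 fv0 addr0.
Qed.

HB.instance Definition _ :=
  GRing.isSubmodClosed.Build E V lker lker_subsemimod_closed.

Record kernel := Kernel { kernel_val :> V; _ : kernel_val \in lker }.

HB.instance Definition _ := [isSub for kernel_val].
HB.instance Definition _ := [Choice of kernel by <:].
HB.instance Definition _ := [SubChoice_isSubLmodule of kernel by <:].

End Kernel.

(* Cycles modulo boundaries of [U -d'-> V -d-> W]. *)
Definition homology (U V W : lmodType E)
    (d' : {linear U -> V}) (d : {linear V -> W}) : lmodType E :=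
  modquot (fun z : kernel d => exists u, val z = d' u).

(* Finitely supported formal sums, with basis [fgen s] for [s : S]. *)
Definition free_module (S : choiceType) : lmodType E := {freeg S / E}.

Definition fgen (S : choiceType) (s : S) : free_module S := << s >>.

Definition free_lift (S : choiceType) (M : lmodType E) (g : S -> M) :
  free_module S -> M := fglift g.

Lemma free_lift_linear (S : choiceType) (M : lmodType E) (g : S -> M) : linear (@free_lift S M g).
Proof.
have liftB (u v : {freeg S / E}) : fglift g (u - v) = fglift g u - fglift g v.
  exact: lift_is_additive.
have lift0 : fglift g 0 = 0 by rewrite -(subrr 0) liftB subrr.
have liftD (u v : {freeg S / E}) : fglift g (u + v) = fglift g u + fglift g v.
  by rewrite -[v]opprK liftB -(sub0r (- v)) liftB lift0 sub0r.
have lift_sum (r : seq S) (c : S -> E) :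
    fglift g (\sum_(x <- r) << c x *g x >>) = \sum_(x <- r) c x *: g x.
  elim: r => [|x r IH]; first by rewrite !big_nil.
  by rewrite !big_cons liftD IH liftU.
have liftZ a (u : {freeg S / E}) : fglift g (a *: u) = a *: fglift g u.
  have -> : a *: u = \sum_(z <- dom u) << a * coeff z u *g z >> by [].
  rewrite lift_sum -[in RHS](freeg_sumE u) lift_sum scaler_sumr.
  by apply: eq_bigr => z _; rewrite scalerA.
by move=> a u v; rewrite /free_lift liftD liftZ.
Qed.

HB.instance Definition _ (S : choiceType) (M : lmodType E) (g : S -> M) :=
  GRing.isLinear.Build E (free_module S) M *:%R (@free_lift S M g)
    (@free_lift_linear S M g).

Lemma free_lift_gen (S : choiceType) (M : lmodType E) (g : S -> M) s : free_lift g (fgen s) = g s.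
Proof. by rewrite /free_lift liftU scale1r. Qed.

Section Tensor.
Variables M N : lmodType E.

Inductive tensor_rel : free_module (M * N)%type -> Prop :=
| tensor_rel_l a m m' n :
    tensor_rel (fgen (a *: m + m', n) - a *: fgen (m, n) - fgen (m', n))
| tensor_rel_r a m n n' :
    tensor_rel (fgen (m, a *: n + n') - a *: fgen (m, n) - fgen (m, n')).

Definition tensor : lmodType E := modquot tensor_rel.

Definition tens (m : M) (n : N) : tensor := modquot_pi tensor_rel (fgen (m, n)).

End Tensor.

Lemma tens_linearl (M N : lmodType E) (n : N) : linear (fun m : M => tens m n).
Proof.
move=> a m m'; apply/eqP; rewrite -subr_eq0 -linearZ -linearD -linearB /=.
by apply/eqP; rewrite -(linear0 (modquot_pi _)); apply/modquot_pi_eq;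
  rewrite subr0 opprD addrA; apply/gen_span/tensor_rel_l.
Qed.

Lemma tens_linearr (M N : lmodType E) (m : M) : linear (fun n : N => tens m n).
Proof.
move=> a n n'; apply/eqP; rewrite -subr_eq0 -linearZ -linearD -linearB /=.
by apply/eqP; rewrite -(linear0 (modquot_pi _)); apply/modquot_pi_eq;
  rewrite subr0 opprD addrA; apply/gen_span/tensor_rel_r.
Qed.

Section TensorMap.
Variables (M M' N : lmodType E) (f : {linear M -> M'}).

Definition tensor_map (x : tensor M N) : tensor M' N :=
  free_lift (fun p => tens (f p.1) p.2) (repr x).

Lemma tensor_map_pi u :
  tensor_map (modquot_pi _ u) = free_lift (fun p => tens (f p.1) p.2) u.
Proof.
pose F : {linear free_module (M * N)%type -> tensor M' N} :=
  free_lift (fun p => tens (f p.1) p.2).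
have F0 w : lin_span (@tensor_rel M N) w -> F w = 0.
  elim=> [|a x y Rx _ IH]; first exact: linear0.
  rewrite linearP IH addr0; have -> : F x = 0; last exact: scaler0.
  case: Rx => [b m m' n | b m n n']; rewrite !linearB linearZ /= !free_lift_gen /=.
    by rewrite [f _]linearP (tens_linearl n b) addrAC addrK subrr.
  by rewrite (tens_linearr (f m) b) addrAC addrK subrr.
apply/eqP; rewrite -subr_eq0 -[X in X - _]/(F _) -[X in _ - X]/(F _) -linearB.
by apply/eqP/F0/spanP/modquot_pi_eq; rewrite modquot_reprK.
Qed.

Lemma tensor_map_tens m n : tensor_map (tens m n) = tens (f m) n.
Proof. by rewrite tensor_map_pi free_lift_gen. Qed.

Lemma tensor_map_linear : linear tensor_map.
Proof.
move=> a x y; rewrite -[x]modquot_reprK -[y]modquot_reprK -linearP.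
by rewrite !tensor_map_pi linearP.
Qed.

HB.instance Definition _ :=
  GRing.isLinear.Build E (tensor M N) (tensor M' N) *:%R tensor_map
    tensor_map_linear.

End TensorMap.
Arguments tensor_map {M M'} N f _.

Section Tor.
Variables M N : lmodType E.

(* Tor is computed from the canonical free resolution
   ... -> res 1 -> res 0 -> M -> 0, where [res n] is the free module on all
   elements of the n-th syzygy module: [iter_syzygy 0] is [M], and
   [iter_syzygy n.+1] is the kernel of [res n -> iter_syzygy n]. *)
Definition syzygy (M : lmodType E) : lmodType E :=
  kernel (@free_lift M M id).

Definition iter_syzygy (n : nat) : lmodType E := iter n syzygy M.

Definition res (n : nat) : lmodType E := free_module (iter_syzygy n).

Definition res_d (n : nat) (x : res n.+1) : res n :=
  kernel_val (@free_lift (iter_syzygy n.+1) (iter_syzygy n.+1) id x).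

Lemma res_d_linear n : linear (@res_d n).
Proof. by move=> a x y; rewrite /res_d linearP. Qed.

HB.instance Definition _ n :=
  GRing.isLinear.Build E (res n.+1) (res n) *:%R (@res_d n) (@res_d_linear n).

Definition Tor (n : nat) : lmodType E :=
  if n is m.+1 then homology (tensor_map N (@res_d m.+1)) (tensor_map N (@res_d m))
  else homology (tensor_map N (@res_d 0)) (\0 : tensor (res 0) N -> tensor (res 0) N).

End Tor.

Section ExteriorPower.
Variables (k : nat) (V : lmodType E).

Definition upd (v : {ffun 'I_k -> V}) (i : 'I_k) (x : V) : {ffun 'I_k -> V} :=
  [ffun j => if j == i then x else v j].

Inductive ext_rel : free_module {ffun 'I_k -> V} -> Prop :=
| ext_rel_lin v i a x y :
    ext_rel (fgen (upd v i (a *: x + y)) - a *: fgen (upd v i x)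
             - fgen (upd v i y))
| ext_rel_alt (v : {ffun 'I_k -> V}) i j : i != j -> v i = v j -> ext_rel (fgen v).

(* The quotient of the free module on the [k]-tuples of [V] by multilinearity
   and by the tuples with a repeated entry. *)
Definition ext_power : lmodType E := modquot ext_rel.

End ExteriorPower.

Definition lin_iso (M N : lmodType E) : Prop :=
  exists f : {linear M -> N}, bijective f.

Definition ring_mod : lmodType E := E^o.

End LinearMaps.

Inductive letter (b : nat) : Type :=
| Thick of 'I_b
| Bivalent of 'I_b.+1.

(* A diagram on [cut_strand.+1] strands, numbered from right to left by
   0, ..., cut_strand, read upwards as a sequence of letters: [Thick k] is a
   thick edge joining the strands [k] and [k.+1], [Bivalent i] a bivalent vertex
   on the strand [i]. *)
Record braid_diagram : Type := BraidDiagram {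
  cut_strand : nat;
  height : nat;
  word : 'I_height -> letter cut_strand
}.

Section Graph.
Variable D : braid_diagram.
Local Notation b := (cut_strand D).
Local Notation n := (height D).

(* A thick edge is a single vertex of the graph, of valence two in and two
   out. *)
Definition vertex : finType := 'I_n.
Definition strand : finType := 'I_b.+1.

Definition thick (v : vertex) : bool :=
  if word v is Thick _ then true else false.

Definition meets (v : vertex) (i : strand) : bool :=
  match word v with
  | Thick k => (i == k :> nat) || (i == k.+1 :> nat)
  | Bivalent j => i == j
  end.

(* [(i, l)] is the piece of the strand [i] at level [l], between the letters
   [l.-1] and [l] (the bottom boundary if [l = 0], the top one if [l = n]). *)
Definition piece : finType := ('I_b.+1 * 'I_n.+1)%type.
Definition below (v : vertex) (i : strand) : piece :=
  (i, widen_ord (leqnSn n) v).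
Definition above (v : vertex) (i : strand) : piece := (i, fintype.lift ord0 v).

(* Pieces are joined across a letter that does not meet their strand, and, off
   the cut strand, from the top boundary to the bottom boundary. *)
Definition joined_up (s u : piece) : bool :=
  [exists v, [&& ~~ meets v s.1, s == below v s.1 & u == above v s.1]]
  || [&& s.1 == u.1, s.1 != ord_max, s.2 == ord_max & u.2 == ord0].

Definition joined : rel piece := fun s u => joined_up s u || joined_up u s.

Lemma joined_connect_sym : connect_sym joined.
Proof. by apply: sym_connect_sym => s u; rewrite /joined orbC. Qed.

Definition thin_edge : finType := {s : piece | roots joined s}.

Definition thin (s : piece) : thin_edge :=
  exist (fun u => roots joined u) _ (roots_root joined_connect_sym s).

Definition goes_out (v : vertex) (e : thin_edge) : bool :=
  [exists i, meets v i && (e == thin (above v i))].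
Definition goes_in (v : vertex) (e : thin_edge) : bool :=
  [exists i, meets v i && (e == thin (below v i))].

Definition starts_in (Gam : {set vertex}) (e : thin_edge) : bool :=
  [exists v in Gam, goes_out v e].
Definition ends_in (Gam : {set vertex}) (e : thin_edge) : bool :=
  [exists v in Gam, goes_in v e].

Definition incident (v : vertex) (e : thin_edge) : bool :=
  goes_out v e || goes_in v e.
Definition adjacent : rel thin_edge :=
  fun e f => [exists v, incident v e && incident v f].

(* Every connected component contains a thin edge, so components are the
   classes of thin edges for [connect adjacent]. *)
Definition components_have_vertex : Prop :=
  forall e : thin_edge, exists f v, connect adjacent e f /\ incident v f.

Definition cut_edge : thin_edge := thin (ord_max, ord0).

Definition nonspecial : finType :=
  {e : thin_edge | roots adjacent e && ~~ connect adjacent e cut_edge}.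

Variable F : fieldType.
Local Notation t := (tvar F).

Definition edge_ring : comNzRingType := {mpoly (laurent F)[#|thin_edge|]}.

Definition x_ (e : thin_edge) : {mpoly (laurent F)[#|thin_edge|]} :=
  'X_(enum_rank e).

Section Framing.
Variable l : thin_edge -> int.

(* [y_e] is eliminated from E(G) by the relation [t ^ l e * y_e = x_e]. *)
Definition y_ (e : thin_edge) : {mpoly (laurent F)[#|thin_edge|]} :=
  t ^ (- l e) *: x_ e.

Definition linear_gen (p : ring_mod edge_ring) : Prop :=
  exists v, thick v /\
    p = \sum_(i | meets v i) x_ (thin (above v i))
        - \sum_(i | meets v i) y_ (thin (below v i)).

Definition weight (Gam : {set vertex}) : int :=
  \sum_(e | starts_in Gam e && ends_in Gam e) l e.

Definition nonlocal_gen (p : ring_mod edge_ring) : Prop :=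
  exists Gam : {set vertex},
    p = t ^ weight Gam *: \prod_(e | starts_in Gam e && ~~ ends_in Gam e) x_ e
        - \prod_(e | ends_in Gam e && ~~ starts_in Gam e) y_ e.

(* The summand in Tor degree [i] and exterior degree [j]. *)
Definition graph_homology (i j : nat) : lmodType edge_ring :=
  tensor (Tor (modquot linear_gen) (modquot nonlocal_gen) i)
         (ext_power j (free_module edge_ring nonspecial)).

End Framing.

Definition os_weight (Gam : {set vertex}) : nat :=
  (\sum_(v in Gam) if thick v then 2 else 1)%N.

Inductive os_rel : ring_mod edge_ring -> Prop :=
| os_linear v : thick v ->
    os_rel (t *: (\sum_(i | meets v i) x_ (thin (above v i)))
            - \sum_(i | meets v i) x_ (thin (below v i)))
| os_nonlocal (Gam : {set vertex}) :
    os_rel (t ^+ os_weight Gam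
              *: \prod_(e | starts_in Gam e && ~~ ends_in Gam e) x_ e
            - \prod_(e | ends_in Gam e && ~~ starts_in Gam e) x_ e).

(* The Ozsvath-Szabo algebra, as a module over the edge ring. *)
Definition os_algebra : lmodType edge_ring := modquot os_rel.

End Graph.

Record closed_braid_graph : Type := ClosedBraidGraph {
  diagram :> braid_diagram;
  _ : components_have_vertex diagram
}.

Section Bigraded.
Variable E : comNzRingType.

Definition in_degree0 (M : lmodType E) (i j : nat) : lmodType E :=
  match i, j with 0, 0 => M | _, _ => 'rV[E]_0 end.

Definition bigraded_iso (M N : nat -> nat -> lmodType E) : Prop :=
  forall i j, lin_iso (M i j) (N i j).

End Bigraded.

(* Main.v *)
(* Multiplying by powers of [t] turns the generators of the ideals for the +1 framing
   into those of the Ozsvath-Szabo relations, so Tor in degree 0 is the algebra.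
   It remains to see that everything else vanishes.  A nonspecial component has no
   edges entering or leaving it, so it makes [t ^ w - 1] with [w > 0], hence 1, an
   element of the non-local ideal [N].  If there is no such component, the linear
   forms are a regular sequence on [E / N], and on [E], so the higher Tor vanishes by
   shifting dimensions in the second variable.

   Regularity is checked at [t = 0] and lifted along the [t]-adic valuation.  At
   [t = 0] the linear form of a thick edge becomes the sum of its two incoming
   variables and [N] degenerates to the monomial ideal generated by the products of
   the variables entering a set of vertices.  This holds because each class of
   monomials modulo cuts contains at most one monomial outside that ideal.  The
   monomial ideal is filtered, by deletion and contraction of the edges leaving the
   root, with quotients by the variables of the spanning arborescences, on which the
   linear forms are just distinct variables. *)

From HB Require Import structures.
From mathcomp Require Import all_boot all_order all_algebra.
From mathcomp Require Import boolp freeg mpoly.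
From mathcomp Require Import zify.
Require Import Defs.

Set Implicit Arguments.
Unset Strict Implicit.
Unset Printing Implicit Defensive.

Import GRing.Theory Num.Theory Order.TTheory.
Local Open Scope ring_scope.

(** * Tensor products *)

(** Tor is defined by the resolution of [E / L] with all elements of each syzygy module as
    generators, and no comparison with a Koszul complex is made. The second variable is shifted
    along [0 -> syzygy N -> free N -> N -> 0] instead: a sequence regular on [E] and on [N] is
    regular on the syzygy module too, so the hypothesis reproduces itself. The obstacle in lifting
    from [t = 0] is that ideals of a polynomial ring over the Laurent field need not be [t]-adically
    closed: [1] is a limit of multiples of [1 - t x]. Homogeneity is the remedy. A set of vertices
    has as many thin edges coming in as going out, so [N] is homogeneous, and approximation takes
    place in finite-dimensional graded pieces. Passing between monomials modulo cuts is recorded by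
    an integer potential on the vertices, zero on the outside. Connectedness to the cut edge makes
    this potential unique, hence the power of [t] well defined; its positivity comes from a minimum
    argument. *)

Section QuotLift.
Variables (E : comNzRingType) (V W : lmodType E) (S : V -> Prop).
Variables (f : {linear V -> W}) (fS : forall v, S v -> f v = 0).

(** The proof that [f] kills [S] is carried as an argument so that the structure of a linear map can
    be attached to [quot_lift fS]. *)
Definition quot_lift of (forall v, S v -> f v = 0) :=
  fun x : modquot S => f (repr x).

Lemma span_vanish v : v \in span S -> f v = 0.
Proof.
move=> /spanP; elim=> [|a x y Sx _ IH]; first exact: linear0.
by rewrite linearP fS // scaler0 add0r.
Qed.

Lemma quot_lift_pi v : quot_lift fS (modquot_pi S v) = f v.
Proof.
apply/eqP; rewrite -subr_eq0 -linearB; apply/eqP/span_vanish/modquot_pi_eq.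
exact: modquot_reprK.
Qed.

Lemma quot_lift_linear : linear (quot_lift fS).
Proof.
move=> a x y; rewrite -[x]modquot_reprK -[y]modquot_reprK -linearP.
by rewrite !quot_lift_pi linearP.
Qed.

HB.instance Definition _ :=
  GRing.isLinear.Build E (modquot S) W *:%R (quot_lift fS) quot_lift_linear.

End QuotLift.

Section FreeModule.
Variables (E : comNzRingType) (S : choiceType).
Implicit Types x y : free_module E S.

Definition fcoef (s : S) (x : free_module E S) : E := coeff s x.

Lemma fcoefP s a x y : fcoef s (a *: x + y) = a * fcoef s x + fcoef s y.
Proof. by rewrite /fcoef coeffD coeffZ. Qed.

Lemma fcoef0 s : fcoef s 0 = 0.
Proof. exact: coeff0. Qed.

Lemma fcoefD s x y : fcoef s (x + y) = fcoef s x + fcoef s y.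
Proof. exact: coeffD. Qed.

Lemma fcoefZ s a x : fcoef s (a *: x) = a * fcoef s x.
Proof. exact: coeffZ. Qed.

Lemma fcoef_gen s u : fcoef s (fgen E u) = (u == s)%:R.
Proof. by rewrite /fcoef /fgen coeffU mul1r. Qed.

Lemma fcoef_sum (I : Type) (r : seq I) (F : I -> free_module E S) s :
  fcoef s (\sum_(i <- r) F i) = \sum_(i <- r) fcoef s (F i).
Proof.
elim: r => [|i r IH]; first by rewrite !big_nil fcoef0.
by rewrite !big_cons fcoefD IH.
Qed.

Lemma free_eqP x y : (forall s, fcoef s x = fcoef s y) -> x = y.
Proof. by move=> xy; apply/eqP/freeg_eqP. Qed.

Definition fdom (x : free_module E S) : seq S := dom x.

(** The list may exceed the support, so that several elements can be expanded over a common list. *)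
Lemma free_expand x (r : seq S) : uniq r -> {subset fdom x <= r} ->
  x = \sum_(s <- r) fcoef s x *: fgen E s.
Proof.
move=> ur xr; apply: free_eqP => s; rewrite fcoef_sum.
have [sr|sr] := boolP (s \in r).
  rewrite (bigD1_seq s) //= big1 => [|u us].
    by rewrite fcoefZ fcoef_gen eqxx mulr1 addr0.
  by rewrite fcoefZ fcoef_gen (negPf us) mulr0.
rewrite big_seq big1 => [|u ur'].
  by rewrite /fcoef coeff_outdom //; apply: contra sr => /xr.
rewrite fcoefZ fcoef_gen; case: eqP => [us|_]; last by rewrite mulr0.
by rewrite -us ur' in sr.
Qed.

Lemma free_ind (P : free_module E S -> Prop) :
  P 0 -> (forall a s x, P x -> P (a *: fgen E s + x)) -> forall x, P x.
Proof.
move=> P0 PS x; rewrite (@free_expand x (fdom x) (uniq_dom x) (fun _ => id)).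
elim: (fdom x) => [|s r IH]; first by rewrite big_nil.
by rewrite big_cons; apply: PS.
Qed.

End FreeModule.

Section TensorLift.
Variables (E : comNzRingType) (M N P : lmodType E).
Variable b : M -> N -> P.

Definition bilin := (forall n, linear (b^~ n)) /\ (forall m, linear (b m)).

Hypothesis bb : bilin.

Lemma tensor_lift_rel u : tensor_rel u -> free_lift (fun p => b p.1 p.2) u = 0.
Proof.
have fE p : free_lift (fun p => b p.1 p.2) (fgen E p) = b p.1 p.2.
  exact: free_lift_gen.
case: bb => bl br; case=> [a m m' n | a m n n'];
  rewrite !linearB linearZ /= !fE /=.
  by rewrite bl addrAC addrK subrr.
by rewrite br addrAC addrK subrr.
Qed.

Definition tensor_lift : tensor M N -> P := quot_lift tensor_lift_rel.

HB.instance Definition _ := GRing.Linear.on tensor_lift.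

Lemma tensor_lift_tens m n : tensor_lift (tens m n) = b m n.
Proof. by rewrite /tensor_lift quot_lift_pi; exact: free_lift_gen. Qed.

End TensorLift.

Section TensorFacts.
Variable E : comNzRingType.

Lemma tensDl (M N : lmodType E) (m m' : M) (n : N) : tens (m + m') n = tens m n + tens m' n.
Proof. by have := tens_linearl n 1 m m'; rewrite !scale1r. Qed.
Lemma tensDr (M N : lmodType E) (m : M) (n n' : N) : tens m (n + n') = tens m n + tens m n'.
Proof. by have := tens_linearr m 1 n n'; rewrite !scale1r. Qed.
Lemma tens0l (M N : lmodType E) (n : N) : tens (0 : M) n = 0.
Proof. by apply: (addrI (tens 0 n)); rewrite -tensDl !addr0. Qed.
Lemma tens0r (M N : lmodType E) (m : M) : tens m (0 : N) = 0.
Proof. by apply: (addrI (tens m 0)); rewrite -tensDr !addr0. Qed.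
Lemma tensZl (M N : lmodType E) a (m : M) (n : N) : tens (a *: m) n = a *: tens m n.
Proof. by have := tens_linearl n a m 0; rewrite !addr0 tens0l addr0. Qed.
Lemma tensZr (M N : lmodType E) a (m : M) (n : N) : tens m (a *: n) = a *: tens m n.
Proof. by have := tens_linearr m a n 0; rewrite !addr0 tens0r addr0. Qed.
Lemma tensor_ind (M N : lmodType E) (P : tensor M N -> Prop) :
  P 0 -> (forall m n x, P x -> P (tens m n + x)) -> forall x, P x.
Proof.
move=> P0 PS x; rewrite -[x]modquot_reprK.
elim/free_ind: (repr x) => [|a [m n] u IH]; first by rewrite linear0.
by rewrite linearP; have := PS (a *: m) n _ IH; rewrite tensZl.
Qed.

Lemma tens_suml (M N : lmodType E) (I : Type) (r : seq I) (f : I -> M) (n : N) :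
  tens (\sum_(i <- r) f i) n = \sum_(i <- r) tens (f i) n.
Proof.
by elim: r => [|i r IH]; rewrite ?big_nil ?tens0l // !big_cons tensDl IH.
Qed.
Lemma tens_sumr (M N : lmodType E) (I : Type) (r : seq I) (m : M) (f : I -> N) :
  tens m (\sum_(i <- r) f i) = \sum_(i <- r) tens m (f i).
Proof.
by elim: r => [|i r IH]; rewrite ?big_nil ?tens0r // !big_cons tensDr IH.
Qed.

Lemma tens_comp_bilin (M N N' : lmodType E) (g : {linear N -> N'}) :
  bilin (fun (m : M) n => tens m (g n)).
Proof.
split=> [n|m] a x y; first by rewrite tensDl tensZl.
by rewrite linearP tensDr tensZr.
Qed.

Definition tensor_mapr (M N N' : lmodType E) (g : {linear N -> N'}) :
  tensor M N -> tensor M N' := tensor_lift (tens_comp_bilin M g).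

HB.instance Definition _ M N N' g := GRing.Linear.on (@tensor_mapr M N N' g).

Lemma tensor_mapr_tens (M N N' : lmodType E) (g : {linear N -> N'}) (m : M) n :
  tensor_mapr g (tens m n) = tens m (g n).
Proof. exact: tensor_lift_tens. Qed.

Lemma tensor_maprD (M N N' : lmodType E) (g : {linear N -> N'}) (x y : tensor M N) :
  tensor_mapr g (x + y) = tensor_mapr g x + tensor_mapr g y.
Proof. exact: linearD. Qed.
Lemma tensor_mapr0 (M N N' : lmodType E) (g : {linear N -> N'}) :
  tensor_mapr g (0 : tensor M N) = 0.
Proof. exact: linear0. Qed.
Lemma tensor_mapD (M M' N : lmodType E) (f : {linear M -> M'}) (x y : tensor M N) :
  tensor_map f (x + y) = tensor_map f x + tensor_map f y.
Proof. exact: linearD. Qed.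
Lemma tensor_map0 (M M' N : lmodType E) (f : {linear M -> M'}) :
  tensor_map f (0 : tensor M N) = 0.
Proof. exact: linear0. Qed.

Lemma tensor_mapZ (M M' N : lmodType E) (f : {linear M -> M'}) a (x : tensor M N) :
  tensor_map f (a *: x) = a *: tensor_map f x.
Proof. exact: linearZ. Qed.
Lemma tensor_maprB (M N N' : lmodType E) (g : {linear N -> N'}) (x y : tensor M N) :
  tensor_mapr g (x - y) = tensor_mapr g x - tensor_mapr g y.
Proof. exact: linearB. Qed.
Lemma tensor_mapB (M M' N : lmodType E) (f : {linear M -> M'}) (x y : tensor M N) :
  tensor_map f (x - y) = tensor_map f x - tensor_map f y.
Proof. exact: linearB. Qed.

Lemma tensor_mapC (M M' N N' : lmodType E) (f : {linear M -> M'}) (g : {linear N -> N'}) x :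
  tensor_mapr g (tensor_map f x) = tensor_map f (tensor_mapr g x).
Proof.
elim/tensor_ind: x => [|m n x IH].
  by rewrite tensor_map0 !tensor_mapr0 tensor_map0.
rewrite tensor_mapD !tensor_maprD IH tensor_mapD.
by rewrite tensor_map_tens !tensor_mapr_tens tensor_map_tens.
Qed.

Lemma tensor_mapr_comp0 (M N N' N'' : lmodType E) (g : {linear N -> N'})
    (h : {linear N' -> N''}) (x : tensor M N) :
  (forall n, h (g n) = 0) -> tensor_mapr h (tensor_mapr g x) = 0.
Proof.
move=> hg; elim/tensor_ind: x => [|m n x IH].
  by rewrite !tensor_mapr0.
by rewrite !tensor_maprD IH !tensor_mapr_tens hg tens0r addr0.
Qed.

Lemma tensor_map_comp0 (M M' M'' N : lmodType E) (g : {linear M -> M'})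
    (h : {linear M' -> M''}) (x : tensor M N) :
  (forall n, h (g n) = 0) -> tensor_map h (tensor_map g x) = 0.
Proof.
move=> hg; elim/tensor_ind: x => [|m n x IH].
  by rewrite !tensor_map0.
by rewrite !tensor_mapD IH !tensor_map_tens hg tens0l addr0.
Qed.

Section Coefficients.
Variables (S : choiceType) (N : lmodType E).

Lemma tcoefl_bilin s : bilin (fun (x : free_module E S) (n : N) => fcoef s x *: n).
Proof.
split=> [n|x] a u v; first by rewrite fcoefP scalerDl scalerA.
by rewrite scalerDr !scalerA mulrC.
Qed.

(** The coordinate at [s] under the identification of a free module tensored with [N] with the
    finitely supported families in [N]. Coordinates and the expansion below replace the isomorphism
    itself. *)
Definition tcoefl s : tensor (free_module E S) N -> N := tensor_lift (tcoefl_bilin s).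
HB.instance Definition _ s := GRing.Linear.on (tcoefl s).

Lemma tcoefl0 s : tcoefl s 0 = 0.
Proof. exact: linear0. Qed.
Lemma tcoeflD s x y : tcoefl s (x + y) = tcoefl s x + tcoefl s y.
Proof. exact: linearD. Qed.

Lemma tcoefl_tens s x n : tcoefl s (tens x n) = fcoef s x *: n.
Proof. exact: tensor_lift_tens. Qed.

Lemma tcoefl_expand (z : tensor (free_module E S) N) :
  exists r : seq S, z = \sum_(s <- r) tens (fgen E s) (tcoefl s z).
Proof.
(* Stated for every larger duplicate-free list, so that in the induction both summands expand over
   the same one. *)
suff [r rP] : exists r : seq S, forall r' : seq S, uniq r' -> {subset r <= r'} ->
    z = \sum_(s <- r') tens (fgen E s) (tcoefl s z).
  by exists (undup r); apply: rP => [|s]; rewrite ?undup_uniq // mem_undup.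
elim/tensor_ind: z => [|x n z [r IH]].
  by exists [::] => r' _ _; rewrite big1 // => s _; rewrite tcoefl0 tens0r.
exists (fdom x ++ r) => r' ur' sr'.
have xr' : {subset fdom x <= r'} by move=> s sx; apply: sr'; rewrite mem_cat sx.
have rr' : {subset r <= r'} by move=> s sx; apply: sr'; rewrite mem_cat sx orbT.
rewrite [in LHS](free_expand ur' xr') tens_suml [in LHS](IH r' ur' rr') -big_split /=.
by apply: eq_bigr => s _; rewrite tcoeflD tensDr tcoefl_tens tensZl tensZr.
Qed.

Lemma tcoefr_bilin s : bilin (fun (n : N) (x : free_module E S) => fcoef s x *: n).
Proof.
split=> [n|x] a u v; last by rewrite fcoefP scalerDl scalerA.
by rewrite scalerDr !scalerA mulrC.
Qed.

Definition tcoefr s : tensor N (free_module E S) -> N := tensor_lift (tcoefr_bilin s).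
HB.instance Definition _ s := GRing.Linear.on (tcoefr s).

Lemma tcoefr0 s : tcoefr s 0 = 0.
Proof. exact: linear0. Qed.
Lemma tcoefrD s x y : tcoefr s (x + y) = tcoefr s x + tcoefr s y.
Proof. exact: linearD. Qed.

Lemma tcoefr_tens s x n : tcoefr s (tens n x) = fcoef s x *: n.
Proof. exact: tensor_lift_tens. Qed.

Lemma tcoefr_expand (z : tensor N (free_module E S)) :
  exists r : seq S, z = \sum_(s <- r) tens (tcoefr s z) (fgen E s).
Proof.
suff [r rP] : exists r : seq S, forall r' : seq S, uniq r' -> {subset r <= r'} ->
    z = \sum_(s <- r') tens (tcoefr s z) (fgen E s).
  by exists (undup r); apply: rP => [|s]; rewrite ?undup_uniq // mem_undup.
elim/tensor_ind: z => [|n x z [r IH]].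
  by exists [::] => r' _ _; rewrite big1 // => s _; rewrite tcoefr0 tens0l.
exists (fdom x ++ r) => r' ur' sr'.
have xr' : {subset fdom x <= r'} by move=> s sx; apply: sr'; rewrite mem_cat sx.
have rr' : {subset r <= r'} by move=> s sx; apply: sr'; rewrite mem_cat sx orbT.
rewrite [in LHS](free_expand ur' xr') tens_sumr [in LHS](IH r' ur' rr') -big_split /=.
by apply: eq_bigr => s _; rewrite tcoefrD tensDl tcoefr_tens tensZl tensZr.
Qed.

End Coefficients.

Lemma tcoefl_mapr (S : choiceType) (N N' : lmodType E) (g : {linear N -> N'}) s
    (z : tensor (free_module E S) N) :
  tcoefl s (tensor_mapr g z) = g (tcoefl s z).
Proof.
elim/tensor_ind: z => [|m n x IH].
  by rewrite tensor_mapr0 !tcoefl0 linear0.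
by rewrite tensor_maprD !tcoeflD IH linearD tensor_mapr_tens !tcoefl_tens linearZ.
Qed.

Lemma tcoefr_map (S : choiceType) (N N' : lmodType E) (g : {linear N -> N'}) s
    (z : tensor N (free_module E S)) :
  tcoefr s (tensor_map g z) = g (tcoefr s z).
Proof.
elim/tensor_ind: z => [|m n x IH].
  by rewrite tensor_map0 !tcoefr0 linear0.
by rewrite tensor_mapD !tcoefrD IH linearD tensor_map_tens !tcoefr_tens linearZ.
Qed.

End TensorFacts.

(** * Regular sequences and vanishing of Tor *)

Lemma ring_scaleE (E : comNzRingType) (a : E) (f : ring_mod E) : a *: f = a * (f : E).
Proof. by []. Qed.

Section Regular.
Variable E : comNzRingType.

Section Submodules.
Variable M : lmodType E.
Implicit Types (U : M -> Prop) (l : E) (ls : seq E).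

(** Submodules are bare predicates, so that colons by a scalar and preimages can be written directly
    as functions. *)
Definition is_submod U := U 0 /\ forall a x y, U x -> U y -> U (a *: x + y).

Definition plus U l : M -> Prop := fun m => exists u m', U u /\ m = u + l *: m'.

Fixpoint adjoin U ls : M -> Prop :=
  if ls is l :: ls' then adjoin (plus U l) ls' else U.

(* [ls] is a weakly regular sequence on [M / U]. *)
Fixpoint regular U ls : Prop :=
  if ls is l :: ls' then (forall m, U (l *: m) -> U m) /\ regular (plus U l) ls'
  else True.

Definition zero_sub : M -> Prop := fun m => m = 0.

Lemma pred_eq U U' : (forall m, U m <-> U' m) -> U = U'.
Proof. by move=> UU'; apply/funext => m; apply/propext. Qed.

Lemma zero_submod : is_submod zero_sub.
Proof. by split=> // a x y -> ->; rewrite scaler0 addr0. Qed.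

Lemma submodD U x y : is_submod U -> U x -> U y -> U (x + y).
Proof. by move=> [_ UP] Ux Uy; rewrite -[x]scale1r; apply: UP. Qed.

Lemma submodZ U a x : is_submod U -> U x -> U (a *: x).
Proof. by move=> [U0 UP] Ux; rewrite -[_ *: _]addr0; apply: UP. Qed.

Lemma submodB U x y : is_submod U -> U x -> U y -> U (x - y).
Proof. by move=> UP Ux Uy; apply: submodD => //; rewrite -scaleN1r; apply: submodZ. Qed.

Lemma plus_submod U l : is_submod U -> is_submod (plus U l).
Proof.
move=> UP; split=> [|a x y [u [m [Uu ->]]] [v [n [Uv ->]]]].
  by exists 0, 0; rewrite scaler0 addr0; split=> //; case: UP.
exists (a *: u + v), (a *: m + n); split; first by case: UP => _; apply.
by rewrite !scalerDr !scalerA [l * a]mulrC addrACA.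
Qed.

Lemma adjoin_submod U ls : is_submod U -> is_submod (adjoin U ls).
Proof. by elim: ls U => //= l ls IH U UP; apply/IH/plus_submod. Qed.

Lemma plus_sub U l m : U m -> plus U l m.
Proof. by move=> Um; exists m, 0; rewrite scaler0 addr0. Qed.

Lemma plus_mul U l m : is_submod U -> plus U l (l *: m).
Proof. by move=> [U0 _]; exists 0, m; rewrite add0r. Qed.

Lemma adjoin_sub U ls m : U m -> adjoin U ls m.
Proof. by elim: ls U => //= l ls IH U Um; apply/IH/plus_sub. Qed.

Lemma adjoin_mul U ls l m : is_submod U -> l \in ls -> adjoin U ls (l *: m).
Proof.
elim: ls U => //= k ls IH U UP; rewrite in_cons => /orP[/eqP-> | lls].
  by apply/adjoin_sub/plus_mul.
by apply: IH => //; apply: plus_submod.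
Qed.

Lemma adjoin_ind U ls (P : M -> Prop) :
  (forall m, U m -> P m) -> (forall l m x, l \in ls -> P m -> P (m + l *: x)) ->
  forall m, adjoin U ls m -> P m.
Proof.
elim: ls U => [|l ls IH] U UP lsP m /=; [exact: UP | apply: IH] => [x [u [y [Uu ->]]]|k n x kls].
  by apply: lsP; [rewrite mem_head | apply: UP].
by apply: lsP; rewrite in_cons kls orbT.
Qed.

Lemma plusC U l k : plus (plus U l) k = plus (plus U k) l.
Proof.
have PlusC a b m : plus (plus U a) b m -> plus (plus U b) a m.
  case=> _ [x [[u [y [Uu ->]]] ->]]; rewrite addrAC.
  by exists (u + b *: x), y; split=> //; exists u, x.
by apply: pred_eq => m; split; exact: PlusC.
Qed.

Lemma regular_full U ls : (forall m, U m) -> regular U ls.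
Proof.
elim: ls U => //= l ls IH U UT; split=> [m _ //|]; apply: IH => m.
exact: plus_sub.
Qed.

(* The sequence [0 -> M / (U : x) -> M / U -> M / (U + x M) -> 0] is exact. *)
Lemma regular_colon U x ls : is_submod U ->
  regular (fun m => U (x *: m)) ls -> regular (plus U x) ls -> regular U ls.
Proof.
elim: ls U => //= l ls IH U UP [reg1 regs1] [reg2 regs2]; split=> [m Ulm|].
  have [u [m' [Uu mE]]] := reg2 m (plus_sub x Ulm).
  rewrite mE; apply: submodD => //; apply: reg1.
  have -> : x *: (l *: m') = l *: m - l *: u.
    by rewrite mE scalerDr addrAC subrr add0r !scalerA mulrC.
  by apply: submodB => //; apply: submodZ.
apply: IH; [exact: plus_submod | | by rewrite plusC].
(* Regularity of [l] on [M / (U + x M)] makes the colon by [x] commute with adding [l M]. *)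
suff <- : plus (fun m => U (x *: m)) l = (fun m => plus U l (x *: m)) by [].
apply: pred_eq => m; split=> [[u [m' [Uu ->]]]|[u [m' [Uu mE]]]].
  by exists (x *: u), (x *: m'); split=> //; rewrite scalerDr !scalerA mulrC.
have Ulm' : plus U x (l *: m').
  by exists (- u), m; split; [rewrite -scaleN1r; apply: submodZ | rewrite mE addrA addNr add0r].
have [u' [m'' [Uu' m'E]]] := reg2 _ Ulm'.
exists (m - l *: m''), m''; split; last by rewrite subrK.
rewrite scalerBr mE m'E scalerDr !scalerA [x * l]mulrC addrA addrK.
by apply: submodD => //; apply: submodZ.
Qed.

End Submodules.

Section Transfer.
Variables (M N : lmodType E) (p : {linear M -> N}).

Lemma plus_preim (U : N -> Prop) l : (forall n, exists m, p m = n) ->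
  plus (fun m => U (p m)) l = (fun m => plus U l (p m)).
Proof.
move=> ps; apply: pred_eq => m; split=> [[u [m' [Uu ->]]]|[u [m' [Uu mE]]]].
  by exists (p u), (p m'); rewrite linearD linearZ.
have [v vE] := ps m'; exists (m - l *: v), v; split; last by rewrite subrK.
by rewrite linearB linearZ /= vE mE addrK.
Qed.

Lemma regular_preim (U : N -> Prop) ls : (forall n, exists m, p m = n) ->
  regular (fun m => U (p m)) ls <-> regular U ls.
Proof.
move=> ps; elim: ls U => //= l ls IH U; rewrite (plus_preim U l ps).
split=> -[reg /IH regs]; (split; last by []).
  by move=> n; have [m <-] := ps n; rewrite -linearZ; apply: reg.
by move=> m; rewrite linearZ; apply: reg.
Qed.

(** Regularity on the cokernel of [p] keeps [M / p^-1 U -> N / U] injective after each form is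
    divided out. The second conclusion is this injectivity at the end of the sequence. *)
Lemma regular_kernel (U : N -> Prop) ls : is_submod U ->
  regular U ls -> regular (fun n => exists u m, U u /\ n = u + p m) ls ->
  regular (fun m => U (p m)) ls /\
  (forall m, adjoin U ls (p m) -> adjoin (fun m => U (p m)) ls m).
Proof.
elim: ls U => [//|l ls IH] U UP [regU regsU] [regp regsp].
(* If [p m = u + l n], then [l n] vanishes in the cokernel, so [n] lies in [U + p M] and [m] can be
   corrected by a multiple of [l]. *)
have plusE : plus (fun m => U (p m)) l = (fun m => plus U l (p m)).
  apply: pred_eq => m; split=> [[u [m' [Uu ->]]]|[u [n [Uu mE]]]].
    by exists (p u), (p m'); rewrite linearD linearZ.
  have [|v [m' [Uv nE]]] := regp n.
    exists (- u), m; split; last by rewrite mE addKr.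
    by rewrite -scaleN1r; apply: submodZ.
  exists (m - l *: m'), m'; split; last by rewrite subrK.
  rewrite linearB linearZ /= mE nE scalerDr addrA addrK.
  by apply: submodD => //; apply: submodZ.
have [|regs adj] := IH (plus U l) (plus_submod l UP) regsU.
  suff <- : plus (fun n => exists u m, U u /\ n = u + p m) l =
    (fun n => exists u m, plus U l u /\ n = u + p m) by [].
  apply: pred_eq => n; split=> [[_ [n' [[u [m [Uu ->]]] ->]]]|[_ [m [[u [n' [Uu ->]]] ->]]]].
    by exists (u + l *: n'), m; rewrite addrAC; split=> //; exists u, n'.
  by exists (u + p m), n'; rewrite addrAC; split=> //; exists u, m.
rewrite /= plusE; split=> //; split=> // m; rewrite linearZ; exact: regU.
Qed.

End Transfer.

Section FreeRegular.
Variable S : choiceType.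

Definition coefwise (U : ring_mod E -> Prop) : free_module E S -> Prop :=
  fun f => forall s, U (fcoef s f).

Lemma coefwise_plus (U : ring_mod E -> Prop) l : is_submod U ->
  plus (coefwise U) l = coefwise (plus U l).
Proof.
move=> UP; apply: pred_eq => f; split=> [[u [m' [Uu ->]]] s|Uf].
  by exists (fcoef s u), (fcoef s m'); split=> //; rewrite fcoefD fcoefZ.
have /choice[g gP] : forall s, exists g, U (fcoef s f - l * g).
  by move=> s; have [u [g [Uu ->]]] := Uf s; exists g; rewrite addrK.
(* The chosen [g] may be nonzero at infinitely many [s]; it is cut off to the support of [f]. *)
pose h := \sum_(s <- fdom f) g s *: fgen E s.
have hE s : fcoef s h = if s \in fdom f then g s else 0.
  rewrite fcoef_sum; case: ifPn => sf.
    rewrite (bigD1_seq s) //= ?uniq_dom // big1 => [|u us].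
      by rewrite fcoefZ fcoef_gen eqxx mulr1 addr0.
    by rewrite fcoefZ fcoef_gen (negPf us) mulr0.
  rewrite big_seq big1 // => u uf; rewrite fcoefZ fcoef_gen.
  by case: eqP => [us|_]; [rewrite -us uf in sf | rewrite mulr0].
exists (f - l *: h), h; split=> [s|]; last by rewrite subrK.
rewrite -scaleN1r addrC scalerA fcoefP mulN1r hE addrC; case: ifPn => sf.
  by rewrite mulNr; apply: gP.
by rewrite mulr0 addr0 /fcoef coeff_outdom //; case: UP.
Qed.

Lemma coefwise_adjoin (U : ring_mod E -> Prop) ls : is_submod U ->
  adjoin (coefwise U) ls = coefwise (adjoin U ls).
Proof.
elim: ls U => //= l ls IH U UP; rewrite coefwise_plus // IH //.
exact: plus_submod.
Qed.

Lemma coefwise_regular (U : ring_mod E -> Prop) ls : is_submod U ->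
  regular U ls -> regular (coefwise U) ls.
Proof.
elim: ls U => //= l ls IH U UP [reg regs]; split=> [f Uf s|].
  by apply: reg; have := Uf s; rewrite fcoefZ.
by rewrite coefwise_plus //; apply: IH => //; apply: plus_submod.
Qed.

Lemma coefwise_zero : coefwise (@zero_sub (ring_mod E)) = @zero_sub (free_module E S).
Proof.
apply: pred_eq => f; split=> [f0|-> s]; last exact: fcoef0.
by apply: free_eqP => s; rewrite f0 fcoef0.
Qed.

End FreeRegular.

End Regular.

(** * Dimension shifting in the second variable of Tor *)

Section TorVanishing.
Variable E : comNzRingType.

Lemma kernelP (V W : lmodType E) (f : {linear V -> W}) (k : kernel f) :
  f (kernel_val k) = 0.
Proof. by case: k => v /= /eqP. Qed.

Definition cover (N : lmodType E) : {linear free_module E N -> N} := free_lift id.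

Lemma cover_gen (N : lmodType E) (n : N) : cover N (fgen E n) = n.
Proof. exact: free_lift_gen. Qed.

Definition cover_ker (N : lmodType E) : {linear syzygy N -> free_module E N} := val.

Lemma cover_kerP (N : lmodType E) (k : syzygy N) : cover N (cover_ker N k) = 0.
Proof. exact: kernelP. Qed.

Lemma cover_ker_inj (N : lmodType E) : injective (@cover_ker N).
Proof. exact: val_inj. Qed.

Lemma cover_ker_ex (N : lmodType E) f : cover N f = 0 -> exists k, f = cover_ker N k.
Proof. by move=> f0; exists (Kernel (introT eqP f0)). Qed.

Section Resolution.
Variable M : lmodType E.

Local Notation d i := (@res_d E M i).

Lemma res_dE i (x : res M i.+1) : d i x = cover_ker _ (cover (iter_syzygy M i.+1) x).
Proof. by []. Qed.

Lemma cover_res_d i (x : res M i) : cover (iter_syzygy M i) x = 0 ->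
  exists y : res M i.+1, x = d i y.
Proof.
by move=> /cover_ker_ex[k ->]; exists (fgen E (k : iter_syzygy M i.+1)); rewrite res_dE cover_gen.
Qed.

Lemma res_exact i (x : res M i.+1) : d i x = 0 -> exists y, x = d i.+1 y.
Proof.
rewrite res_dE => dx0; apply: cover_res_d; apply: (@cover_ker_inj (iter_syzygy M i)).
by rewrite dx0 linear0.
Qed.

Lemma res_dd i (x : res M i.+2) : d i (d i.+1 x) = 0.
Proof. by rewrite res_dE (res_dE x) cover_kerP linear0. Qed.

(** Tensoring with a free module gives a sum of copies of the resolution, so exactness is checked on
    coordinates. *)
Lemma tensor_res_exact_free (S : choiceType) i (z : tensor (res M i.+1) (free_module E S)) :
  tensor_map (d i) z = 0 -> exists y, z = tensor_map (d i.+1) y.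
Proof.
move=> dz0; have [r ->] := tcoefr_expand z.
have /choice[y yE] : forall s, exists y, tcoefr s z = d i.+1 y.
  by move=> s; apply: res_exact; rewrite -tcoefr_map dz0 tcoefr0.
exists (\sum_(s <- r) tens (y s) (fgen E s)).
elim: r => [|s r IH]; first by rewrite !big_nil tensor_map0.
by rewrite !big_cons tensor_mapD IH tensor_map_tens yE.
Qed.

End Resolution.

Lemma tensor_lifts (S : choiceType) (N N' : lmodType E) (p : {linear N -> N'})
    (z : tensor (free_module E S) N') :
  (forall s, exists n, tcoefl s z = p n) -> exists y, z = tensor_mapr p y.
Proof.
move=> /choice[n nE]; have [r ->] := tcoefl_expand z.
exists (\sum_(s <- r) tens (fgen E s) (n s)).
elim: r => [|s r IH]; first by rewrite !big_nil tensor_mapr0.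
by rewrite !big_cons tensor_maprD IH tensor_mapr_tens nE.
Qed.

Lemma tcoefl_eq0 (S : choiceType) (N : lmodType E) (z : tensor (free_module E S) N) :
  (forall s, tcoefl s z = 0) -> z = 0.
Proof.
by move=> z0; have [r ->] := tcoefl_expand z; rewrite big1 // => s _; rewrite z0 tens0r.
Qed.

Lemma tensor_mapr_inj0 (S : choiceType) (N N' : lmodType E) (g : {linear N -> N'})
    (z : tensor (free_module E S) N) :
  injective g -> tensor_mapr g z = 0 -> z = 0.
Proof.
move=> gi gz; apply: tcoefl_eq0 => s; apply: gi.
by rewrite -tcoefl_mapr gz tcoefl0 linear0.
Qed.

(** The diagram chase of the connecting map for [0 -> syzygy N -> free N -> N -> 0]. The last
    hypothesis says that a chain [u] over the syzygies which bounds over the free module already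
    bounds. *)
Lemma tensor_res_shift (M N : lmodType E) i (z : tensor (res M i.+1) N) :
  tensor_map (@res_d E M i) z = 0 ->
  (forall u zt, tensor_mapr (cover_ker N) u = tensor_map (@res_d E M i) zt ->
     exists v, u = tensor_map (@res_d E M i) v) ->
  exists y, z = tensor_map (@res_d E M i.+1) y.
Proof.
move=> dz0 lift.
have [zt ztE] : exists zt, z = tensor_mapr (cover N) zt.
  by apply: tensor_lifts => s; exists (fgen E (tcoefl s z)); rewrite cover_gen.
have [u uE] : exists u, tensor_map (@res_d E M i) zt = tensor_mapr (cover_ker N) u.
  apply: tensor_lifts => s; apply: cover_ker_ex.
  by rewrite -tcoefl_mapr tensor_mapC -ztE dz0 tcoefl0.
have [v vE] := lift u zt (esym uE).
have [|y yE] := @tensor_res_exact_free M N i (zt - tensor_mapr (cover_ker N) v).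
  by rewrite tensor_mapB -tensor_mapC -vE -uE subrr.
exists (tensor_mapr (cover N) y).
rewrite -tensor_mapC -yE tensor_maprB -ztE.
by rewrite (tensor_mapr_comp0 _ (@cover_kerP N)) subr0.
Qed.

(** An instance of [regular_kernel] at the inclusion of the syzygies, with cokernel [N]. The second
    conclusion is the vanishing of the first Tor of [N] against [E / (ls)], which starts the
    induction for Tor below. *)
Lemma regular_syzygy (N : lmodType E) (ls : seq E) :
  regular (@zero_sub E (ring_mod E)) ls -> regular (@zero_sub E N) ls ->
  regular (@zero_sub E (syzygy N)) ls /\
  (forall k, adjoin (@zero_sub E _) ls (cover_ker N k) -> adjoin (@zero_sub E _) ls k).
Proof.
move=> regE regN.
have <- : (fun k => zero_sub (cover_ker N k)) = @zero_sub E (syzygy N).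
  apply: pred_eq => k; rewrite /zero_sub; split=> [k0|->]; last exact: linear0.
  by apply: (@cover_ker_inj N); rewrite k0 linear0.
apply: regular_kernel; first exact: zero_submod.
  by rewrite -coefwise_zero; apply: coefwise_regular => //; exact: zero_submod.
have cs n : exists f, cover N f = n by exists (fgen E n); rewrite cover_gen.
move: regN; rewrite -(regular_preim _ _ cs).
suff -> : (fun m => zero_sub (cover N m)) =
  (fun n => exists u m, zero_sub u /\ n = u + cover_ker N m) by [].
apply: pred_eq => f; split=> [/cover_ker_ex[k ->]|[_ [k [-> ->]]]].
  by exists 0, k; rewrite add0r.
by rewrite add0r; exact: cover_kerP.
Qed.

Section Cyclic.
Variables (S : ring_mod E -> Prop) (ls : seq E).
Hypothesis S_ls : forall a, a \in span S <-> adjoin (@zero_sub E (ring_mod E)) ls a.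
Hypothesis regE : regular (@zero_sub E (ring_mod E)) ls.

Let M : lmodType E := modquot S.
Let one : M := modquot_pi S (1 : E^o).
Local Notation d i := (@res_d E M i).

Lemma one_scale (a : E) : a *: one = modquot_pi S a.
Proof. by rewrite /one -linearZ /= /GRing.scale /= mulr1. Qed.

(** As [M] is generated by [one], each generator of [res M 0] is a multiple of [fgen E one] up to a
    boundary. *)
Lemma tensor_res0_cyclic (N : lmodType E) (u : tensor (res M 0) N) :
  exists n v, u = tens (fgen E one) n + tensor_map (d 0) v.
Proof.
elim/tensor_ind: u => [|x n u [n' [v uE]]].
  by exists 0, 0; rewrite tens0r tensor_map0 addr0.
elim/free_ind: x => [|a m x [n1 [v1 IH]]].
  by exists n', v; rewrite tens0l add0r.
have [c mE] : exists c : E, m = c *: one.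
  by exists (repr m : E); rewrite one_scale modquot_reprK.
have [|y yE] := @cover_res_d M 0 (fgen E m - c *: fgen E one).
  by rewrite linearB linearZ /= !cover_gen mE subrr.
exists (n1 + (a * c) *: n), (v1 + a *: tens y n).
have -> : fgen E m = d 0 y + c *: fgen E one by rewrite -yE subrK.
rewrite tensDl -addrA IH tensDr tensZr tensor_mapD tensor_mapZ.
rewrite tensor_map_tens tensZl tensDl tensZl scalerDr scalerA.
by rewrite -!addrA addrC addrA [_ + (a * c) *: _]addrC -!addrA.
Qed.

Lemma tens_one_adjoin (N : lmodType E) (n : N) : adjoin (@zero_sub E N) ls n ->
  exists v, tens (fgen E one) n = tensor_map (d 0) v.
Proof.
move: n; apply: adjoin_ind => [_ ->|l n x lls [v vE]].
  by exists 0; rewrite tens0r tensor_map0.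
have [|y yE] := @cover_res_d M 0 (l *: fgen E one).
  rewrite linearZ /= cover_gen one_scale -(linear0 (modquot_pi S)).
  apply/modquot_pi_eq; rewrite subr0; apply/S_ls.
  have := @adjoin_mul E (ring_mod E) (@zero_sub _ _) ls l 1 (zero_submod _) lls.
  by rewrite /GRing.scale /= mulr1.
exists (v + tens y x).
by rewrite tensor_mapD tensor_map_tens /= -yE -vE tensDr tensZr tensZl.
Qed.

(** Induction on [i], with [N] replaced by its syzygy module. In the inductive step [u] is again a
    cycle, because the inclusion of the syzygies stays injective after tensoring with a free
    module. *)
Lemma tensor_res_exact (N : lmodType E) i (z : tensor (res M i.+1) N) :
  regular (@zero_sub E N) ls ->
  tensor_map (d i) z = 0 -> exists y, z = tensor_map (d i.+1) y.
Proof.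
elim: i N z => [|i IH] N z regN dz0; apply: tensor_res_shift => // u zt uE;
  have [regZ adjZ] := regular_syzygy regE regN; last first.
  apply: IH => //; apply: (tensor_mapr_inj0 (@cover_ker_inj N)).
  rewrite tensor_mapC uE tensor_map_comp0 //; exact: res_dd.
(* Base case: up to a boundary [u] is [one] tensor [n], which bounds once [n] is a combination of
   multiples of [ls] over the syzygies. By [adjZ] this may be checked in the free module, hence on
   coordinates. *)
have [n [v uE']] := tensor_res0_cyclic u.
have [|w wE] := @tens_one_adjoin _ n; last first.
  by exists (w + v); rewrite uE' wE tensor_mapD.
apply: adjZ; rewrite -coefwise_zero coefwise_adjoin; last exact: zero_submod.
move=> s; apply/S_ls.
have ztE : tensor_map (d 0) (zt - tensor_mapr (cover_ker N) v) =
    tens (fgen E one) (cover_ker N n).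
  by rewrite tensor_mapB -tensor_mapC -uE uE' tensor_maprD tensor_mapr_tens addrK.
(* The augmentation kills boundaries and sends a coordinate of [one] tensor [n] to the class of the
   corresponding coefficient of [n] in [E / S]. *)
have : cover M (tcoefr s (tens (fgen E one) (cover_ker N n))) = 0.
  by rewrite -ztE tcoefr_map /= res_dE; exact: cover_kerP.
rewrite tcoefr_tens linearZ /= cover_gen one_scale -(linear0 (modquot_pi S)).
by move/modquot_pi_eq; rewrite subr0.
Qed.

Lemma Tor_regular_eq0 (N : lmodType E) i (x : Tor M N i.+1) :
  regular (@zero_sub E N) ls -> x = 0.
Proof.
move=> regN; rewrite -[x]modquot_reprK -(linear0 (modquot_pi _)).
apply/modquot_pi_eq; rewrite subr0; apply: gen_span.
have [y yE] := tensor_res_exact regN (kernelP (repr x)).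
by exists y.
Qed.

End Cyclic.
End TorVanishing.

(** * Tor and the exterior power in degree zero *)

Section DegreeZero.
Variable E : comNzRingType.

Lemma tensor_eq0r (M N : lmodType E) : (forall n : N, n = 0) -> forall x : tensor M N, x = 0.
Proof. by move=> N0 x; elim/tensor_ind: x => // m n x ->; rewrite (N0 n) tens0r addr0. Qed.

Lemma tensor_eq0l (M N : lmodType E) : (forall m : M, m = 0) -> forall x : tensor M N, x = 0.
Proof. by move=> M0 x; elim/tensor_ind: x => // m n x ->; rewrite (M0 m) tens0l addr0. Qed.

Lemma homology_eq0 (U V W : lmodType E) (d' : {linear U -> V}) (d : {linear V -> W}) :
  (forall v : V, v = 0) -> forall x : homology d' d, x = 0.
Proof.
move=> V0 x; rewrite -[x]modquot_reprK -[RHS](linear0 (modquot_pi _)).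
by congr (modquot_pi _ _); apply: val_inj; rewrite [LHS]V0 [RHS]V0.
Qed.

Lemma Tor_eq0r (M N : lmodType E) i : (forall n : N, n = 0) -> forall x : Tor M N i, x = 0.
Proof. by move=> N0; case: i => [|i]; apply/homology_eq0/tensor_eq0r. Qed.

Lemma ext_power_eq0 k (V : lmodType E) : (forall v : V, v = 0) ->
  forall x : ext_power k.+1 V, x = 0.
Proof.
move=> V0 x; rewrite -[x]modquot_reprK; elim/free_ind: (repr x) => [|a v u IH].
  exact: linear0.
rewrite linearP /= IH addr0.
suff -> : modquot_pi (@ext_rel E k.+1 V) (fgen E v) = 0 by rewrite scaler0.
have updE y : upd v ord0 y = v.
  by apply/ffunP => j; rewrite ffunE (V0 (v j)) (V0 y) if_same.
(* Multilinearity for [1 *: 0 + 0] on a tuple of zeros reads [v - v - v], so [- v] is a relation. *)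
have := gen_span (@ext_rel_lin E k.+1 V v ord0 1 0 0); rewrite !updE scale1r subrr sub0r => vS.
rewrite -(linear0 (modquot_pi _)); apply/modquot_pi_eq; rewrite subr0.
by rewrite -rpredN.
Qed.

Lemma lin_iso_eq0 (M N : lmodType E) : (forall m : M, m = 0) -> (forall n : N, n = 0) ->
  lin_iso M N.
Proof.
move=> M0 N0; exists (\0 : {linear M -> N}); exists (fun _ => 0) => x.
  by rewrite (M0 x).
by rewrite (N0 x) [LHS]N0.
Qed.

Section Iso.
Variables (SL SN SO : ring_mod E -> Prop) (V : lmodType E).
Hypotheses (SLO : forall p, SL p -> p \in span SO) (SNO : forall p, SN p -> p \in span SO).
Hypothesis SOLN : forall p, SO p -> p \in span SL \/ p \in span SN.

Let B : lmodType E := modquot SL.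
Let C : lmodType E := modquot SN.
Let A : lmodType E := modquot SO.
Let oneB : B := modquot_pi SL (1 : E^o).
Let oneC : C := modquot_pi SN (1 : E^o).

Lemma modquot_pi_eq0 (W : lmodType E) (S : W -> Prop) w :
  w \in span S -> modquot_pi S w = 0.
Proof. by move=> wS; rewrite -(linear0 (modquot_pi S)); apply/modquot_pi_eq; rewrite subr0. Qed.

Let gamma : {linear C -> A} :=
  quot_lift (fun p (Sp : SN p) => modquot_pi_eq0 (SNO Sp)).

Definition scale_of (W : lmodType E) (y : W) : ring_mod E -> W := fun a => (a : E) *: y.

Lemma scale_of_linear (W : lmodType E) (y : W) : linear (scale_of y).
Proof. by move=> a u v; rewrite /scale_of scalerDl ring_scaleE scalerA. Qed.

HB.instance Definition _ (W : lmodType E) (y : W) :=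
  GRing.isLinear.Build E (ring_mod E) W *:%R (scale_of y) (scale_of_linear y).

Lemma SL_scale (a : A) p : SL p -> scale_of a p = 0.
Proof.
move=> Sp; rewrite /scale_of -[a]modquot_reprK -linearZ /=; apply: modquot_pi_eq0.
by rewrite ring_scaleE mulrC -ring_scaleE; apply/rpredZ/SLO.
Qed.

Let mu (c : C) : {linear B -> A} := quot_lift (SL_scale (gamma c)).

Lemma mu_bilin : bilin (fun (x : res B 0) c => mu c (cover B x)).
Proof.
split=> [c|x] a u v; first by rewrite !linearP.
have muE k b : mu k b = (repr b : E) *: gamma k by [].
by rewrite !muE (linearP gamma) scalerDr !scalerA mulrC.
Qed.

(** Multiplication: the generator on [b] tensored with [c] goes to the product of [b] and [c] in
    [A], and this kills boundaries because the augmentation does. *)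
Let alpha0 : {linear tensor (res B 0) C -> A} := tensor_lift mu_bilin.

Lemma alpha0_res_d (u : tensor (res B 1) C) : alpha0 (tensor_map (@res_d E B 0) u) = 0.
Proof.
elim/tensor_ind: u => [|y c u IH]; first by rewrite tensor_map0 linear0.
rewrite tensor_mapD linearD IH addr0 tensor_map_tens /= tensor_lift_tens.
by rewrite res_dE [cover B _]cover_kerP; exact: (linear0 (mu c)).
Qed.

Let T0 : lmodType E := Tor B C 0.

Lemma alpha_rel (z : kernel (\0 : {linear tensor (res B 0) C -> tensor (res B 0) C})) :
  (exists u, val z = tensor_map (@res_d E B 0) u) -> (alpha0 \o val) z = 0.
Proof. by case=> u /= ->; exact: alpha0_res_d. Qed.

Let alpha : {linear T0 -> A} := quot_lift alpha_rel.

Let L0 : lmodType E := ext_power 0 V.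

Lemma ext0_rel u : @ext_rel E 0 V u -> free_lift (fun=> 1 : ring_mod E) u = 0.
Proof. by case=> [v []|v []]. Qed.

Let eps : {linear L0 -> ring_mod E} := quot_lift ext0_rel.

Lemma phi_bilin : bilin (fun (h : T0) (y : L0) => (eps y : E) *: alpha h).
Proof.
split=> [y|h] a u v; first by rewrite linearP scalerDr !scalerA mulrC.
by rewrite linearP scalerDl ring_scaleE scalerA.
Qed.

Let phi : {linear tensor T0 L0 -> A} := tensor_lift phi_bilin.

Lemma z0_ker : (tens (fgen E oneB) oneC : tensor (res B 0) C) \in
  lker (\0 : {linear tensor (res B 0) C -> tensor (res B 0) C}).
Proof. exact/eqP. Qed.

Let z0 := Kernel z0_ker.
Let h0 : T0 := modquot_pi _ z0.
Let y0 : L0 := modquot_pi _ (fgen E [ffun=> 0]).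
Let g0 : tensor T0 L0 := tens h0 y0.

Lemma phi_g0 : phi g0 = modquot_pi SO (1 : E^o).
Proof.
have phiE : phi g0 = (eps y0 : E) *: alpha h0 by exact: tensor_lift_tens.
have epsE : eps y0 = 1.
  by apply: etrans (quot_lift_pi ext0_rel _) _; exact: free_lift_gen.
have alphaE : alpha h0 = mu oneC (cover B (fgen E oneB)).
  by apply: etrans (quot_lift_pi alpha_rel _) _; exact: tensor_lift_tens.
have muE : mu oneC oneB = (1 : E) *: gamma oneC by exact: quot_lift_pi.
by rewrite phiE epsE scale1r alphaE cover_gen muE scale1r; exact: quot_lift_pi.
Qed.

Lemma oneB_scale (a : E) : a *: oneB = modquot_pi SL a.
Proof. exact: one_scale. Qed.

Lemma h0_scale_span p : p \in span SL \/ p \in span SN -> (p : E) *: h0 = 0.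
Proof.
move=> pLN; have -> : (p : E) *: h0 = modquot_pi _ ((p : E) *: z0).
  exact: modquot_scale_pi.
apply/modquot_pi_eq0/gen_span.
have zE : val ((p : E) *: z0) = (p : E) *: tens (fgen E oneB) oneC by [].
case: pLN => pS.
  have [|y yE] := @cover_res_d E B 0 ((p : E) *: fgen E oneB).
    by rewrite linearZ /= cover_gen oneB_scale modquot_pi_eq0.
  exists (tens y oneC); apply: etrans zE _; rewrite -tensZl yE.
  exact/esym/tensor_map_tens.
exists 0; apply: etrans zE _.
rewrite -tensZr [_ *: oneC]one_scale modquot_pi_eq0 // tens0r.
exact/esym/tensor_map0.
Qed.

Lemma psi_rel p : SO p -> scale_of g0 p = 0.
Proof. by move=> /SOLN pLN; rewrite /scale_of /g0 -tensZl h0_scale_span // tens0l. Qed.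

Let psi : {linear A -> tensor T0 L0} := quot_lift psi_rel.

Lemma h0_span (h : T0) : exists a : E, h = a *: h0.
Proof.
have [n [v zE]] := tensor_res0_cyclic (kernel_val (repr h)).
have -> : h = modquot_pi _ (repr h) by rewrite modquot_reprK.
exists (repr n : E); have -> : (repr n : E) *: h0 = modquot_pi _ ((repr n : E) *: z0).
  exact: modquot_scale_pi.
apply/modquot_pi_eq/gen_span; exists v.
have valE : val (repr h - (repr n : E) *: z0) =
    kernel_val (repr h) - (repr n : E) *: tens (fgen E oneB) oneC by [].
apply: etrans valE _; rewrite zE -tensZr [_ *: oneC]one_scale modquot_reprK.
by rewrite addrC addKr.
Qed.

Lemma y0_span (y : L0) : exists a : E, y = a *: y0.
Proof.
rewrite -[y]modquot_reprK; elim/free_ind: (repr y) => [|a s u [c cE]].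
  by exists 0; rewrite linear0 scale0r.
exists (a + c); rewrite linearP /= cE scalerDl; congr (_ *: modquot_pi _ (fgen _ _) + _).
by apply/ffunP => -[].
Qed.

Lemma g0_span (x : tensor T0 L0) : exists a : E, x = a *: g0.
Proof.
elim/tensor_ind: x => [|h y x [c ->]]; first by exists 0; rewrite scale0r.
have [[a ->] [b ->]] := (h0_span h, y0_span y).
by exists (a * b + c); rewrite tensZl tensZr scalerA scalerDl.
Qed.

(** Both sides are cyclic. [phi] sends the generator [g0] to the class of [1], and [psi] sends that
    class back to [g0], which the relations of [A] kill; maps exchanging generators are inverse to
    each other. *)
Lemma Tor0_ext0_iso :
  lin_iso (tensor (Tor (modquot SL) (modquot SN) 0) (ext_power 0 V)) (modquot SO).
Proof.
have psiE (a : E^o) : psi (modquot_pi SO a) = (a : E) *: g0.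
  exact: (quot_lift_pi psi_rel).
have phiE (a : E) : phi (a *: g0) = modquot_pi SO a.
  have -> : phi (a *: g0) = a *: phi g0 by exact: linearZ.
  by rewrite phi_g0; exact: one_scale.
exists phi, psi => x; last by rewrite -[x]modquot_reprK psiE phiE.
by have [a ->] := g0_span x; rewrite phiE psiE.
Qed.

End Iso.
End DegreeZero.

(** * Monomial ideals *)

Section MonomialSubmodules.
Variables (K : comNzRingType) (n : nat).
Local Notation P := {mpoly K[n]}.
Implicit Types (Q : 'X_{1..n} -> Prop) (m : 'X_{1..n}) (f g : ring_mod P).

Definition monomial_span Q : ring_mod P -> Prop := fun f => forall m, f@_m != 0 -> Q m.

Lemma monomial_spanE Q (W : ring_mod P -> Prop) : is_submod W ->
  (forall m, Q m -> W 'X_[m]) -> forall f, monomial_span Q f -> W f.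
Proof.
move=> WP QW f Qf; rewrite [f]mpolyE big_seq.
elim/big_rec: _ => [|m g mf Wg]; first by case: WP.
have := @submodZ _ (ring_mod P) W (f@_m)%:MP 'X_[m] WP (QW m (Qf m _)).
rewrite -mcoeff_msupp => /(_ mf); rewrite ring_scaleE mul_mpolyC => Wm.
exact: (submodD WP Wm Wg).
Qed.

Lemma monomial_span_submod Q : (forall m m', Q m -> Q (m + m')%MM) ->
  is_submod (monomial_span Q).
Proof.
move=> Qup; split=> [m|a f g Qf Qg m]; first by rewrite mcoeff0 eqxx.
rewrite mcoeffD; have [af0|af0 _] := eqVneq ((a *: f : P)@_m) 0.
  by rewrite af0 add0r; apply: Qg.
move: af0; rewrite ring_scaleE -mcoeff_msupp => /msuppM_le/allpairsP[[m1 m2] /= [_ m2f ->]].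
by rewrite addmC; apply/Qup/Qf; rewrite -mcoeff_msupp.
Qed.

Lemma monomial_span_mulX Q i f :
  monomial_span Q (('X_i : P) *: f) <-> monomial_span (fun m => Q (m + U_(i))%MM) f.
Proof.
split=> Qf m fm.
  by apply: Qf; rewrite ring_scaleE mulrC addmC mcoeffMX.
move: fm; rewrite ring_scaleE mulrC -mcoeff_msupp.
rewrite (perm_mem (msuppMX _ _)) => /mapP[m' m'f ->].
by rewrite addmC; apply: Qf; rewrite -mcoeff_msupp.
Qed.

Lemma monomial_span_colon Q i :
  (fun f => monomial_span Q (('X_i : P) *: f)) = monomial_span (fun m => Q (m + U_(i))%MM).
Proof. by apply: pred_eq => f; exact: monomial_span_mulX. Qed.

Lemma monomial_span_plus Q i : (forall m m', Q m -> Q (m + m')%MM) ->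
  plus (monomial_span Q) 'X_i = monomial_span (fun m => Q m \/ (0 < m i)%N).
Proof.
move=> Qup; apply: pred_eq => f; split.
  case=> u [g [Qu ->]] m; rewrite mcoeffD.
  have [um|um _] := eqVneq u@_m 0; last by left; apply: Qu.
  rewrite um add0r ring_scaleE mulrC -mcoeff_msupp (perm_mem (msuppMX _ _)).
  by case/mapP=> m' _ ->; right; rewrite mnmDE mnm1E eqxx.
apply: monomial_spanE; first exact/plus_submod/monomial_span_submod.
move=> m [Qm|mi].
  by apply: plus_sub => m'; rewrite mcoeffX; have [<- //|_] := eqVneq m m'; rewrite eqxx.
have -> : m = (U_(i) + (m - U_(i)))%MM.
  apply/mnmP => j; rewrite mnmDE mnmBE mnm1E.
  by case: (i =P j) => [<-|_]; rewrite ?subn0 // subnKC.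
rewrite mpolyXD -ring_scaleE; apply/plus_mul/monomial_span_submod => //.
Qed.

(** [regular_colon] at a variable, where both the colon and the sum of a monomial ideal are again
    monomial. *)
Lemma regular_deletion_contraction Q i ls : (forall m m', Q m -> Q (m + m')%MM) ->
  regular (monomial_span (fun m => Q (m + U_(i))%MM)) ls ->
  regular (monomial_span (fun m => Q m \/ (0 < m i)%N)) ls ->
  regular (monomial_span Q) ls.
Proof.
move=> Qup; rewrite -monomial_span_colon -monomial_span_plus //.
exact/regular_colon/monomial_span_submod.
Qed.

Lemma plus_shift (M : lmodType P) (U : M -> Prop) (k l : P) : is_submod U ->
  (forall f : M, U (k *: f)) -> plus U (k + l) = plus U l.
Proof.
move=> UP Uk; apply: pred_eq => f; split=> -[u [g [Uu ->]]].
  by exists (u + k *: g), g; rewrite scalerDl addrA; split=> //; apply: submodD.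
by exists (u - k *: g), g; rewrite scalerDl addrA subrK; split=> //; apply: submodB.
Qed.

Definition meets_set (S : {set 'I_n}) m := exists2 i, i \in S & (0 < m i)%N.

Lemma meets_set_up S m m' : meets_set S m -> meets_set S (m + m')%MM.
Proof. by case=> i iS mi; exists i; rewrite // mnmDE addn_gt0 mi. Qed.

(** Modulo the variables of [S] each form is the one of its two variables that lies outside [S].
    Dividing by it adds this variable to [S], and disjointness of the pairs preserves the hypothesis
    for the remaining forms. *)
Lemma regular_var_sums (V : eqType) (c d : V -> 'I_n) (ts : seq V) (S : {set 'I_n}) :
  uniq ts -> {in ts, forall v, c v != d v} ->
  {in ts &, forall v w, v != w -> [&& c v != c w, c v != d w, d v != c w & d v != d w]} ->
  {in ts, forall v, (c v \in S) (+) (d v \in S)} ->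
  regular (monomial_span (meets_set S)) [seq 'X_(c v) + 'X_(d v) | v <- ts].
Proof.
elim: ts c d S => //= v ts IH c d S /andP[vts uts] cd dis inS.
(* The form is symmetric in [c v] and [d v]; the two are exchanged at [v] alone. *)
wlog cS : c d cd dis inS / c v \in S.
  move=> wl; have := inS v (mem_head _ _); case cvS: (c v \in S) => /= dvS.
    exact: (wl c d).
  have /= := wl (fun u => if u == v then d v else c u) (fun u => if u == v then c v else d u).
  rewrite !eqxx; have -> : [seq 'X_(if u == v then d v else c u) +
       'X_(if u == v then c v else d u) | u <- ts] = [seq 'X_(c u) + 'X_(d u) | u <- ts] :> seq P.
    apply/eq_in_map => u uts'; case: eqP => // uv; by rewrite -uv uts' in vts.
  rewrite [_ + 'X_(c v)]addrC; apply=> //.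
  - by move=> u uv; case: (u =P v) => [_|_]; [rewrite eq_sym cd ?mem_head | exact: cd].
  - move=> u w uv wv uw; have := dis u w uv wv uw.
    have := cd _ (mem_head v ts).
    case: (u =P v) => [uE|_]; case: (w =P v) => [wE|_]; rewrite ?uE ?wE //.
    + by rewrite uE wE eqxx in uw.
    + by move=> _ /and4P[-> -> -> ->].
    + by move=> _ /and4P[-> -> -> ->].
  by move=> u uv; case: (u =P v) => [_|_]; rewrite ?cvS ?dvS //; apply: inS.
have dS : d v \notin S by have := inS v (mem_head _ _); rewrite cS.
have Sup := @meets_set_up S; have SP := monomial_span_submod Sup.
have Sc f : monomial_span (meets_set S) ('X_(c v) *: f).
  apply/monomial_span_mulX => m _; exists (c v) => //.
  by rewrite mnmDE mnm1E eqxx addn1.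
split.
  move=> f; rewrite scalerDl => Sf.
  have /monomial_span_mulX Sdf : monomial_span (meets_set S) ('X_(d v) *: f).
    rewrite -[_ *: f](addKr ('X_(c v) *: f)) addrC.
    exact: submodB SP Sf (Sc f).
  move=> m /Sdf[i iS].
  rewrite mnmDE mnm1E; case: eqP => [dvi|_]; first by rewrite dvi iS in dS.
  by rewrite addn0; exists i.
rewrite plus_shift // monomial_span_plus //.
rewrite (_ : (fun m => _) = meets_set (d v |: S)); last first.
  apply/funext => m; apply/propext; split=> [[[i iS mi]|mi]|[i]].
  - by exists i; rewrite // in_setU1 iS orbT.
  - by exists (d v); rewrite // in_setU1 eqxx.
  by rewrite in_setU1 => /orP[/eqP-> |iS mi]; [right | left; exists i].
apply: IH => // [u uts'|u w uts' wts|u uts'].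
- by apply: cd; rewrite in_cons uts' orbT.
- by apply: dis; rewrite in_cons ?uts' ?wts orbT.
have uv : v != u by apply: contraNneq vts => ->.
have /and4P[_ _ dc dd] := dis v u (mem_head _ _) ltac:(by rewrite in_cons uts' orbT) uv.
rewrite !in_setU1 ![_ == d v]eq_sym (negPf dc) (negPf dd).
by apply: inS; rewrite in_cons uts' orbT.
Qed.

Lemma regular_vars (ts : seq 'I_n) (S : {set 'I_n}) :
  uniq ts -> {in ts, forall i, i \notin S} ->
  regular (monomial_span (meets_set S)) [seq 'X_i | i <- ts].
Proof.
elim: ts S => //= i ts IH S /andP[its uts] tsS.
have Sup := @meets_set_up S; have SP := monomial_span_submod Sup.
have iS := tsS i (mem_head _ _).
split.
  move=> f /monomial_span_mulX Sf m /Sf[j jS].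
  rewrite mnmDE mnm1E; case: eqP => [ij|_]; first by rewrite ij jS in iS.
  by rewrite addn0; exists j.
rewrite monomial_span_plus // (_ : (fun m => _) = meets_set (i |: S)); last first.
  apply/funext => m; apply/propext; split=> [[[j jS mj]|mi]|[j]].
  - by exists j; rewrite // in_setU1 jS orbT.
  - by exists i; rewrite // in_setU1 eqxx.
  by rewrite in_setU1 => /orP[/eqP-> |jS mj]; [right | left; exists j].
apply: IH => // j jts; rewrite in_setU1 negb_or tsS ?in_cons ?jts ?orbT // andbT.
by apply: contraNneq its => <-.
Qed.

End MonomialSubmodules.

(** The counterpart of [regular_preim] for a ring endomorphism, which is only semilinear. *)
Lemma regular_rmorphism (E : comNzRingType) (s : {rmorphism E -> E})
    (U : ring_mod E -> Prop) (ls : seq E) :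
  (forall g, exists f, s f = g) -> regular U (map s ls) ->
  regular (fun f : ring_mod E => U (s f)) ls.
Proof.
move=> ss; elim: ls U => //= l ls IH U [reg regs]; split=> [f|].
  by rewrite /GRing.scale /= rmorphM; apply: reg.
rewrite (_ : plus _ l = (fun f : ring_mod E => plus U (s l) (s f))); first exact: IH.
apply: pred_eq => f; split=> [[u [g [Uu ->]]]|[u [g [Uu fE]]]].
  by exists (s u), (s g); rewrite rmorphD rmorphM.
have [g' g'E] := ss g; exists (f - l * g' : E), g'.
by rewrite rmorphB rmorphM /= g'E fE addrK subrK.
Qed.

(** * Sums of disjoint pairs of variables are regular on the polynomial ring *)

Section FreeRegularSequence.
Variables (K : fieldType) (n : nat).
Local Notation P := {mpoly K[n]}.

Lemma comp_mpolyK (s t : n.-tuple P) :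
  (forall i, tnth s i \mPo t = 'X_i) -> forall f, (f \mPo s) \mPo t = f.
Proof.
move=> st f; rewrite [f \mPo s]comp_mpolyE raddf_sum [RHS]mpolyE /=; apply: eq_bigr => m _.
rewrite comp_mpolyZ rmorph_prod [in RHS]mpolyXE_id /=; congr (_ *: _).
by apply: eq_bigr => i _; rewrite rmorphXn /= st.
Qed.

Variables (V : eqType) (c d : V -> 'I_n) (ts : seq V).
Hypotheses (uts : uniq ts) (cd : {in ts, forall v, c v != d v}).
Hypothesis dis : {in ts &, forall v w, v != w ->
  [&& c v != c w, c v != d w, d v != c w & d v != d w]}.

(** A triangular substitution adding [a] times [X_(c v)] to [X_(d v)], with inverse given by [- a].
    At [a = -1] it turns each form into the single variable [X_(d v)]. *)
Let shear (a : K) : n.-tuple P :=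
  [tuple 'X_i + a *: \sum_(v <- ts | d v == i) 'X_(c v) | i < n].

Lemma shearE a i : 'X_i \mPo shear a = 'X_i + a *: \sum_(v <- ts | d v == i) 'X_(c v).
Proof. by rewrite comp_mpolyXU -tnth_nth tnth_mktuple. Qed.

Lemma shear_c a v : v \in ts -> 'X_(c v) \mPo shear a = 'X_(c v).
Proof.
move=> vts; rewrite shearE big_seq_cond big1 ?scaler0 ?addr0 // => w /andP[wts /eqP dw].
have [wv|wv] := eqVneq w v; first by have := cd vts; rewrite -dw wv eqxx.
by have := dis wts vts wv; rewrite dw eqxx !andbF.
Qed.

Lemma shear_d a v : v \in ts -> 'X_(d v) \mPo shear a = 'X_(d v) + a *: 'X_(c v).
Proof.
move=> vts; rewrite shearE big_mkcond (bigD1_seq v) //= eqxx big_seq_cond big1 ?addr0 //.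
move=> w /andP[wts wv]; case: eqP => // dw.
by have := dis wts vts wv; rewrite dw eqxx !andbF.
Qed.

Lemma shearK a f : (f \mPo shear (- a)) \mPo shear a = f.
Proof.
move: f; apply: comp_mpolyK => i; rewrite tnth_mktuple comp_mpolyD comp_mpolyZ shearE.
have -> : (\sum_(v <- ts | d v == i) 'X_(c v)) \mPo shear a =
    \sum_(v <- ts | d v == i) 'X_(c v).
  rewrite (raddf_sum (comp_mpoly (shear a))) big_seq_cond [RHS]big_seq_cond.
  apply: eq_bigr => v /andP[vts _]; exact: shear_c.
by rewrite scaleNr addrK.
Qed.

Lemma regular_free_var_sums :
  regular (@zero_sub P (ring_mod P)) [seq 'X_(c v) + 'X_(d v) | v <- ts].
Proof.
pose s : {rmorphism P -> P} := comp_mpoly (shear (-1)).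
have sK f : s f \mPo shear 1 = f by exact: (shearK 1).
have sK' f : s (f \mPo shear 1) = f by rewrite -[RHS](shearK (-1)) opprK.
rewrite (_ : @zero_sub _ _ = (fun f : ring_mod P => monomial_span (meets_set set0) (s f))); last first.
  apply: pred_eq => f; split=> [->|sf0].
    by move=> m; rewrite (rmorph0 s) mcoeff0 eqxx.
  rewrite /zero_sub -[f]sK (_ : s f = 0) ?comp_mpoly0 //; apply/mpolyP => m; rewrite mcoeff0.
  by apply/eqP/negPn/negP => /sf0[i]; rewrite in_set0.
apply: regular_rmorphism => [g|]; first by exists (g \mPo shear 1).
rewrite -map_comp (_ : [seq _ | v <- ts] = [seq 'X_i | i <- map d ts]); last first.
  rewrite -map_comp; apply/eq_in_map => v vts /=.
  by rewrite comp_mpolyD shear_c // shear_d // scaleN1r addrC subrK.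
apply: regular_vars => [|i _]; last by rewrite in_set0.
rewrite map_inj_in_uniq // => v w vts wts dvw; apply: contrapT => /eqP vw.
by have := dis vts wts vw; rewrite dvw eqxx !andbF.
Qed.

End FreeRegularSequence.

(** * The monomial ideal of a directed graph *)

Section Digraph.
Variables (V : finType) (n : nat) (tl hd : 'I_n -> option V).
Implicit Types (W Gam : {set V}) (D S : {set 'I_n}) (m : 'X_{1..n}).

(** An end [None] lies on the outside, which belongs to no set of vertices and serves as the
    root. *)
Definition oin (o : option V) Gam := if o is Some v then v \in Gam else false.

Definition enters Gam e := oin (hd e) Gam && ~~ oin (tl e) Gam.
Definition leaves Gam e := oin (tl e) Gam && ~~ oin (hd e) Gam.

(** [W] is the set of vertices not yet contracted into the root, and [D] the set of edges not yet
    deleted. *)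
Definition cut_in W D m := exists Gam : {set V},
  [/\ Gam \subset W, Gam != set0 & forall e, e \in D -> enters Gam e -> (0 < m e)%N].

Lemma cut_in_up W D m m' : cut_in W D m -> cut_in W D (m + m')%MM.
Proof.
case=> Gam [sG G0 Gm]; exists Gam; split=> // e eD eG.
by rewrite mnmDE addn_gt0 (Gm e).
Qed.

Variables (K : comNzRingType) (c d : V -> 'I_n) (ts : seq V).
Hypotheses (uts : uniq ts) (cd : {in ts, forall v, c v != d v}).
Hypothesis hdE : {in ts, forall v e, (hd e == Some v) = (e == c v) || (e == d v)}.

Lemma hd_c v : v \in ts -> hd (c v) = Some v.
Proof. by move=> vts; apply/eqP; rewrite hdE // eqxx. Qed.
Lemma hd_d v : v \in ts -> hd (d v) = Some v.
Proof. by move=> vts; apply/eqP; rewrite hdE // eqxx orbT. Qed.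

Lemma heads_disjoint : {in ts &, forall v w, v != w ->
  [&& c v != c w, c v != d w, d v != c w & d v != d w]}.
Proof.
move=> v w vts wts vw.
have neq x y : hd x = Some v -> hd y = Some w -> x != y.
  by move=> xv yw; apply: contraNneq vw => E; apply/eqP/Some_inj; rewrite -xv -yw E.
by rewrite !neq ?hd_c ?hd_d.
Qed.

(* Deleting or contracting an edge [e] from the contracted vertices to [W]
   computes the colon ideal by, and the sum with, the ideal of ['X_e]. *)
Lemma regular_cut_in W D S :
  (forall e, e \in S -> ~~ oin (hd e) W) ->
  {in ts, forall v, v \notin W -> (c v \in S) (+) (d v \in S)} ->
  regular (monomial_span (K := K) (fun m => meets_set S m \/ cut_in W D m))
    [seq 'X_(c v) + 'X_(d v) | v <- ts].
Proof.
have [k] := ubnP (#|W| + #|D|); elim: k W D S => // k IH W D S WDk SW tsS.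
(* Everything is contracted: [S] holds exactly one of the two edges into each [v] of [ts], which is
   the case of a single arborescence. *)
have [W0|W0] := eqVneq W set0.
  rewrite (_ : (fun m => _) = meets_set S); last first.
    apply/funext => m; apply/propext; split=> [[//|[Gam []]]|]; last by left.
    by rewrite W0 subset0 => ->.
  apply: regular_var_sums => //; first exact: heads_disjoint.
  by move=> v vts; apply: tsS; rewrite // W0 in_set0.
(* If no edge of [D] enters [W], then [W] is a cut with empty product, so the ideal is
   everything. *)
have [e /andP[eD eW]|noe] := pickP (fun e => (e \in D) && enters W e); last first.
  apply: regular_full => f m _; right; exists W; split=> // e eD eW.
  by have := noe e; rewrite eD eW.
have /andP[] := eW; case hde: (hd e) => [v|//] /= vW tlW.
have eS : e \notin S by apply/negP => /SW; rewrite hde /= vW.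
apply: (@regular_deletion_contraction _ _ _ e).
- by move=> m m' [Sm|Wm]; [left; apply: meets_set_up | right; apply: cut_in_up].
- rewrite (_ : (fun m => _) = (fun m => meets_set S m \/ cut_in W (D :\ e) m)).
    by apply: IH => //; move: WDk; rewrite (cardsD1 e D) eD addnCA add1n ltnS.
  apply/funext => m; apply/propext; split=> [[[i iS]|[Gam [sG G0 Gm]]]|[[i iS mi]|[Gam [sG G0 Gm]]]].
  + rewrite mnmDE mnm1E; case: eqP => [ei|_]; first by rewrite ei iS in eS.
    by rewrite addn0 => mi; left; exists i.
  + right; exists Gam; split=> // f; rewrite in_setD1 => /andP[fe fD] fG.
    by have := Gm f fD fG; rewrite mnmDE mnm1E eq_sym (negPf fe) addn0.
  + by left; exists i; rewrite // mnmDE addn_gt0 mi.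
  right; exists Gam; split=> // f fD fG; rewrite mnmDE mnm1E.
  by have [<-|fe] := eqVneq e f; rewrite ?addn1 // addn0 Gm // in_setD1 eq_sym fe.
rewrite (_ : (fun m => _) = (fun m => meets_set (e |: S) m \/ cut_in (W :\ v) D m)).
  apply: IH => [|f|u uts' uW].
  - by move: WDk; rewrite (cardsD1 v W) vW.
  - rewrite in_setU1 => /orP[/eqP->|fS]; first by rewrite hde /= in_setD1 eqxx.
    by have := SW f fS; case: (hd f) => //= u; rewrite in_setD1 negb_and orbC => ->.
  (* For [u = v] the contracted edge is one of [c v] and [d v], and the other is not in [S] since
     its head was still in [W]. *)
  rewrite !in_setU1; have [uv|uv] := eqVneq u v.
    rewrite uv in uts' *; have := hdE uts' e; rewrite hde eqxx => /esym/orP[]/eqP eE.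
      rewrite eE eqxx /= [d v == _]eq_sym (negPf (cd uts')).
      by apply/negP => /SW; rewrite hd_d //= vW.
    rewrite eE eqxx /= (negPf (cd uts')) addbT.
    by apply/negP => /SW; rewrite hd_c //= vW.
  have ue x : hd x = Some u -> x == e = false.
    by move=> xu; apply/eqP => xe; case/eqP: uv; apply: Some_inj; rewrite -xu xe.
  rewrite !ue ?hd_c ?hd_d //=; apply: tsS => //.
  by move: uW; rewrite in_setD1 uv.
apply/funext => m; apply/propext.
split=> [[[[i iS mi]|[Gam [sG G0 Gm]]]|me]|[[i]|[Gam [sG G0 Gm]]]].
- by left; exists i; rewrite // in_setU1 iS orbT.
(* The tail of [e] is outside [W], so [e] enters every cut containing [v], and the monomials of such
   a cut are divisible by the variable of [e]. *)
- have [vG|vG] := boolP (v \in Gam).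
    left; exists e; rewrite ?in_setU1 ?eqxx //; apply: Gm => //.
    rewrite /enters hde /= vG; apply: contra tlW.
    by case: (tl e) => //= u; apply/subsetP.
  by right; exists Gam; split=> //; apply/subsetD1P.
- by left; exists e; rewrite // in_setU1 eqxx.
- by rewrite in_setU1 => /orP[/eqP-> |iS mi]; [right | left; left; exists i].
left; right; exists Gam; split=> //; apply: subset_trans sG _; exact: subsetDl.
Qed.

End Digraph.

(** * Lifting regular sequences from t = 0 *)

Section LaurentOrder.
Variable F : fieldType.
Local Notation L := (laurent F).
Implicit Types (a b : L) (p q j : int).

Definition order_ge p a := forall j, j < p -> a j = 0.

Definition tpow p : L := lmono 1 p.

Lemma tpowM p a j : (tpow p * a : L) j = a (j - p).
Proof. by rewrite -[LHS]/(lmul (lmono 1 p) a j) lmonoE mul1r. Qed.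

Lemma tpowD p q : tpow (p + q) = tpow p * tpow q.
Proof.
apply/laurentP => j; rewrite tpowM /=.
by congr (if _ then _ else _); apply/eqP/eqP => ?; lia.
Qed.

Lemma tpow_unit p : tpow p * tpow (- p) = 1.
Proof. by rewrite -tpowD subrr. Qed.

Lemma tvarX k : tvar F ^+ k = tpow k%:Z.
Proof.
elim: k => [|k IH]; first by rewrite expr0.
by rewrite exprS IH -[tvar F]/(tpow 1) -tpowD; congr tpow; lia.
Qed.

Lemma laurentD a b j : (a + b) j = a j + b j. Proof. by []. Qed.
Lemma laurentN a j : (- a) j = - a j. Proof. by []. Qed.

Lemma laurent_sum (I : Type) (r : seq I) (A : pred I) (f : I -> L) j :
  (\sum_(i <- r | A i) f i) j = \sum_(i <- r | A i) f i j.
Proof. by apply: (big_morph (fun a : L => a j)). Qed.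

Lemma order_ge_le p q a : p <= q -> order_ge q a -> order_ge p a.
Proof. by move=> pq qa j jp; apply: qa; lia. Qed.

Lemma order_geD p a b : order_ge p a -> order_ge p b -> order_ge p (a + b).
Proof. by move=> pa pb j jp; rewrite laurentD pa // pb // addr0. Qed.

Lemma order_geN p a : order_ge p a -> order_ge p (- a).
Proof. by move=> pa j jp; rewrite laurentN pa // oppr0. Qed.

Lemma order_ge_tpow p q a : order_ge q a -> order_ge (p + q) (tpow p * a).
Proof. by move=> qa j jp; rewrite tpowM qa //; lia. Qed.

Lemma order_geM p q a b : order_ge p a -> order_ge q b -> order_ge (p + q) (a * b).
Proof.
have shiftE r c : c = tpow r * (tpow (- r) * c) by rewrite mulrA tpow_unit mul1r.
move=> pa qb; rewrite (shiftE p a) (shiftE q b) mulrACA -tpowD.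
suff ab0 : order_ge 0 ((tpow (- p) * a) * (tpow (- q) * b)).
  by have := @order_ge_tpow (p + q) 0 _ ab0; rewrite addr0.
move=> j j0; apply: (@lmul_lt _ _ _ 0 0) => // k k0.
  by rewrite tpowM pa //; lia.
by rewrite tpowM qb //; lia.
Qed.

Lemma coef0M a b : order_ge 0 a -> order_ge 0 b -> (a * b) 0 = a 0 * b 0.
Proof.
move=> a0 b0; rewrite -[LHS]/(lmul_coef a b 0).
rewrite (@lmul_coefE _ a b 0 0 0 0 1) ?big_ord1 ?addr0 ?subr0 //.
Qed.

Lemma order_ge_ex a : exists N : nat, order_ge (- N%:Z) a.
Proof. by exists (lbound a) => j; apply: lbound_lt. Qed.

Lemma order_ge_inf a : (forall k : nat, order_ge k%:Z a) -> a = 0.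
Proof. by move=> ak; apply/laurentP => j; apply: (ak (absz j).+1); lia. Qed.

End LaurentOrder.

(** * Reduction of polynomials modulo [t] *)

Section Reduction.
Variables (F : fieldType) (n : nat).
Local Notation L := (laurent F).
Local Notation P := {mpoly L[n]}.
Local Notation P0 := {mpoly F[n]}.
Implicit Types (f g : P) (p q : int) (m : 'X_{1..n}).

Definition pol_ge p f := forall m, order_ge p f@_m.

Lemma pol_ge_le p q f : p <= q -> pol_ge q f -> pol_ge p f.
Proof. by move=> pq qf m; apply: order_ge_le (qf m). Qed.

Lemma pol_geD p f g : pol_ge p f -> pol_ge p g -> pol_ge p (f + g).
Proof. by move=> pf pg m; rewrite mcoeffD; apply: order_geD. Qed.

Lemma pol_geN p f : pol_ge p f -> pol_ge p (- f).
Proof. by move=> pf m; rewrite mcoeffN; apply: order_geN. Qed.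

Lemma pol_geB p f g : pol_ge p f -> pol_ge p g -> pol_ge p (f - g).
Proof. by move=> pf pg; apply/pol_geD/pol_geN. Qed.

Lemma pol_ge0 p : pol_ge p 0.
Proof. by move=> m; rewrite mcoeff0. Qed.

Lemma pol_geZ p q (a : L) f : order_ge p a -> pol_ge q f -> pol_ge (p + q) (a *: f).
Proof. by move=> pa qf m; rewrite mcoeffZ; apply: order_geM. Qed.

Lemma pol_ge_tpow p q f : pol_ge q f -> pol_ge (p + q) (tpow F p *: f).
Proof. by move=> qf m; rewrite mcoeffZ; apply: order_ge_tpow. Qed.

Lemma pol_geX p m : p <= 0 -> pol_ge p 'X_[m].
Proof.
move=> p0 m'; rewrite mcoeffX; case: eqP => _ j jp //=.
by case: eqP => // j0; lia.
Qed.

Lemma pol_geM p q f g : pol_ge p f -> pol_ge q g -> pol_ge (p + q) (f * g).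
Proof.
move=> pf qg m; rewrite mcoeffM; elim/big_ind: _ => //; first exact: order_geD.
by move=> k _; apply: order_geM.
Qed.

Lemma pol_ge_ex f : exists N : nat, pol_ge (- N%:Z) f.
Proof.
elim/mpolyind: f => [|a m f _ _ [N Nf]]; first by exists 0%N; apply: pol_ge0.
have [M Ma] := order_ge_ex a; exists (maxn M N); apply: pol_geD.
  have -> : - (maxn M N)%:Z = - (maxn M N)%:Z + 0 :> int by rewrite addr0.
  by apply: pol_geZ; [apply: order_ge_le Ma; lia | apply: pol_geX].
by apply: pol_ge_le Nf; lia.
Qed.

(** The coefficientwise value at [t = 0]. It is additive on all polynomials, but multiplicative only
    on those with coefficients in [F[[t]]]. *)
Definition red f : P0 := \sum_(m <- msupp f) f@_m 0 *: 'X_[m].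

Lemma mcoeff_red f m : (red f)@_m = f@_m 0.
Proof.
rewrite /red raddf_sum /=; have [mf|mf] := boolP (m \in msupp f).
  rewrite (bigD1_seq m) ?msupp_uniq //= mcoeffZ mcoeffX eqxx mulr1 big1 ?addr0 //.
  by move=> k km; rewrite mcoeffZ mcoeffX (negPf km) mulr0.
rewrite (memN_msupp_eq0 mf) big_seq big1 // => k kf; rewrite mcoeffZ mcoeffX.
by case: eqP => [km|_]; [rewrite -km kf in mf | rewrite mulr0].
Qed.

Lemma redD f g : red (f + g) = red f + red g.
Proof. by apply/mpolyP => m; rewrite mcoeffD !mcoeff_red mcoeffD. Qed.

Lemma redN f : red (- f) = - red f.
Proof. by apply/mpolyP => m; rewrite mcoeffN !mcoeff_red mcoeffN. Qed.

Lemma redB f g : red (f - g) = red f - red g.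
Proof. by rewrite redD redN. Qed.

Lemma red0 : red 0 = 0.
Proof. by apply/mpolyP => m; rewrite mcoeff_red !mcoeff0. Qed.

Lemma redX m : red 'X_[m] = 'X_[m].
Proof. by apply/mpolyP => k; rewrite mcoeff_red !mcoeffX; case: eqP. Qed.

Lemma redM f g : pol_ge 0 f -> pol_ge 0 g -> red (f * g) = red f * red g.
Proof.
move=> f0 g0; apply/mpolyP => m; rewrite mcoeff_red !mcoeffM laurent_sum.
by apply: eq_bigr => k _; rewrite !mcoeff_red coef0M.
Qed.

Lemma redZ a f : order_ge 0 a -> pol_ge 0 f -> red (a *: f) = a 0 *: red f.
Proof.
by move=> a0 f0; apply/mpolyP => m; rewrite mcoeff_red !mcoeffZ mcoeff_red coef0M.
Qed.

Lemma red_eq0 f : pol_ge 0 f -> red f = 0 -> pol_ge 1 f.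
Proof.
move=> f0 rf m j j1; have [j0|j0] := ltP j 0; first exact: f0.
have -> : j = 0 by lia.
by rewrite -mcoeff_red rf mcoeff0.
Qed.

Lemma red_ge1 f : pol_ge 1 f -> red f = 0.
Proof. by move=> f1; apply/mpolyP => m; rewrite mcoeff_red mcoeff0 f1. Qed.

Lemma red_lift (g : P0) : exists f, pol_ge 0 f /\ red f = g.
Proof.
elim/mpolyind: g => [|a m g _ _ [f [f0 fg]]]; first by exists 0; split; [exact: pol_ge0 | exact: red0].
have a0 : order_ge 0 (lmono a 0) by move=> j j0 /=; case: eqP => // ?; lia.
exists (lmono a 0 *: 'X_[m] + f); split.
  by apply: pol_geD => //; rewrite -[0]addr0; apply: pol_geZ => //; exact: pol_geX.
by rewrite redD redZ ?redX ?fg //; exact: pol_geX.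
Qed.

End Reduction.

(** * Homogeneous components *)

Section HomogeneousParts.
Variables (n : nat) (K : comNzRingType).
Local Notation P := {mpoly K[n]}.
Local Notation part d f := (pihomog (@mdeg n) d f).

Lemma mcoeff_part d (f : P) m : (part d f)@_m = if mdeg m == d then f@_m else 0.
Proof.
elim/mpolyind: f => [|a k f _ _ IH]; first by rewrite pihomog0 mcoeff0 if_same.
rewrite linearP /= pihomogX !mcoeffD !mcoeffZ IH mcoeffX.
have [<-|km] := eqVneq k m.
  by case: ifP => _; rewrite ?mcoeffX ?mcoeff0 ?eqxx ?mulr0 ?addr0.
have -> : (if mdeg k == d then 'X_[k] else 0 : P)@_m = 0.
  by case: ifP => _; rewrite ?mcoeffX ?(negPf km) ?mcoeff0.
by rewrite !mulr0 !add0r.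
Qed.

Lemma part_sum (f : P) : exists k, f = \sum_(d < k) part d f.
Proof. by exists (mmeasure (@mdeg n) f); apply: pihomog_partitionE. Qed.

Lemma mul_part_homog (l f : P) d : l \is 1.-homog -> l * part d f \is d.+1.-homog.
Proof. by move=> l1; have := dhomogM l1 (pihomogP (@mdeg n) d f); rewrite add1n. Qed.

Lemma part_mul_homog1 (l f : P) d : l \is 1.-homog -> part d.+1 (l * f) = l * part d f.
Proof.
move=> l1; have [k fE] := part_sum f; rewrite [in LHS]fE mulr_sumr linear_sum /=.
rewrite [in RHS]fE !linear_sum /= mulr_sumr; apply: eq_bigr => i _.
have [->|di] := eqVneq (i : nat) d.
  by rewrite pihomog_id pihomog_dE //; apply: mul_part_homog.
rewrite [part d _](pihomog_ne0 di) ?mulr0 ?pihomogP //.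
by rewrite (@pihomog_ne0 _ _ _ i.+1) //; apply: mul_part_homog.
Qed.

Lemma part0_mul_homog1 (l f : P) : l \is 1.-homog -> part 0 (l * f) = 0.
Proof.
move=> l1; have [k fE] := part_sum f; rewrite [in LHS]fE mulr_sumr linear_sum /=.
rewrite big1 // => i _.
by rewrite (@pihomog_ne0 _ _ _ i.+1) //; apply: mul_part_homog.
Qed.

Definition graded (J : ring_mod P -> Prop) := forall f d, J f -> J (part d f).

Lemma plus_graded J (l : P) : is_submod J -> graded J -> l \is 1.-homog -> graded (plus J l).
Proof.
move=> JP Jg l1 _ d [u [g [Ju ->]]]; rewrite pihomogD; case: d => [|d].
  by rewrite part0_mul_homog1 // addr0; apply/plus_sub/Jg.
rewrite part_mul_homog1 //; exists (part d.+1 u), (part d g); split=> //; exact: Jg.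
Qed.

End HomogeneousParts.

(** * Lifting regularity along the [t]-adic valuation *)

Section Lifting.
Variables (F : fieldType) (n : nat).
Local Notation L := (laurent F).
Local Notation P := {mpoly L[n]}.
Local Notation P0 := {mpoly F[n]}.
Local Notation part d f := (pihomog (@mdeg n) d f).
Implicit Types (J : ring_mod P -> Prop) (Jr : ring_mod P0 -> Prop).

(** [Jr] is the initial ideal of [J]: the image at [t = 0] of the elements of [J] whose coefficients
    are in [F[[t]]]. *)
Definition reduces_to J Jr :=
  (forall f, J f -> pol_ge 0 f -> Jr (red f)) /\
  (forall g, Jr g -> exists f, [/\ J f, pol_ge 0 f & red f = g]).

Lemma ideal_scale J a f : is_submod J -> J f -> J ((a : L) *: (f : P)).
Proof. by move=> JP Jf; rewrite -mul_mpolyC; exact: (submodZ _ JP Jf). Qed.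

Lemma tpowZK k (f : P) : tpow F (- k) *: (tpow F k *: f) = f.
Proof. by rewrite scalerA mulrC tpow_unit scale1r. Qed.

Lemma tpowZK' k (f : P) : tpow F k *: (tpow F (- k) *: f) = f.
Proof. by rewrite scalerA tpow_unit scale1r. Qed.

(* Subspaces of a finite-dimensional space are closed for the [t]-adic topology. *)
Lemma ideal_closed J (s : seq 'X_{1..n}) (f : P) : is_submod J ->
  {subset msupp f <= s} ->
  (forall k : nat, exists j : P, [/\ J j, {subset msupp j <= s} & pol_ge k (f - j)]) ->
  J f.
Proof.
move=> JP; elim: s f => [|m s IH] f fs fJ.
  rewrite (_ : f = 0); first by case: JP.
  apply: msuppnil0; case: (msupp f) fs => // m s fs.
  by have := fs m (mem_head _ _).
have supp_tail (g : P) : {subset msupp g <= m :: s} -> g@_m = 0 -> {subset msupp g <= s}.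
  move=> gs gm k kg; have := gs k kg; rewrite in_cons => /orP[/eqP km|//].
  by move: kg; rewrite mcoeff_msupp km gm eqxx.
(* Elimination of the coordinate [m]: with a pivot in [J] it is subtracted off, and without one it
   vanishes on the relevant elements of [J], hence on their limit [f]. *)
have [[j [Jj js jm]]|nj] := pselect (exists j : P, [/\ J j, {subset msupp j <= m :: s} & j@_m != 0]).
  pose j1 := (j@_m)^-1 *: j.
  have Jj1 : J j1 by apply: ideal_scale.
  have j1m : j1@_m = 1 by rewrite mcoeffZ mulVf.
  have j1s : {subset msupp j1 <= m :: s} by move=> k /msuppZ_le/js.
  have subs (g : P) (a : L) : {subset msupp g <= m :: s} -> {subset msupp (g - a *: j1) <= m :: s}.
    move=> gs k /msuppB_le; rewrite mem_cat => /orP[/gs //|/msuppZ_le]; exact: j1s.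
  have [N Nj1] := pol_ge_ex j1.
  rewrite -[f](subrK (f@_m *: j1)); apply: (submodD JP); last exact: ideal_scale.
  apply: IH => [|k].
    by apply: supp_tail; [apply: subs | rewrite mcoeffB mcoeffZ j1m mulr1 subrr].
  (* The extra precision [N] pays for the subtracted multiple of [j1], whose coefficients have order
     at least [- N]. *)
  have [jk [Jjk jks fjk]] := fJ (k + N)%N.
  exists (jk - jk@_m *: j1); split.
  - by apply: (submodB JP) => //; apply: ideal_scale.
  - by apply: supp_tail; [apply: subs | rewrite mcoeffB mcoeffZ j1m mulr1 subrr].
  have -> : f - f@_m *: j1 - (jk - jk@_m *: j1) = (f - jk) - (f - jk)@_m *: j1.
    by rewrite mcoeffB scalerBl !opprD !opprK addrACA.
  apply: pol_geB; first by apply: pol_ge_le fjk; lia.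
  have -> : k%:Z = (k + N)%N%:Z + - N%:Z by lia.
  exact: pol_geZ.
have jm0 (j : P) : J j -> {subset msupp j <= m :: s} -> j@_m = 0.
  by move=> Jj js; apply: contrapT => /eqP jm; apply: nj; exists j.
apply: IH => [|k].
  apply: supp_tail => //; apply: order_ge_inf => k.
  have [j [Jj js fj]] := fJ k; have := fj m.
  by rewrite mcoeffB (jm0 j) // subr0.
have [j [Jj js fj]] := fJ k; exists j; split=> //.
by apply: supp_tail => //; apply: jm0.
Qed.

(** An integral [u + l g] may have poles in [g] that cancel against [u]. They are removed one order
    at a time by changing [g] by elements of [J], which exist because [red l] is regular modulo
    [Jr]. *)
Lemma reduces_to_plus J Jr (l : P) : is_submod J -> is_submod Jr -> reduces_to J Jr ->
  pol_ge 0 l -> (forall g : ring_mod P0, Jr (red l *: g) -> Jr g) ->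
  reduces_to (plus J l) (plus Jr (red l)).
Proof.
move=> JP JrP [redJ liftJ] l0 regl; split; last first.
  move=> _ [u0 [g0 [Ju0 ->]]]; have [u [Ju uge uE]] := liftJ u0 Ju0.
  have [g [gge gE]] := red_lift g0.
  exists (u + l * g); split; first by exists u, g.
    by apply: pol_geD => //; rewrite -[0]addr0; apply: pol_geM.
  by rewrite redD redM // uE gE.
move=> h [u [g [Ju hE]]] h0; have [N] := pol_ge_ex g.
elim: N u g Ju hE => [|N IH] u g Ju hE gN.
  have lg0 : pol_ge 0 (l * g) by rewrite -[0]addr0; apply: pol_geM.
  exists (red u), (red g); split.
    apply: redJ => //; rewrite (_ : u = h - l * g); first exact: pol_geB.
    by rewrite hE addrK.
  by rewrite hE redD redM.
set k : int := N.+1%:Z in gN *.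
have g0 : pol_ge 0 (tpow F k *: g) by have := pol_ge_tpow (p := k) gN; rewrite subrr.
have h1 : pol_ge 1 (tpow F k *: h).
  by apply: (@pol_ge_le _ _ _ (k + 0)); [rewrite /k; lia | apply: pol_ge_tpow].
have lg0 : pol_ge 0 (l * (tpow F k *: g)) by rewrite -[0]addr0; apply: pol_geM.
have uE : tpow F k *: u = tpow F k *: h - l * (tpow F k *: g).
  by rewrite hE scalerDr -scalerAr addrK.
have u0 : pol_ge 0 (tpow F k *: u) by rewrite uE; apply: pol_geB => //; apply: pol_ge_le h1.
(* As [t^k h] vanishes at [t = 0], the reductions of [t^k u] and [l t^k g] are opposite; so [red l]
   times the leading part of [g] is in [Jr], and regularity cancels [red l]. *)
have [|j [Jj jge jE]] := liftJ (red (tpow F k *: g)).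
  apply: regl; rewrite -[_ *: _]/(red l * red (tpow F k *: g)) -redM //.
  have -> : red (l * (tpow F k *: g)) = - red (tpow F k *: u).
    by rewrite uE redB (red_ge1 h1) sub0r opprK.
  have := submodZ (-1 : P0) JrP (redJ _ (ideal_scale (tpow F k) JP Ju) u0).
  by rewrite ring_scaleE mulN1r.
pose g' := g - tpow F (- k) *: j.
apply: (IH (u + l * (tpow F (- k) *: j)) g').
- by apply: (submodD JP) => //; apply: submodZ => //; apply: ideal_scale.
- by rewrite hE -addrA; congr (_ + _); rewrite /g' /GRing.scale /= mulrBr addrC subrK.
have -> : g' = tpow F (- k) *: (tpow F k *: g - j) by rewrite scalerBr tpowZK.
have -> : - N%:Z = - k + 1 :> int by rewrite /k; lia.
apply: pol_ge_tpow; apply: red_eq0; first exact: pol_geB.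
by rewrite redB jE subrr.
Qed.

(** For [f] homogeneous and integral, regularity at [t = 0] approximates [f] by elements of [J] to
    every order in [t]: the error, divided by its power of [t], is again carried into [J] by [l].
    Closedness in a fixed degree then puts [f] in [J]. *)
Lemma lift_regular1 J Jr (l : P) : is_submod J -> is_submod Jr -> graded J ->
  reduces_to J Jr -> pol_ge 0 l -> l \is 1.-homog ->
  (forall g : ring_mod P0, Jr (red l *: g) -> Jr g) ->
  forall f : ring_mod P, J (l *: f) -> J f.
Proof.
move=> JP JrP Jg [redJ liftJ] l0 l1 regl.
suff homogP (f : P) d : pol_ge 0 f -> f \is d.-homog -> J (l * f) -> J f.
  move=> f Jlf; have [k ->] := part_sum f.
  elim/big_rec: _ => [|d g _ Jg']; first by case: JP.
  have Jd : J (part d f); last exact: (submodD JP Jd Jg').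
  have [N Nf] := pol_ge_ex (part d f); rewrite -[part d f](tpowZK N).
  apply: ideal_scale => //; apply: (homogP _ d).
  - by have := pol_ge_tpow (p := N%:Z) Nf; rewrite subrr.
  - by apply: dhomogZ; apply: pihomogP.
  by rewrite -scalerAr; apply: ideal_scale => //; rewrite -part_mul_homog1 //; apply: Jg.
move=> f0 fd Jlf.
have approx (k : nat) : exists j : P, [/\ J j, j \is d.-homog & pol_ge k (f - j)].
  elim: k => [|k [j [Jj jd fj]]].
    by exists 0; split; [case: JP | exact: dhomog0 | rewrite subr0].
  pose g := tpow F (- k%:Z) *: (f - j).
  have g0 : pol_ge 0 g by have := pol_ge_tpow (p := - k%:Z) fj; rewrite addNr.
  have gd : g \is d.-homog by apply/dhomogZ/rpredB.
  have [|j' [Jj' j'0 j'E]] := liftJ (red g).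
    apply: regl; rewrite -[_ *: _]/(red l * red g) -redM //; apply: redJ.
      rewrite -scalerAr mulrBr; apply: ideal_scale => //.
      by apply: (submodB JP) => //; apply: (submodZ l JP Jj).
    by rewrite -[0]addr0; apply: pol_geM.
  (* Only the degree [d] part of the lift is kept. It has the same reduction, since [g] is
     homogeneous of degree [d], and all approximations stay in one finite-dimensional space. *)
  exists (j + tpow F k *: part d j'); split.
  - by apply: (submodD JP) => //; apply: ideal_scale => //; apply: Jg.
  - by apply: rpredD => //; apply: dhomogZ; apply: pihomogP.
  have -> : f - (j + tpow F k *: part d j') = tpow F k *: (g - part d j').
    by rewrite scalerBr tpowZK' opprD addrA.
  have -> : k.+1%:Z = k%:Z + 1 by lia.
  apply: pol_ge_tpow; apply: red_eq0.
    by apply: pol_geB => // m; rewrite mcoeff_part; case: ifP.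
  apply/mpolyP => m; rewrite redB mcoeffB mcoeff0 !mcoeff_red mcoeff_part.
  case: eqP => [_|/eqP md]; first by rewrite -!mcoeff_red j'E subrr.
  by rewrite (dhomog_nemf_coeff gd md) subrr.
pose s : seq 'X_{1..n} := [seq bmnm m | m : 'X_{1..n < d.+1}].
have supp_s (g : P) : g \is d.-homog -> {subset msupp g <= s}.
  move=> gd m mg; have md : mdeg m = d by apply: (dhomog_mf gd).
  have mdS : (mdeg m < d.+1)%N by rewrite md.
  by apply/mapP; exists (BMultinom mdS); rewrite ?mem_enum.
apply: (@ideal_closed J s f JP) => [|k]; first exact: supp_s.
by have [j [Jj jd fj]] := approx k; exists j; split=> //; apply: supp_s.
Qed.

Lemma lift_regular J Jr (ls : seq P) : is_submod J -> is_submod Jr -> graded J ->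
  reduces_to J Jr -> (forall l, l \in ls -> pol_ge 0 l /\ l \is 1.-homog) ->
  regular Jr (map (@red F n) ls) -> regular J ls.
Proof.
elim: ls J Jr => //= l ls IH J Jr JP JrP Jg JJr lsP [reg0 regs0].
have [l0 l1] := lsP l (mem_head _ _).
split; first exact: lift_regular1 JJr l0 l1 reg0.
apply: IH regs0.
- exact: plus_submod.
- exact: plus_submod.
- exact: plus_graded.
- exact: reduces_to_plus.
by move=> k kls; apply: lsP; rewrite in_cons kls orbT.
Qed.

End Lifting.

(** * The non-local ideal of a directed graph *)

Section NonlocalIdeal.
Variables (F : fieldType) (V : finType) (n : nat) (tl hd : 'I_n -> option V) (w : V -> nat).
Local Notation L := (laurent F).
Local Notation P := {mpoly L[n]}.
Local Notation P0 := {mpoly F[n]}.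
Local Notation part d f := (pihomog (@mdeg n) d f).
Local Notation into := (enters tl hd).
Local Notation out_of := (leaves tl hd).
Implicit Types (Gam : {set V}) (a b m : 'X_{1..n}) (phi : V -> int).

Definition mset (A : pred 'I_n) : 'X_{1..n} := [multinom (A i : nat) | i < n].

Definition set_weight Gam := (\sum_(v in Gam) w v)%N.

Definition binomial Gam : P :=
  tvar F ^+ set_weight Gam *: 'X_[mset (out_of Gam)] - 'X_[mset (into Gam)].

Definition nonlocal_ideal : ring_mod P -> Prop :=
  fun f => f \in span (fun p : ring_mod P => exists Gam, p = binomial Gam).

Definition pot phi (o : option V) : int := if o is Some v then phi v else 0.

Hypothesis w_gt0 : forall v, (0 < w v)%N.
(** Connectedness to the outside, where potentials are [0]: a potential that is constant along every
    edge vanishes. *)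
Hypothesis connected : forall phi,
  (forall i, pot phi (tl i) = pot phi (hd i)) -> forall v, phi v = 0.
Hypothesis balanced : forall Gam, mdeg (mset (out_of Gam)) = mdeg (mset (into Gam)).

Lemma nonlocal_submod : is_submod nonlocal_ideal.
Proof.
split=> [|c x y xJ yJ]; first exact: rpred0.
by apply: rpredD => //; apply: rpredZ.
Qed.

Lemma nonlocal_mul (g : P) Gam : nonlocal_ideal (g * binomial Gam).
Proof.
have bJ : nonlocal_ideal (binomial Gam) by apply: gen_span; exists Gam.
exact: (submodZ g nonlocal_submod bJ).
Qed.

Lemma nonlocal_ind (A : P -> Prop) :
  A 0 -> (forall f g, A f -> A g -> A (f + g)) -> (forall (c : L) f, A f -> A (c *: f)) ->
  (forall m Gam, A ('X_[m] * binomial Gam)) -> forall f, nonlocal_ideal f -> A f.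
Proof.
move=> A0 AD AZ Ab f /spanP; elim=> // q x y [Gam ->] _ Ay; apply: (AD) => //.
rewrite ring_scaleE; elim/mpolyind: q => [|c m q _ _ Aq]; first by rewrite mul0r.
by rewrite mulrDl; apply: AD => //; rewrite -scalerAl; apply: AZ.
Qed.

Lemma binomial_homog m Gam :
  'X_[m] * binomial Gam \is (mdeg m + mdeg (mset (into Gam)))%N.-homog.
Proof.
apply: dhomogM; first by rewrite dhomogX.
apply: rpredB; last by rewrite dhomogX.
by apply: dhomogZ; rewrite dhomogX /= balanced.
Qed.

Lemma nonlocal_graded : graded nonlocal_ideal.
Proof.
move=> f d; move: f; apply: (nonlocal_ind (A := fun f => nonlocal_ideal (part d f))) => [|f g Jf Jg|c f Jf|m Gam].
- by rewrite pihomog0; case: nonlocal_submod.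
- by rewrite pihomogD; apply: (submodD nonlocal_submod).
- by rewrite linearZ /=; apply: ideal_scale => //; exact: nonlocal_submod.
have [md|md] := eqVneq (mdeg m + mdeg (mset (into Gam)))%N d.
  rewrite pihomog_dE; last by rewrite -md; exact: binomial_homog.
  exact: nonlocal_mul.
rewrite (pihomog_ne0 md); last exact: binomial_homog.
by case: nonlocal_submod.
Qed.

(** [phi v] counts, formally, how often the outgoing edges of [v] are traded for the incoming ones
    on the way from [a] to [b]. Each trade contributes [w v] to the exponent of [t] in
    [pot_weight]. *)
Definition shifts a b phi := forall i, (b i)%:Z + pot phi (tl i) = (a i)%:Z + pot phi (hd i).

Definition pot_weight phi : int := \sum_v phi v * (w v)%:Z.

(** The difference of two potentials is constant along edges, hence zero by connectedness. *)
Lemma shifts_weight a b phi psi : shifts a b phi -> shifts a b psi ->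
  pot_weight phi = pot_weight psi.
Proof.
move=> phiP psiP; apply: eq_bigr => v _; congr (_ * _).
apply/eqP; rewrite -subr_eq0; apply/eqP.
apply: (connected (phi := fun v => phi v - psi v)) => i.
have potB o : pot (fun v => phi v - psi v) o = pot phi o - pot psi o by case: o.
by rewrite !potB; have := phiP i; have := psiP i; lia.
Qed.

(* [transport a b] is the coefficient [c] such that ['X_[b]] is congruent to
   [c *: 'X_[a]] modulo the nonlocal ideal, and [0] if there is none. *)
Definition transport a b : L :=
  if pselect (exists phi, shifts a b phi) is left ex then tpow F (pot_weight (sval (cid ex)))
  else 0.

Lemma transportE a b phi : shifts a b phi -> transport a b = tpow F (pot_weight phi).
Proof.
move=> phiP; rewrite /transport; case: pselect => [ex|[]]; last by exists phi.
by congr tpow; apply: shifts_weight phiP; exact: (svalP (cid ex)).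
Qed.

Lemma transport0 a b : ~ (exists phi, shifts a b phi) -> transport a b = 0.
Proof. by move=> nex; rewrite /transport; case: pselect. Qed.

Lemma pot_set phi Gam (s : int) o :
  pot (fun v => phi v + s * (v \in Gam)%:Z) o = pot phi o + s * (oin o Gam)%:Z.
Proof. by case: o => //=; rewrite mulr0. Qed.

Lemma shifts_binomial a m Gam phi :
  shifts a (m + mset (out_of Gam))%MM phi ->
  shifts a (m + mset (into Gam))%MM (fun v => phi v + 1 * (v \in Gam)%:Z).
Proof.
move=> phiP i; have := phiP i; rewrite !pot_set !mnmDE !mnmE /leaves /enters; case: (oin (tl i) Gam); case: (oin (hd i) Gam) => /=; lia.
Qed.

Lemma shifts_binomial' a m Gam phi :
  shifts a (m + mset (into Gam))%MM phi ->
  shifts a (m + mset (out_of Gam))%MM (fun v => phi v + (-1) * (v \in Gam)%:Z).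
Proof.
move=> phiP i; have := phiP i; rewrite !pot_set !mnmDE !mnmE /leaves /enters; case: (oin (tl i) Gam); case: (oin (hd i) Gam) => /=; lia.
Qed.

Lemma transport_binomial a m Gam :
  transport a (m + mset (into Gam))%MM =
  tvar F ^+ set_weight Gam * transport a (m + mset (out_of Gam))%MM.
Proof.
have [[phi phiP]|nex] := pselect (exists phi, shifts a (m + mset (out_of Gam))%MM phi).
  rewrite (transportE phiP) (transportE (shifts_binomial phiP)) tvarX -tpowD addrC.
  congr tpow; rewrite /pot_weight /set_weight (eq_bigr (fun v =>
    phi v * (w v)%:Z + (v \in Gam)%:Z * (w v)%:Z)) => [|v _]; last by rewrite mulrDl mul1r.
  rewrite big_split /=; congr (_ + _); rewrite [in RHS]big_mkcond /= raddf_sum /=.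
  by apply: eq_bigr => v _; case: (v \in Gam); rewrite ?mul1r ?mul0r.
rewrite !transport0 ?mulr0 // => -[phi phiP]; apply: nex.
by exists (fun v => phi v + (-1) * (v \in Gam)%:Z); apply: shifts_binomial'.
Qed.

(** The linear functional reading off the coefficient of the class of [a]. Truncation at the degree
    of [a] makes it a fixed finite sum, and by homogeneity it keeps or drops both terms of a
    binomial together. *)
Definition transport_sum a (f : P) : L :=
  \sum_(b : 'X_{1..n < (mdeg a).+1}) f@_b * transport a b.

Lemma transport_sumX a b :
  transport_sum a 'X_[b] = if (mdeg b < (mdeg a).+1)%N then transport a b else 0.
Proof.
rewrite /transport_sum; case: ifP => [ba|/negbT ba].
  rewrite (bigD1 (BMultinom ba)) //= mcoeffX eqxx mul1r big1 ?addr0 // => k kb.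
  rewrite mcoeffX; case: eqP => [bk|_]; last by rewrite mul0r.
  by case/eqP: kb; apply: val_inj.
rewrite big1 // => k _; rewrite mcoeffX; case: eqP => [bk|_]; last by rewrite mul0r.
by case/negP: ba; rewrite bk bmdeg.
Qed.

Lemma transport_sumD a f g : transport_sum a (f + g) = transport_sum a f + transport_sum a g.
Proof.
by rewrite /transport_sum -big_split; apply: eq_bigr => b _; rewrite mcoeffD mulrDl.
Qed.

Lemma transport_sumZ a c f : transport_sum a (c *: f) = c * transport_sum a f.
Proof.
by rewrite /transport_sum mulr_sumr; apply: eq_bigr => b _; rewrite mcoeffZ mulrA.
Qed.

Lemma transport_sum_nonlocal a f : nonlocal_ideal f -> transport_sum a f = 0.
Proof.
move: f; apply: (nonlocal_ind (A := fun f => transport_sum a f = 0)) => [|f g f0 g0|c f f0|m Gam].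
- by rewrite /transport_sum big1 // => b _; rewrite mcoeff0 mul0r.
- by rewrite transport_sumD f0 g0 addr0.
- by rewrite transport_sumZ f0 mulr0.
rewrite mulrBr -scalerAr -!mpolyXD -scaleN1r transport_sumD !transport_sumZ !transport_sumX.
rewrite !mdegD balanced; case: ifP => _; last by rewrite !mulr0 addr0.
by rewrite mulN1r transport_binomial subrr.
Qed.

Local Notation standard a := (~ cut_in tl hd [set: V] [set: 'I_n] a).

(** Otherwise take the set where [phi] attains its negative minimum. An edge entering it comes from
    a higher potential, the outside having potential [0], so its exponent in [a] is positive, and
    this set is a cut dividing [a]. *)
Lemma shifts_standard_ge0 a b phi : standard a -> shifts a b phi -> forall v, 0 <= phi v.
Proof.
move=> sa phiP v0; apply: contrapT => /negP; rewrite -ltNge => v0_lt0.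
have [v _ vmin] := arg_minP (phi : V -> int) (isT : xpredT v0).
apply: sa; exists [set u | phi u == phi v]; split; first exact: subsetT.
  by apply/set0Pn; exists v; rewrite inE.
move=> i _ /andP[]; case hdi: (hd i) => [u|//] /=; rewrite inE => /eqP uv tli.
have := phiP i; rewrite hdi /= uv.
have : phi v < pot phi (tl i); last by lia.
case: (tl i) tli => [x|_] /=; last exact: le_lt_trans (vmin _ isT) v0_lt0.
by rewrite inE lt_neqAle vmin // eq_sym andbT.
Qed.

Lemma shifts_weight_gt0 a b phi : standard a -> shifts a b phi -> b <> a ->
  0 < pot_weight phi.
Proof.
move=> sa phiP ba; have phi0 := shifts_standard_ge0 sa phiP.
have term0 v : 0 <= phi v * (w v)%:Z by apply: mulr_ge0.
rewrite lt_neqAle sumr_ge0 // andbT eq_sym; apply/eqP => wt0; apply: ba.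
have phiE v : phi v = 0.
  have /eqP := psumr_eq0P (fun v _ => term0 v) wt0 (i := v) isT.
  rewrite mulf_eq0 => /orP[/eqP //|]; have := w_gt0 v; lia.
apply/mnmP => i; have := phiP i.
have -> : pot phi (tl i) = 0 by case: (tl i) => //=.
have -> : pot phi (hd i) = 0 by case: (hd i) => //=.
lia.
Qed.

(** A multiple of a cut monomial lifts to a multiple of its binomial, whose other term carries [t]
    to the positive power [set_weight Gam]. Conversely, the functional of a standard monomial
    vanishes on the ideal and detects the coefficient of that monomial at [t = 0]. *)
Lemma nonlocal_reduces :
  reduces_to nonlocal_ideal (monomial_span (cut_in tl hd [set: V] [set: 'I_n])).
Proof.
split=> [f Jf f0 a|]; last first.
  apply: monomial_spanE; first split.
  - exists 0; split; [by case: nonlocal_submod | exact: pol_ge0 | exact: red0].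
  - move=> c x y [fx [Jx x0 <-]] [fy [Jy y0 <-]]; have [fc [c0 <-]] := red_lift c.
    exists (fc * fx + fy); split.
    + by case: nonlocal_submod => _; apply.
    + by apply: pol_geD => //; rewrite -[0]addr0; apply: pol_geM.
    + by rewrite redD redM.
  move=> m [Gam [_ G0 Gm]].
  have mE : m = ((m - mset (into Gam)) + mset (into Gam))%MM.
    apply/mnmP => i; rewrite mnmDE mnmBE mnmE subnK //; case: (boolP (into Gam i)) => //= iG.
    by apply: Gm => //; rewrite in_setT.
  set m' := (m - _)%MM in mE.
  have w0 : (0 < set_weight Gam)%N.
    by case/set0Pn: G0 => v vG; rewrite /set_weight (bigD1 v) //= addn_gt0 w_gt0.
  have fE : - 'X_[m'] * binomial Gam =
      'X_[m] - tpow F (set_weight Gam) *: 'X_[m' + mset (out_of Gam)].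
    by rewrite [in RHS]mE !mpolyXD /binomial tvarX mulNr mulrBr opprB -scalerAr.
  have t1 : pol_ge 1 (tpow F (set_weight Gam) *: 'X_[m' + mset (out_of Gam)] : P).
    apply: (@pol_ge_le _ _ _ ((set_weight Gam)%:Z + 0)); first by lia.
    by apply: pol_ge_tpow; apply: pol_geX.
  exists (- 'X_[m'] * binomial Gam); split; first exact: nonlocal_mul.
    by rewrite fE; apply: pol_geB; [apply: pol_geX | apply: pol_ge_le t1].
  by rewrite fE redB redX (red_ge1 t1) subr0.
rewrite mcoeff_red => fa0; apply: contrapT => sa; case/eqP: fa0.
(* Read at [t^0]. The term [b = a] gives the constant coefficient of [f] at [a]; every other term is
   zero or a coefficient in [F[[t]]] times a positive power of [t]. *)
have := transport_sum_nonlocal a Jf; rewrite /transport_sum.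
rewrite (bigD1 (BMultinom (ltnSn (mdeg a)))) //= => /(congr1 (fun c : L => c 0)).
rewrite laurentD laurent_sum big1 ?addr0 => [|b ba].
  rewrite (transportE (phi := fun=> 0)).
    rewrite /pot_weight big1 ?mulr1 // => v _; exact: mul0r.
  by move=> i; case: (tl i); case: (hd i).
have [[phi phiP]|nex] := pselect (exists phi, shifts a b phi); last first.
  by rewrite transport0 // mulr0.
rewrite (transportE phiP) mulrC tpowM f0 //.
have : 0 < pot_weight phi; last by lia.
apply: shifts_weight_gt0 phiP _ => // bE.
by case/eqP: ba; apply: val_inj.
Qed.

Variables (c d : V -> 'I_n) (ts : seq V) (o : V -> P).
Hypotheses (uts : uniq ts) (cd : {in ts, forall v, c v != d v}).
Hypothesis hdE : {in ts, forall v e, (hd e == Some v) = (e == c v) || (e == d v)}.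
Hypothesis oP : {in ts, forall v, pol_ge 0 (o v) /\ o v \is 1.-homog}.

Let l v : P := 'X_(c v) + 'X_(d v) - tvar F *: o v.

Lemma linear_form_props v : v \in ts ->
  [/\ pol_ge 0 (l v), l v \is 1.-homog & red (l v) = 'X_(c v) + 'X_(d v)].
Proof.
move=> vts; have [o0 o1] := oP vts.
have t1 : pol_ge 1 (tvar F *: o v).
  by have := pol_ge_tpow (p := 1) o0; rewrite addr0.
have x0 : pol_ge 0 ('X_(c v) + 'X_(d v) : P) by apply: pol_geD; apply: pol_geX.
split.
- by apply: pol_geB => //; apply: pol_ge_le t1.
- by apply: rpredB; [apply: rpredD; rewrite dhomogX /= mdeg1 | apply: dhomogZ].
by rewrite redB (red_ge1 t1) subr0 redD !redX.
Qed.

Lemma regular_linear_forms (J : ring_mod P -> Prop) (Jr : ring_mod P0 -> Prop) :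
  is_submod J -> is_submod Jr -> graded J -> reduces_to J Jr ->
  regular Jr [seq 'X_(c v) + 'X_(d v) | v <- ts] -> regular J [seq l v | v <- ts].
Proof.
move=> JP JrP Jg JJr reg; apply: lift_regular JJr _ _ => // [k /mapP[v vts ->]|].
  by have [] := linear_form_props vts.
rewrite -map_comp (_ : [seq _ | v <- ts] = [seq 'X_(c v) + 'X_(d v) | v <- ts]) //.
by apply/eq_in_map => v vts /=; have [] := linear_form_props vts.
Qed.

Lemma regular_linear_nonlocal : regular nonlocal_ideal [seq l v | v <- ts].
Proof.
apply: regular_linear_forms nonlocal_reduces _.
- exact: nonlocal_submod.
- by apply: monomial_span_submod => m m'; apply: cut_in_up.
- exact: nonlocal_graded.
(* The initial state: nothing deleted, nothing contracted. *)
have := @regular_cut_in V n tl hd F c d ts uts cd hdE [set: V] [set: 'I_n] set0.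
rewrite (_ : (fun m => _) = cut_in tl hd [set: V] [set: 'I_n]); last first.
  by apply/funext => m; apply/propext; split=> [[[i]|//]|]; [rewrite in_set0 | right].
by apply=> [e|v _]; rewrite ?in_set0 ?in_setT.
Qed.

Lemma regular_linear_zero : regular (@zero_sub P (ring_mod P)) [seq l v | v <- ts].
Proof.
apply: (@regular_linear_forms _ (@zero_sub P0 (ring_mod P0))).
- exact: zero_submod.
- exact: zero_submod.
- by move=> f k ->; rewrite /zero_sub pihomog0.
- split=> [f -> _|g ->]; first exact: red0.
  by exists 0; split; [|exact: pol_ge0 | exact: red0].
apply: regular_free_var_sums => //; exact: heads_disjoint hdE.
Qed.

End NonlocalIdeal.

(** * Thin edges of a closed braid graph *)

Section TerminalVertices.
Variables (T : finType) (r : rel T).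
Hypothesis r_fun : forall x y z, r x y -> r x z -> y = z.

(** Confluence of a partial function: a step backwards followed by a path forwards cancels against
    the first step of that path. *)
Lemma connect_confluent x y : connect (fun x y => r x y || r y x) x y ->
  exists z, connect r x z /\ connect r y z.
Proof.
case/connectP=> p; elim: p x => [|u p IH] x /=.
  by move=> _ ->; exists x.
case/andP=> xu up yE; have [z [uz yz]] := IH u up yE.
case/orP: xu => [xu|ux]; first by exists z; split=> //; apply: connect_trans uz; apply: connect1.
case/connectP: uz => -[_ zE|u' q /= /andP[uu' u'q] zE].
  by exists x; split=> //; apply: connect_trans yz _; rewrite zE; apply: connect1.
exists z; split=> //; apply/connectP; exists q => //.
  by rewrite -(r_fun uu' ux).
by rewrite -(r_fun uu' ux).
Qed.

Lemma terminal_connect_eq x y : (forall z, ~~ r x z) -> (forall z, ~~ r y z) ->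
  connect (fun x y => r x y || r y x) x y -> x = y.
Proof.
move=> xt yt /connect_confluent[z [/connectP[p xp zx] /connectP[q yq zy]]].
have term u s : (forall v, ~~ r u v) -> path r u s -> s = [::].
  by move=> ut; case: s => //= v s; rewrite (negPf (ut v)).
by rewrite (term x p xt xp) /= in zx; rewrite (term y q yt yq) /= in zy; rewrite -zx -zy.
Qed.

End TerminalVertices.

Section ThinEdges.
Variable D : braid_diagram.
Local Notation b := (cut_strand D).
Local Notation n := (height D).
Implicit Types (v : vertex D) (i : strand D) (s u : piece D) (e f : thin_edge D)
  (Gam : {set vertex D}).

Lemma joined_upP s u : reflect
  ((exists v, [/\ ~~ meets v s.1, s = below v s.1 & u = above v s.1]) \/
   [/\ s.1 != ord_max, s = (s.1, ord_max) & u = (s.1, ord0)])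
  (joined_up s u).
Proof.
apply: (iffP orP) => -[].
- by case/existsP=> v /and3P[nm /eqP sE /eqP uE]; left; exists v.
- case/and4P=> /eqP su nmax /eqP s2 /eqP u2; right; split=> //.
    by case: s s2 {su nmax} => /= ? ? ->.
  by case: u u2 su => /= ? ? -> ->.
- by case=> v [nm sE uE]; left; apply/existsP; exists v; rewrite nm -sE -uE !eqxx.
by case=> nmax -> ->; right; rewrite /= nmax !eqxx.
Qed.

Lemma below_inj v w i j : below v i = below w j -> v = w /\ i = j.
Proof. by case=> -> vw; split=> //; apply: val_inj. Qed.

Lemma above_inj v w i j : above v i = above w j -> v = w /\ i = j.
Proof. by move=> E; split; [exact: (@lift_inj _ ord0 v w (congr1 snd E)) | exact: (congr1 fst E)]. Qed.

Lemma below_not_top v i : (below v i).2 != ord_max.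
Proof. by rewrite /below -val_eqE /= neq_ltn ltn_ord. Qed.

Lemma above_not_bottom v i : (above v i).2 != ord0.
Proof. by rewrite eq_sym neq_lift. Qed.

(** With [joined_up_inj], this makes the pieces of a thin edge a chain. A piece with nothing joined
    above it, such as one just below a vertex on its strand, is then determined by its thin edge,
    and likewise downwards. *)
Lemma joined_up_fun s u w : joined_up s u -> joined_up s w -> u = w.
Proof.
move=> /joined_upP[[v [_ sv ->]]|[_ sv ->]] /joined_upP[[v' [_ sv' ->]]|[_ sv' ->]] //.
- by have [-> _] := below_inj (etrans (esym sv) sv').
- by have := below_not_top v s.1; rewrite -sv sv' eqxx.
by have := below_not_top v' s.1; rewrite -sv' sv eqxx.
Qed.

Lemma joined_up_inj s u w : joined_up u s -> joined_up w s -> u = w.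
Proof.
move=> /joined_upP[[v [_ uv sv]]|[_ uv sv]] /joined_upP[[v' [_ wv sv']]|[_ wv sv']].
- by have [vv uw] := above_inj (etrans (esym sv) sv'); rewrite uv wv vv uw.
- by have := above_not_bottom v u.1; rewrite -sv sv' eqxx.
- by have := above_not_bottom v' w.1; rewrite -sv' sv eqxx.
by rewrite uv wv; case: (etrans (esym sv) sv') => ->.
Qed.

Lemma meets_below_terminal v i s : meets v i -> ~~ joined_up (below v i) s.
Proof.
move=> vi; apply/joined_upP => -[[w [nw /below_inj[vw _] _]]|[_ E _]].
  by rewrite -vw vi in nw.
by have := below_not_top v i; rewrite E eqxx.
Qed.

Lemma meets_above_initial v i s : meets v i -> ~~ joined_up s (above v i).
Proof.
move=> vi; apply/joined_upP => -[[w [nw _ /above_inj[vw si]]]|[_ _ E]].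
  by rewrite -vw -si vi in nw.
by have := above_not_bottom v i; rewrite E eqxx.
Qed.

Lemma bottom_cut_initial s : ~~ joined_up s (ord_max, ord0).
Proof.
apply/joined_upP => -[[w [_ _ E]]|[smax _ [E]]].
  by have := above_not_bottom w s.1; rewrite -E eqxx.
by rewrite -E eqxx in smax.
Qed.

Lemma thin_eq s u : (thin s = thin u) <-> connect (@joined D) s u.
Proof.
split=> [[]|]; first by move/(fingraph.rootP (@joined_connect_sym D)).
by move/(fingraph.rootP (@joined_connect_sym D)) => su; apply: val_inj.
Qed.

Lemma thin_terminal_eq s u : (forall w, ~~ joined_up s w) -> (forall w, ~~ joined_up u w) ->
  thin s = thin u -> s = u.
Proof. by move=> st ut /thin_eq; apply: terminal_connect_eq joined_up_fun _ _ st ut. Qed.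

Lemma thin_initial_eq s u : (forall w, ~~ joined_up w s) -> (forall w, ~~ joined_up w u) ->
  thin s = thin u -> s = u.
Proof.
move=> st ut /thin_eq su.
apply: (@terminal_connect_eq _ (fun x y => joined_up y x)) => // [x y z|].
  exact: joined_up_inj.
by rewrite (eq_connect (e' := @joined D)) // => x y; rewrite /joined orbC.
Qed.

Lemma thin_below_inj v w i j : meets v i -> meets w j ->
  thin (below v i) = thin (below w j) -> v = w /\ i = j.
Proof.
move=> vi wj /thin_terminal_eq E; apply: below_inj; apply: E => u; exact: meets_below_terminal.
Qed.

Lemma thin_above_inj v w i j : meets v i -> meets w j ->
  thin (above v i) = thin (above w j) -> v = w /\ i = j.
Proof.
move=> vi wj /thin_initial_eq E; apply: above_inj; apply: E => u; exact: meets_above_initial.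
Qed.

Lemma goes_inP v e : reflect (exists2 i, meets v i & e = thin (below v i)) (goes_in v e).
Proof.
by apply: (iffP existsP) => [[i /andP[vi /eqP ->]]|[i vi ->]]; exists i; rewrite // vi eqxx.
Qed.

Lemma goes_outP v e : reflect (exists2 i, meets v i & e = thin (above v i)) (goes_out v e).
Proof.
by apply: (iffP existsP) => [[i /andP[vi /eqP ->]]|[i vi ->]]; exists i; rewrite // vi eqxx.
Qed.

Lemma goes_in_uniq v w e : goes_in v e -> goes_in w e -> v = w.
Proof.
by move=> /goes_inP[i vi ->] /goes_inP[j wj] /thin_below_inj[].
Qed.

Lemma goes_out_uniq v w e : goes_out v e -> goes_out w e -> v = w.
Proof.
by move=> /goes_outP[i vi ->] /goes_outP[j wj] /thin_above_inj[].
Qed.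

Lemma not_goes_out_cut v : ~~ goes_out v (cut_edge D).
Proof.
apply/negP => /goes_outP[i vi] /thin_initial_eq E.
have := above_not_bottom v i; rewrite -E ?eqxx // => w; first exact: bottom_cut_initial.
exact: meets_above_initial.
Qed.

(** The start is unique by [goes_out_uniq]; [None] means that the edge starts at no vertex, as the
    cut edge does. *)
Definition source e : option (vertex D) := [pick v | goes_out v e].
Definition target e : option (vertex D) := [pick v | goes_in v e].

Lemma sourceE e v : (source e == Some v) = goes_out v e.
Proof.
rewrite /source; case: pickP => [w we|none]; last by rewrite none.
apply/eqP/idP => [[<-] //|ve]; by rewrite (goes_out_uniq we ve).
Qed.

Lemma targetE e v : (target e == Some v) = goes_in v e.
Proof.
rewrite /target; case: pickP => [w we|none]; last by rewrite none.
apply/eqP/idP => [[<-] //|ve]; by rewrite (goes_in_uniq we ve).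
Qed.

Lemma starts_inE Gam e : starts_in Gam e = oin (source e) Gam.
Proof.
apply/existsP/idP => [[v /andP[vG]]|]; first by rewrite -sourceE => /eqP ->.
case E: (source e) => [v|//] /= vG; exists v; by rewrite vG -sourceE E eqxx.
Qed.

Lemma ends_inE Gam e : ends_in Gam e = oin (target e) Gam.
Proof.
apply/existsP/idP => [[v /andP[vG]]|]; first by rewrite -targetE => /eqP ->.
case E: (target e) => [v|//] /= vG; exists v; by rewrite vG -targetE E eqxx.
Qed.

(** The number of thin edges on each side of [v], and at the same time the contribution of [v] to
    [os_weight]. *)
Definition degree v : nat := if thick v then 2%N else 1%N.

Lemma card_meets v : #|[pred i | meets v i]| = degree v.
Proof.
rewrite /degree /thick; case E: (word v) => [k|j]; last first.
  rewrite /= -(card1 j); by apply: eq_card => i; rewrite !inE /meets E.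
have kk : widen_ord (leqnSn b) k != fintype.lift ord0 k.
  by rewrite -val_eqE /= neq_ltn ltnSn.
transitivity (widen_ord (leqnSn b) k != fintype.lift ord0 k).+1; last by rewrite kk.
rewrite -card2; apply: eq_card => i.
by rewrite !inE /meets E -!val_eqE.
Qed.

End ThinEdges.

Lemma card_split (T : finType) (A B : pred T) :
  (#|[pred x | A x && B x]| + #|[pred x | A x && ~~ B x]|)%N = #|[pred x | A x]|.
Proof.
rewrite -(cardID B A); congr (_ + _)%N; apply: eq_card => x; rewrite !inE //.
exact: andbC.
Qed.

Lemma card_split_comm (T : finType) (A B : pred T) :
  (#|[pred x | B x && A x]| + #|[pred x | A x && ~~ B x]|)%N = #|[pred x | A x]|.
Proof. by rewrite -(card_split A B); congr (_ + _)%N; apply: eq_card => x; rewrite !inE andbC. Qed.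

Lemma card_oin (T V : finType) (h : T -> option V) (dg : V -> nat) (A : {set V}) :
  (forall y : V, #|[pred x | h x == Some y]| = dg y) ->
  #|[pred x | oin (h x) A]| = (\sum_(y in A) dg y)%N.
Proof.
move=> hdg; rewrite -sum1_card.
rewrite [RHS](eq_bigr (fun y : V => (\sum_(x | h x == Some y) 1)%N)) => [|y _]; last first.
  by rewrite sum1_card -hdg.
rewrite (exchange_big_dep (fun x => oin (h x) A)) /=; last first.
  by move=> y x yA /eqP ->.
apply: eq_bigr => x; rewrite inE; case E: (h x) => [y|//] /= yA.
rewrite (big_pred1 y) // => z.
by apply/andP/eqP => [[_ /eqP[]] //|->]; rewrite eqxx.
Qed.

(** * Counting thin edges, and connectedness to the cut edge *)

Section ThinEdgeCounts.
Variable D : braid_diagram.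
Local Notation b := (cut_strand D).
Local Notation n := (height D).
Implicit Types (v : vertex D) (i : strand D) (s u : piece D) (e f : thin_edge D)
  (Gam : {set vertex D}).

Lemma card_goes_in v : #|[pred e | goes_in v e]| = degree v.
Proof.
rewrite -card_meets -(@card_in_image _ _ (fun i => thin (below v i))); last first.
  by move=> i j vi vj /thin_below_inj[].
apply: eq_card => e; apply/goes_inP/imageP => -[i vi ->]; by exists i.
Qed.

Lemma card_goes_out v : #|[pred e | goes_out v e]| = degree v.
Proof.
rewrite -card_meets -(@card_in_image _ _ (fun i => thin (above v i))); last first.
  by move=> i j vi vj /thin_above_inj[].
apply: eq_card => e; apply/goes_outP/imageP => -[i vi ->]; by exists i.
Qed.

Lemma card_ends Gam : #|[pred e | oin (target e) Gam]| = (\sum_(v in Gam) degree v)%N.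
Proof.
by apply: card_oin => v; rewrite -card_goes_in; apply: eq_card => e; rewrite !inE targetE.
Qed.

Lemma card_starts Gam : #|[pred e | oin (source e) Gam]| = (\sum_(v in Gam) degree v)%N.
Proof.
by apply: card_oin => v; rewrite -card_goes_out; apply: eq_card => e; rewrite !inE sourceE.
Qed.

Definition internal Gam := [pred e | oin (source e) Gam && oin (target e) Gam].
Definition incoming Gam := [pred e | oin (target e) Gam && ~~ oin (source e) Gam].
Definition outgoing Gam := [pred e | oin (source e) Gam && ~~ oin (target e) Gam].

Lemma card_outgoing Gam :
  (#|internal Gam| + #|outgoing Gam|)%N = (\sum_(v in Gam) degree v)%N.
Proof. by rewrite -card_starts; exact: card_split. Qed.

(** This count is where the two weights meet: the [+1] framing gives one [t] per internal edge, each
    incoming [y] gives one more, and together they make the sum of degrees. *)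
Lemma card_incoming Gam :
  (#|internal Gam| + #|incoming Gam|)%N = (\sum_(v in Gam) degree v)%N.
Proof. by rewrite -card_ends; exact: card_split_comm. Qed.

Lemma card_out_in Gam : #|outgoing Gam| = #|incoming Gam|.
Proof. exact/(@addnI #|internal Gam|)/(etrans (card_outgoing Gam))/esym/card_incoming. Qed.

Lemma exists_meets v : exists i, meets v i.
Proof.
have /card_gt0P[i vi] : (0 < #|[pred i | meets v i]|)%N.
  by rewrite card_meets /degree; case: ifP.
by exists i.
Qed.

Lemma thin_through v i : ~~ meets v i -> thin (below v i) = thin (above v i).
Proof.
move=> nm; apply/thin_eq/connect1; rewrite /joined; apply/orP; left.
by apply/joined_upP; left; exists v.
Qed.

Lemma thin_closure i : i != ord_max -> thin (i, ord_max) = thin (i, ord0) :> thin_edge D.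
Proof.
move=> im; apply/thin_eq/connect1; rewrite /joined; apply/orP; left.
by apply/joined_upP; right.
Qed.

Lemma thin_climb i (l : 'I_n.+1) :
  (exists v, meets v i /\ thin (i, l) = thin (below v i)) \/
  (thin (i, l) = thin (i, ord_max) :> thin_edge D /\
   forall v, (l <= v)%N -> ~~ meets v i).
Proof.
have [k] := ubnP (n - l)%N; elim: k l => // k IH l lk.
have [ln|ln] := ltnP l n; last first.
  right; have -> : l = ord_max by apply: val_inj; apply/eqP; rewrite eqn_leq leq_ord.
  by split=> // v; rewrite leqNgt ltn_ord.
pose v : vertex D := Ordinal ln; have lv : (i, l) = below v i.
  by rewrite /below; congr pair; apply: val_inj.
have [vi|nvi] := boolP (meets v i); first by left; exists v; rewrite lv.
rewrite lv (thin_through nvi).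
have [|[w wP]|[wE wP]] := IH (fintype.lift ord0 v); first by rewrite /= /bump /=; lia.
  by left; exists w.
right; split=> // w; rewrite leq_eqVlt => /orP[/eqP lw|lw].
  by have -> : w = v by apply: val_inj.
by apply: wP.
Qed.

(** The edge runs upwards, through the closure to the bottom if necessary, and meets a vertex at the
    latest when it returns to [v]. *)
Lemma goes_in_ex v i : meets v i -> i != ord_max ->
  exists w, goes_in w (thin (above v i)).
Proof.
move=> vi imax; have [[w [wi E]]|[E _]] := thin_climb i (fintype.lift ord0 v).
  by exists w; apply/goes_inP; exists i.
have [[w [wi E']]|[_ nm]] := thin_climb i ord0.
  exists w; apply/goes_inP; exists i => //.
  by rewrite /above E (thin_closure imax) E'.
by have := nm v (leq0n v); rewrite vi.
Qed.

Lemma cut_strand_connected (l : 'I_n.+1) :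
  connect (@adjacent D) (thin (ord_max, l)) (cut_edge D).
Proof.
case: l => l; elim: l => [|l IH] ln.
  by rewrite (_ : Ordinal ln = ord0) //; apply: val_inj.
have ln' : (l < n)%N by [].
apply: connect_trans (IH (ltnW ln)); pose v : vertex D := Ordinal ln'.
have -> : (ord_max, Ordinal ln) = above v ord_max by congr pair; apply: val_inj.
have -> : (ord_max, Ordinal (ltnW ln)) = below v ord_max by congr pair; apply: val_inj.
have [vi|nvi] := boolP (meets v ord_max); last by rewrite (thin_through nvi).
apply: connect1; apply/existsP; exists v; rewrite /incident.
have -> : goes_out v (thin (above v ord_max)) by apply/goes_outP; exists ord_max.
have -> : goes_in v (thin (below v ord_max)) by apply/goes_inP; exists ord_max.
by rewrite orbT.
Qed.

(** The potential is constant on a component, and it is [0] on the cut edge, which has no source. *)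
Lemma potential_connected (phi : vertex D -> int) :
  (forall e, connect (@adjacent D) e (cut_edge D)) ->
  (forall e, pot phi (source e) = pot phi (target e)) -> forall v, phi v = 0.
Proof.
move=> conn phiE.
have incE v e : incident v e -> pot phi (source e) = phi v.
  case/orP; first by rewrite -sourceE => /eqP ->.
  by rewrite -targetE phiE => /eqP ->.
have constE e f : connect (@adjacent D) e f -> pot phi (source e) = pot phi (source f).
  case/connectP=> p; elim: p e => [|g p IH] e /=; first by move=> _ ->.
  case/andP=> /existsP[v /andP[ve vg]] gp fE.
  by rewrite (incE _ _ ve) -(incE _ _ vg); apply: IH.
move=> v; have [i vi] := exists_meets v.
have ve : incident v (thin (above v i)) by apply/orP; left; apply/goes_outP; exists i.
rewrite -(incE _ _ ve) (constE _ _ (conn _)).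
case E: (source (cut_edge D)) => [w|//].
by have := not_goes_out_cut w; rewrite -sourceE E eqxx.
Qed.

(** The set consists of the vertices in the component of [e]. An edge leaving it would start on the
    cut strand, which is special, or else end at a vertex of the same component. Counting then
    excludes entering edges. *)
Lemma nonspecial_closed_set e : components_have_vertex D ->
  ~~ connect (@adjacent D) e (cut_edge D) ->
  exists Gam, [/\ Gam != set0, outgoing Gam =1 xpred0 & incoming Gam =1 xpred0].
Proof.
move=> hasv ecut.
pose Gam := [set v | [exists f, connect (@adjacent D) e f && incident v f]].
have inG v f : connect (@adjacent D) e f -> incident v f -> v \in Gam.
  by move=> ef vf; rewrite inE; apply/existsP; exists f; rewrite ef.
have out0 : outgoing Gam =1 xpred0.
  move=> f /=; apply/negbTE/negP => /andP[sf tf].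
  case E: (source f) sf => [v|//] /=; rewrite inE => /existsP[g /andP[eg vg]].
  have vf : goes_out v f by rewrite -sourceE E.
  have ef : connect (@adjacent D) e f.
    apply: connect_trans eg _; apply: connect1; apply/existsP; exists v.
    by rewrite vg /incident vf.
  have /goes_outP[i vi fE] := vf.
  have [imax|imax] := eqVneq i ord_max.
    by case/negP: ecut; apply: connect_trans ef _; rewrite fE imax; exact: cut_strand_connected.
  have [w wf] := goes_in_ex vi imax; rewrite -fE in wf.
  have wG : w \in Gam by apply: (inG w f ef); rewrite /incident wf orbT.
  by move: wf tf; rewrite -targetE => /eqP -> /=; rewrite wG.
have G0 : Gam != set0.
  by have [f [v [ef vf]]] := hasv e; apply/set0Pn; exists v; exact: inG ef vf.
exists Gam; split; [exact: G0 | exact: out0 |].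
have /fintype.card0_eq in0 : #|incoming Gam| = 0%N by rewrite -card_out_in (eq_card0 out0).
by move=> f; exact: in0.
Qed.

End ThinEdgeCounts.

(** * The ideals of a closed braid graph *)

Lemma span_is_submod (E : comNzRingType) (W : lmodType E) (S : W -> Prop) :
  is_submod (fun w => w \in span S).
Proof. by split=> [|a x y xS yS]; rewrite ?rpred0 // rpredD // rpredZ. Qed.

Lemma span_le (E : comNzRingType) (W : lmodType E) (S S' : W -> Prop) :
  (forall w, S w -> w \in span S') -> forall w, w \in span S -> w \in span S'.
Proof.
move=> SS' w /spanP; elim=> [|a x y /SS' xS' _ yS']; first exact: rpred0.
by rewrite rpredD // rpredZ.
Qed.

Lemma scaleN_inv_sub (K : fieldType) (W : lmodType K) (c : K) (x y : W) : c != 0 ->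
  x - c^-1 *: y = - c^-1 *: (y - c *: x).
Proof. by move=> c0; rewrite scaleNr -scalerN opprB scalerBr scalerA mulVf // scale1r. Qed.

Section BraidIdeals.
Variables (F : fieldType) (D : braid_diagram).
Local Notation T := (thin_edge D).
Local Notation L := (laurent F).
Local Notation P := {mpoly L[#|T|]}.
Local Notation t := (tvar F).
Local Notation one_framed := (fun _ : T => 1 : int).
Implicit Types (v : vertex D) (e : T) (Gam : {set vertex D}).

Definition edge_source (i : 'I_#|T|) := source (enum_val i).
Definition edge_target (i : 'I_#|T|) := target (enum_val i).

Lemma prod_x (A : pred T) : \prod_(e | A e) x_ F e = 'X_[mset (fun i : 'I_#|T| => A (enum_val i))].
Proof.
rewrite mpolyXE_id (reindex (fun i : 'I_#|T| => enum_val i : T)) /=; last exact/onW_bij/enum_val_bij.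
rewrite big_mkcond; apply: eq_bigr => i _; rewrite mnmE /x_ enum_valK.
by case: (A _).
Qed.

Lemma mdeg_mset (A : pred T) : mdeg (mset (fun i : 'I_#|T| => A (enum_val i))) = #|A|.
Proof.
rewrite mdegE -sum1_card [RHS]big_mkcond (reindex (fun i : 'I_#|T| => enum_val i : T)) /=; last exact/onW_bij/enum_val_bij.
by apply: eq_bigr => i _; rewrite mnmE -topredE /=; case: (A _).
Qed.

Local Notation binom := (binomial F edge_source edge_target (@degree D)).

Lemma binomialE Gam : binom Gam =
  t ^+ os_weight Gam *: \prod_(e | starts_in Gam e && ~~ ends_in Gam e) x_ F e
  - \prod_(e | ends_in Gam e && ~~ starts_in Gam e) x_ F e.
Proof.
have outE := eq_bigl (fun e => starts_in Gam e && ~~ ends_in Gam e) (x_ F)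
  (fun e => congr2 (fun x y => x && ~~ y) (esym (starts_inE Gam e)) (esym (ends_inE Gam e))).
have inE := eq_bigl (fun e => ends_in Gam e && ~~ starts_in Gam e) (x_ F)
  (fun e => congr2 (fun x y => x && ~~ y) (esym (ends_inE Gam e)) (esym (starts_inE Gam e))).
by rewrite -outE -inE !prod_x.
Qed.

Lemma weight_one_framed Gam : weight one_framed Gam = #|internal Gam|%:Z.
Proof.
rewrite /weight (eq_bigl (fun e => e \in internal Gam)) => [|e]; last first.
  by rewrite starts_inE ends_inE.
by rewrite sumr_const -mulr_natr mul1r natz.
Qed.

Lemma tvar_neq0 : t != 0.
Proof.
apply/eqP => t0; have := tpow_unit F 1; rewrite -[tpow F 1]/t t0 mul0r => /eqP.
by rewrite eq_sym oner_eq0.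
Qed.

Lemma prod_y Gam : \prod_(e | ends_in Gam e && ~~ starts_in Gam e) y_ F one_framed e =
  t ^- #|incoming Gam| *: \prod_(e | ends_in Gam e && ~~ starts_in Gam e) x_ F e.
Proof.
rewrite /y_ scaler_prod; congr (_ *: _).
rewrite (eq_bigl (fun e => e \in incoming Gam)) => [|e]; last first.
  by rewrite starts_inE ends_inE.
by rewrite prodr_const exprN1 exprVn.
Qed.

Lemma nonlocal_genE Gam :
  t ^ weight one_framed Gam *: \prod_(e | starts_in Gam e && ~~ ends_in Gam e) x_ F e
  - \prod_(e | ends_in Gam e && ~~ starts_in Gam e) y_ F one_framed e =
  t ^- #|incoming Gam| *: binom Gam.
Proof.
rewrite binomialE scalerBr scalerA prod_y; congr (_ *: _ - _).
(* The factor [t^-1] of each incoming [y] splits off, leaving exactly the internal edges of the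
   framing weight. *)
have -> : os_weight Gam = (#|internal Gam| + #|incoming Gam|)%N by rewrite card_incoming.
rewrite weight_one_framed -exprnP exprD mulrCA mulVf ?mulr1 //.
by rewrite expf_neq0 // tvar_neq0.
Qed.

Definition above_sum v : P := \sum_(i | meets v i) x_ F (thin (above v i)).
Definition below_sum v : P := \sum_(i | meets v i) x_ F (thin (below v i)).

Lemma linear_genE v :
  \sum_(i | meets v i) x_ F (thin (above v i))
  - \sum_(i | meets v i) y_ F one_framed (thin (below v i)) =
  - t^-1 *: (below_sum v - t *: above_sum v).
Proof.
have -> : \sum_(i | meets v i) y_ F one_framed (thin (below v i)) = t^-1 *: below_sum v.
  exact/esym/scaler_sumr.
exact/scaleN_inv_sub/tvar_neq0.
Qed.

(** [ord0] is a placeholder at bivalent vertices; the linear forms are taken at thick vertices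
    only. *)
Definition right_strand v : strand D :=
  if word v is Thick k then widen_ord (leqnSn _) k else ord0.
Definition left_strand v : strand D :=
  if word v is Thick k then fintype.lift ord0 k else ord0.

Lemma thick_strands v : thick v ->
  right_strand v != left_strand v /\
  meets v =1 (fun i => (i == right_strand v) || (i == left_strand v)).
Proof.
rewrite /thick /right_strand /left_strand; case E: (word v) => [k|//] _; split.
  by rewrite -val_eqE /= neq_ltn ltnSn.
by move=> i; rewrite /meets E -!val_eqE.
Qed.

Definition right_below v : 'I_#|T| := enum_rank (thin (below v (right_strand v))).
Definition left_below v : 'I_#|T| := enum_rank (thin (below v (left_strand v))).

Lemma thick_meets v : thick v -> meets v (right_strand v) /\ meets v (left_strand v).
Proof. by case/thick_strands=> _ mE; rewrite !mE !eqxx orbT. Qed.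

Lemma below_sumE v : thick v -> below_sum v = 'X_(right_below v) + 'X_(left_below v).
Proof.
case/thick_strands=> lr mE; rewrite /below_sum (eq_bigl _ _ mE).
rewrite (bigD1 (right_strand v)) ?eqxx //=; congr (_ + _).
rewrite (big_pred1 (left_strand v)) // => i /=.
have [->|_] := eqVneq i (left_strand v); first by rewrite orbT eq_sym lr.
by rewrite orbF andbN.
Qed.

Definition thick_vertices := enum (fun v : vertex D => thick v).

Lemma thick_verticesE v : (v \in thick_vertices) = thick v.
Proof. by rewrite mem_enum. Qed.

Lemma right_left_below : {in thick_vertices, forall v, right_below v != left_below v}.
Proof.
move=> v; rewrite thick_verticesE => tv; have [mr ml] := thick_meets tv.
have [lr _] := thick_strands tv; apply: contraNneq lr => /enum_rank_inj E.
by have [_ ->] := thin_below_inj mr ml E.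
Qed.

Lemma edge_target_thick : {in thick_vertices, forall v i,
  (edge_target i == Some v) = (i == right_below v) || (i == left_below v)}.
Proof.
move=> v; rewrite thick_verticesE => tv i; rewrite targetE.
have [mr ml] := thick_meets tv; have [_ mE] := thick_strands tv.
rewrite /right_below /left_below -!(can2_eq (@enum_valK T) (@enum_rankK T)).
apply/goes_inP/orP => [[j]|[]/eqP ->].
- by rewrite mE => /orP[]/eqP -> ->; [left | right].
- by exists (right_strand v).
by exists (left_strand v).
Qed.

Lemma above_sum_props v : pol_ge 0 (above_sum v) /\ above_sum v \is 1.-homog.
Proof.
split; last by apply: rpred_sum => i _; rewrite dhomogX /= mdeg1.
apply: big_ind => [|f g|i _]; [exact: pol_ge0 | exact: pol_geD | exact: pol_geX].
Qed.

Definition linear_form v : P :=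
  'X_(right_below v) + 'X_(left_below v) - t *: above_sum v.

Lemma linear_formE v : thick v -> linear_form v = below_sum v - t *: above_sum v.
Proof. by move=> tv; rewrite /linear_form below_sumE. Qed.

Definition linear_forms := [seq linear_form v | v <- thick_vertices].

(** Up to units the generators are forms with reduction [X_(right_below v) + X_(left_below v)],
    adjoined one by one as the vanishing of Tor requires. *)
Lemma span_linear_gen (a : ring_mod P) :
  a \in span (@linear_gen D F one_framed) <->
  adjoin (@zero_sub P (ring_mod P)) linear_forms a.
Proof.
have zP := @zero_submod P (ring_mod P); have aP := adjoin_submod linear_forms zP.
split=> [/spanP|].
  elim=> [|c x y [v [tv ->]] _ IH]; first by case: aP.
  case: aP => _; apply=> //; rewrite linear_genE -linear_formE //.
  apply: ideal_scale; first exact: adjoin_submod.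
  have -> : linear_form v = linear_form v *: (1 : ring_mod P) by rewrite ring_scaleE mulr1.
  by apply: adjoin_mul => //; apply/mapP; exists v; rewrite // thick_verticesE.
move: a; apply: adjoin_ind => [a ->|l a x /mapP[v vts ->] aS]; first exact: rpred0.
rewrite rpredD // ring_scaleE mulrC -ring_scaleE rpredZ //.
rewrite thick_verticesE in vts; rewrite linear_formE //.
have -> : below_sum v - t *: above_sum v = - t *: (- t^-1 *: (below_sum v - t *: above_sum v)).
  by rewrite scalerA mulrNN mulfV ?tvar_neq0 // scale1r.
apply: (ideal_scale _ (span_is_submod _)); apply: gen_span; exists v.
by rewrite -linear_genE.
Qed.

Lemma span_nonlocal_gen (a : ring_mod P) :
  a \in span (@nonlocal_gen D F one_framed) <->
  nonlocal_ideal edge_source edge_target (@degree D) a.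
Proof.
split; apply: span_le => _ [Gam ->].
  rewrite nonlocal_genE; apply: (ideal_scale _ (span_is_submod _)).
  by apply: gen_span; exists Gam.
have -> : binom Gam = t ^+ #|incoming Gam| *: (t ^- #|incoming Gam| *: binom Gam).
  by rewrite scalerA mulfV ?scale1r // expf_neq0 // tvar_neq0.
apply: (ideal_scale _ (span_is_submod _)); apply: gen_span; exists Gam.
by rewrite nonlocal_genE.
Qed.

Lemma edge_balanced Gam : mdeg (mset (leaves edge_source edge_target Gam)) =
  mdeg (mset (enters edge_source edge_target Gam)).
Proof.
apply: etrans (mdeg_mset (outgoing Gam)) _; rewrite card_out_in.
exact: esym (mdeg_mset (incoming Gam)).
Qed.

Lemma degree_gt0 v : (0 < degree v)%N.
Proof. by rewrite /degree; case: ifP. Qed.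

Lemma os_relLN (p : ring_mod P) : @os_rel D F p ->
  p \in span (@linear_gen D F one_framed) \/ p \in span (@nonlocal_gen D F one_framed).
Proof.
case=> [v tv|Gam]; [left | right].
  have -> : t *: above_sum v - below_sum v =
      t *: (- t^-1 *: (below_sum v - t *: above_sum v)).
    by rewrite scalerA mulrN mulfV ?tvar_neq0 // scaleN1r opprB.
  apply: (ideal_scale _ (span_is_submod _)); apply: gen_span; exists v.
  by rewrite -linear_genE.
rewrite -binomialE; apply/span_nonlocal_gen; apply: gen_span; by exists Gam.
Qed.

Lemma linear_gen_os (p : ring_mod P) : @linear_gen D F one_framed p -> p \in span (@os_rel D F).
Proof.
case=> v [tv ->]; rewrite linear_genE.
have -> : - t^-1 *: (below_sum v - t *: above_sum v) = t^-1 *: (t *: above_sum v - below_sum v).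
  by rewrite scaleNr -scalerN opprB.
apply: (ideal_scale _ (span_is_submod _)); apply: gen_span; exact: os_linear.
Qed.

Lemma nonlocal_gen_os (p : ring_mod P) :
  @nonlocal_gen D F one_framed p -> p \in span (@os_rel D F).
Proof.
case=> Gam ->; rewrite nonlocal_genE; apply: (ideal_scale _ (span_is_submod _)).
by apply: gen_span; rewrite binomialE; exact: os_nonlocal.
Qed.

Lemma nonlocal_full : components_have_vertex D ->
  (exists e, ~~ connect (@adjacent D) e (cut_edge D)) ->
  forall a : modquot (@nonlocal_gen D F one_framed), a = 0.
Proof.
move=> hasv [e ecut] a; have [Gam [G0 out0 in0]] := nonspecial_closed_set hasv ecut.
rewrite -[a]modquot_reprK; apply: modquot_pi_eq0; apply/span_nonlocal_gen.
have JP := @nonlocal_submod F _ _ edge_source edge_target (@degree D).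
have bJ := @nonlocal_mul F _ _ edge_source edge_target (@degree D) 1 Gam.
have mset0 (A : pred 'I_#|T|) : A =1 xpred0 -> mset A = 0%MM.
  by move=> A0; apply/mnmP => i; rewrite mnmE A0 mnm0E.
have W0 : (0 < set_weight (@degree D) Gam)%N.
  by case/set0Pn: G0 => v vG; rewrite /set_weight (bigD1 v) //= addn_gt0 degree_gt0.
have bE : binom Gam = (t ^+ set_weight (@degree D) Gam - 1)%:MP.
  rewrite /binomial (mset0 (leaves _ _ _)) => [|i]; last exact: out0.
  rewrite (mset0 (enters _ _ _)) => [|i]; last exact: in0.
  by rewrite mpolyX0 mpolyCB mpolyC1 -mul_mpolyC mulr1.
(* The exponent is positive, so the coefficient at [t^0] is [-1]; a nonzero Laurent series is a
   unit. *)
have nz : t ^+ set_weight (@degree D) Gam - 1 != 0.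
  apply/eqP => /laurentP/(_ 0); rewrite tvarX laurentD laurentN /=.
  have /negPf-> : 0 != (set_weight (@degree D) Gam)%:Z by lia.
  by rewrite sub0r => /eqP; rewrite oppr_eq0 oner_eq0.
have oneJ : nonlocal_ideal edge_source edge_target (@degree D) (1 : P).
  have -> : (1 : P) = (t ^+ set_weight (@degree D) Gam - 1)^-1 *: (1 * binom Gam).
    by rewrite mul1r bE -mul_mpolyC -mpolyCM mulVf.
  exact: ideal_scale.
by have := submodZ (repr a : P) JP oneJ; rewrite ring_scaleE mulr1.
Qed.

Section Connected.
Hypothesis conn : forall e, connect (@adjacent D) e (cut_edge D).

Lemma edge_connected (phi : vertex D -> int) :
  (forall i, pot phi (edge_source i) = pot phi (edge_target i)) -> forall v, phi v = 0.
Proof.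
move=> phiE; apply: potential_connected => // e.
by have := phiE (enum_rank e); rewrite /edge_source /edge_target enum_rankK.
Qed.

Lemma Tor_connected_eq0 i (x : Tor (modquot (@linear_gen D F one_framed))
    (modquot (@nonlocal_gen D F one_framed)) i.+1) : x = 0.
Proof.
have oP : {in thick_vertices, forall v, pol_ge 0 (above_sum v) /\ above_sum v \is 1.-homog}.
  by move=> v _; exact: above_sum_props.
have uts : uniq thick_vertices by exact: enum_uniq.
apply: (Tor_regular_eq0 span_linear_gen).
  exact: (regular_linear_zero uts right_left_below edge_target_thick oP).
have ps (q : modquot (@nonlocal_gen D F one_framed)) : exists f, modquot_pi _ f = q.
  by exists (repr q); exact: modquot_reprK.
(* Regularity on the quotient is pulled back to the edge ring, where the zero submodule becomes the
   non-local ideal. *)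
apply/(regular_preim _ _ ps).
rewrite (_ : (fun m => _) = nonlocal_ideal edge_source edge_target (@degree D)); last first.
  apply: pred_eq => f; rewrite /zero_sub -(linear0 (modquot_pi _)).
  split=> [/modquot_pi_eq|fJ]; first by rewrite subr0 => /span_nonlocal_gen.
  by apply/modquot_pi_eq; rewrite subr0; apply/span_nonlocal_gen.
exact: (regular_linear_nonlocal degree_gt0 edge_connected edge_balanced uts right_left_below
  edge_target_thick oP).
Qed.

End Connected.

(** With a nonspecial component the second argument of Tor is zero. Without one, the exterior factor
    vanishes for [j > 0], its module having no generators, and Tor vanishes for [i > 0]. *)
Lemma graph_homology_eq0 i j : components_have_vertex D -> (0 < i + j)%N ->
  forall x : graph_homology F one_framed i j, x = 0.
Proof.
move=> hasv ij.
have [nonconn|conn] := pselect (exists e, ~~ connect (@adjacent D) e (cut_edge D)).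
  by apply: tensor_eq0l; apply: Tor_eq0r; exact: nonlocal_full.
have conn' e : connect (@adjacent D) e (cut_edge D).
  by apply: contrapT => /negP ne; apply: conn; exists e.
case: i ij => [|i] ij; last by apply: tensor_eq0l => x; exact: Tor_connected_eq0.
case: j ij => [//|j] _; apply: tensor_eq0r; apply: ext_power_eq0 => v.
apply: free_eqP => -[e he]; have /andP[_ ne] := he.
by have := conn' e; rewrite (negPf ne).
Qed.

Lemma graph_homology00 : lin_iso (graph_homology F one_framed 0 0) (os_algebra D F).
Proof.
exact: (Tor0_ext0_iso (free_module (edge_ring D F) (nonspecial D))
  linear_gen_os nonlocal_gen_os os_relLN).
Qed.

End BraidIdeals.

Theorem proposition2p2 (F : fieldType) (G : closed_braid_graph) :
  bigraded_iso
    (@graph_homology G F (fun _ : thin_edge G => 1))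
    (in_degree0 (os_algebra G F)).
Proof.
have hasv : components_have_vertex G by case: G.
move=> [|i] [|j]; first exact: graph_homology00.
all: by apply: lin_iso_eq0 => [|m]; [exact: graph_homology_eq0 | apply/rowP => -[]].
Qed.
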